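(* Suppose that $\psi\in L^1(\mathbb R^n)$ satisfies $\int_{\mathbb R^n}\psi(x)\,dx=0$, $|\psi(x)|\leq C_1(1+|x|)^{-(n+1)}$ and $|\nabla\psi(x)|\leq C_2(1+|x|)^{-(n+2)}$ for all $x\in\mathbb R^n$, with positive constants $C_1,C_2$ independent of $x$. If $f\in \mathrm{BMO}(\mathbb R^n)$, then $\mathcal{G}(f)$ is either infinite everywhere or finite almost everywhere, and in the latter case $$\big\|\mathcal{G}(f)\big\|_{\mathrm{BLO}}\leq C\big\|f\big\|_{\mathrm{BMO}},$$ where $C>0$ is a constant independent of $f$.
   Context: $\psi$ is real-valued. For $t>0$, $\psi_t(x):=t^{-n}\psi(x/t)$, and $\mathcal{G}(f)(x):=\big(\int_0^\infty|\psi_t*f(x)|^2\frac{dt}{t}\big)^{1/2}$. Here $\nabla=(\partial/\partial x_1,\dots,\partial/\partial x_n)$. $m$ denotes Lebesgue measure. For $f\in L^1_{\mathrm{loc}}(\mathbb R^n)$, $f_B:=\frac1{m(B)}\int_Bf\,dx$ and $\|f\|_{\mathrm{BMO}}:=\sup_B\frac1{m(B)}\int_B|f(x)-f_B|\,dx$ over all balls $B$; $\mathrm{BMO}(\mathbb R^n)$ is the set of $f$ with $\|f\|_{\mathrm{BMO}}<\infty$. $\|f\|_{\mathrm{BLO}}$ is the smallest $C$ such that $\frac1{m(B)}\int_B\big[f(x)-\mathrm{ess\,inf}_{y\in B}f(y)\big]dx\leq C$ for every ball $B$. *)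

(* Defs.v *)
From HB Require Import structures.
From mathcomp Require Import all_boot all_order all_algebra.
From mathcomp Require Import all_classical all_reals all_analysis.
From mathcomp Require Import measurable_realfun ess_sup_inf.
Set Implicit Arguments.
Unset Strict Implicit.
Unset Printing Implicit Defensive.
Import Order.TTheory GRing.Theory Num.Theory.
Import numFieldNormedType.Exports.
Local Open Scope classical_set_scope.
Local Open Scope ring_scope.

(* R^n is 'rV[R]_n.  The library norm on 'rV[R]_n is the sup norm; it is only
   used through the topology (compactness, partial derivatives), the Euclidean
   norm being [enorm] below. *)

Definition measure_rV_display : measure_display -> measure_display.
Proof. exact. Qed.

(* The product sigma-algebra, as for n.-tuple T in the library; for a realType
   it is the Borel sigma-algebra of R^n. *)
Section measurable_rV.
Context {d} {T : measurableType d}.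
Variable n : nat.

Let coors : 'I_n -> 'rV[T]_n -> T := fun i x => x ord0 i.

Let rV_set0 : g_sigma_preimage coors set0.
Proof. exact: sigma_algebra0. Qed.

Let rV_setC A : g_sigma_preimage coors A -> g_sigma_preimage coors (~` A).
Proof. exact: sigma_algebraC. Qed.

Let rV_bigcup (F : (set 'rV[T]_n)^nat) :
  (forall i, g_sigma_preimage coors (F i)) ->
  g_sigma_preimage coors (\bigcup_i (F i)).
Proof. exact: sigma_algebra_bigcup. Qed.

HB.instance Definition _ := @isMeasurable.Build (measure_rV_display d)
  'rV[T]_n (g_sigma_preimage coors) rV_set0 rV_setC rV_bigcup.

End measurable_rV.

Lemma measurable_coord d (T : measurableType d) n (i : 'I_n) :
  measurable_fun [set: 'rV[T]_n] (fun x : 'rV[T]_n => x ord0 i).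
Proof.
move=> _ Y mY; rewrite setTI; apply: sub_sigma_algebra => /=.
rewrite -bigcup_seq/=; exists i => /=; first by rewrite mem_index_enum.
by exists Y => //; rewrite setTI.
Qed.

Lemma measurable_fun_rVP d1 d2 (T1 : measurableType d1)
    (T2 : measurableType d2) n (f : T1 -> 'rV[T2]_n) :
  (forall i, measurable_fun [set: T1] (fun t => f t ord0 i)) ->
  measurable_fun [set: T1] f.
Proof.
move=> mf.
suff prefS : g_sigma_preimage (fun i => (fun x : 'rV[T2]_n => x ord0 i) \o f)
    `<=` measurable.
  rewrite g_sigma_preimage_comp in prefS.
  by move=> _ A mA; apply: prefS; exists A.
apply: smallest_sub; first exact: sigma_algebra_measurable.
case: n => [|n] in f mf *; first by rewrite big_ord0.
rewrite -bigcup_mkord_ord; apply: bigcup_sub => i Ii.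
by move=> A [B mB <-]; exact: mf.
Qed.

Section lebesgue_rV.
Context {R : realType}.

Definition cons_rV n (p : measurableTypeR R * 'rV[R]_n) : 'rV[R]_n.+1 :=
  row_mx (const_mx p.1 : 'rV[R]_1) p.2.

Lemma measurable_cons_rV n : measurable_fun setT (@cons_rV n).
Proof.
apply: measurable_fun_rVP => i.
case: (splitP (i : 'I_(1 + n))) => j ij.
- have -> : i = lshift n j by exact/val_inj.
  rewrite (_ : (fun t => _) = fst); first exact: measurable_fst.
  by apply/funext => -[x y]; rewrite /cons_rV (@row_mxEl _ 1 1 n) mxE.
- have -> : i = rshift 1 j by exact/val_inj.
  rewrite (_ : (fun t => _) = (fun x : 'rV[R]_n => x ord0 j) \o snd); last first.
    by apply/funext => -[x y]; rewrite /cons_rV (@row_mxEr _ 1 1 n).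
  by apply: measurableT_comp; [exact: measurable_coord|exact: measurable_snd].
Qed.

(* Lebesgue measure on the Borel sets of R^n, as the n-fold product of the
   one-dimensional one. *)
Fixpoint lebesgue_rV n : set 'rV[R]_n -> \bar R :=
  match n with
  | 0 => dirac (0 : 'rV[R]_0)
  | m.+1 => pushforward (lebesgue_measure \x @lebesgue_rV m)%E (@cons_rV m)
  end.

Let uncons_rV n (x : 'rV[R]_n.+1) : measurableTypeR R * 'rV[R]_n :=
  (x ord0 ord0, \row_j x ord0 (rshift 1 j)).

Let measurable_uncons_rV n : measurable_fun setT (@uncons_rV n).
Proof.
apply/measurable_fun_pairP; split; first exact: measurable_coord.
apply: measurable_fun_rVP => i.
rewrite (_ : (fun t => _) = fun x : 'rV[R]_n.+1 => x ord0 (rshift 1 i)).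
  exact: measurable_coord.
by apply/funext => x; rewrite mxE.
Qed.

Let cons_rVK n : cancel (@cons_rV n) (@uncons_rV n).
Proof.
move=> [x y]; rewrite /uncons_rV /cons_rV; congr pair.
  have -> : ord0 = lshift n (ord0 : 'I_1) :> 'I_(1 + n) by exact/val_inj.
  by rewrite (@row_mxEl _ 1 1 n) mxE.
by apply/rowP => j; rewrite mxE (@row_mxEr _ 1 1 n).
Qed.

Let lebesgue_rV_subproof n :
  [/\ @lebesgue_rV n set0 = 0%E, forall A, (0 <= @lebesgue_rV n A)%E,
      semi_sigma_additive (@lebesgue_rV n) & sigma_finite setT (@lebesgue_rV n)].
Proof.
elim: n => [|n [m0 m_ge0 m_add m_fin]].
  split; [exact: measure0|exact: measure_ge0|exact: measure_semi_sigma_additive|].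
  apply: fin_num_fun_sigma_finite; first by rewrite /lebesgue_rV measure0.
  by move=> A mA /=; rewrite /dirac.
pose mM := isMeasure.Build _ _ _ (@lebesgue_rV n) m0 m_ge0 m_add.
pose M : {measure set 'rV[R]_n -> \bar R} := HB.pack (@lebesgue_rV n) mM.
pose mF := @Measure_isSigmaFinite.Build _ _ _ M m_fin.
pose m : {sigma_finite_measure set 'rV[R]_n -> \bar R} := HB.pack (@lebesgue_rV n) mM mF.
have mC := @measurable_cons_rV n.
pose Q := measure_function_pushforward__canonical__measure_function_Measure
  [the measure _ _ of (@lebesgue_measure R \x m)%E] mC.
have QE : @lebesgue_rV n.+1 = Q by [].
split; [exact: (measure0 Q)|exact: (measure_ge0 Q)|
        exact: (@measure_semi_sigma_additive _ _ _ Q)|].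
have /sigma_finiteP[F [TF ndF Foo]] := sigma_finiteT (@lebesgue_measure R).
have /sigma_finiteP[G [TG ndG Goo]] := sigma_finiteT m.
exists (fun k => @uncons_rV n @^-1` (F k `*` G k)).
  rewrite -preimage_bigcup -[LHS](preimage_setT (@uncons_rV n)); congr (_ @^-1` _).
  rewrite -setXTT TF TG predeqE => -[x y]; split.
    move=> [/= [a _ Fax] [b _ Gby]]; exists (maxn a b) => //; split.
    - by move: x Fax; exact/subsetPset/ndF/leq_maxl.
    - by move: y Gby; exact/subsetPset/ndG/leq_maxr.
  by move=> [k _ []/= ? ?]; split; exists k.
move=> k; have [mF1 Fkoo] := Foo k; have [mG1 Gkoo] := Goo k; split.
  rewrite -[X in measurable X]setTI; apply: measurable_uncons_rV => //.
  exact: measurableX.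
have QX A : Q (@uncons_rV n @^-1` A) = (@lebesgue_measure R \x m)%E A.
  rewrite /Q /= /pushforward -comp_preimage.
  by rewrite (_ : _ \o _ = id) //; apply/funext => x /=; rewrite cons_rVK.
rewrite QE QX (@product_measure1E _ _ _ _ _ (@lebesgue_measure R) m)//.
by rewrite lte_mul_pinfty// ge0_fin_numE.
Qed.

HB.instance Definition _ n := isMeasure.Build _ _ _ (@lebesgue_rV n)
  (let: And4 m0 _ _ _ := lebesgue_rV_subproof n in m0)
  (let: And4 _ m_ge0 _ _ := lebesgue_rV_subproof n in m_ge0)
  (let: And4 _ _ m_add _ := lebesgue_rV_subproof n in m_add).

HB.instance Definition _ n := @Measure_isSigmaFinite.Build _ _ _ (@lebesgue_rV n)
  (let: And4 _ _ _ m_fin := lebesgue_rV_subproof n in m_fin).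

Lemma lebesgue_rV_box n (A : 'I_n -> set R) :
  (forall i, measurable (A i)) ->
  @lebesgue_rV n [set x | forall i, A i (x ord0 i)] =
  (\prod_(i < n) lebesgue_measure (A i))%E.
Proof.
elim: n A => [|n IHn] A mA.
  by rewrite big_ord0 /= diracE mem_set// => -[].
have mB : measurable [set x : 'rV[R]_n | forall i, A (lift ord0 i) (x ord0 i)].
  rewrite (_ : mkset _ = \bigcap_(i in [set: 'I_n])
      ((fun x : 'rV[R]_n => x ord0 i) @^-1` A (lift ord0 i))).
    apply: fin_bigcap_measurable => // i _.
    by rewrite -[X in measurable X]setTI; exact: measurable_coord.
  by apply/seteqP; split => x /= Ax i; [move=> _; exact: Ax|exact: Ax].
rewrite big_ord_recl -(IHn (fun i => A (lift ord0 i)))//.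
rewrite -(@product_measure1E _ _ _ _ _ (@lebesgue_measure R) (@lebesgue_rV n))//.
  congr ((_ \x _)%E _); apply/seteqP; split => [[x y] /= Axy|[x y] /= [Ax Ay] i].
    split.
      have := Axy ord0; have -> : ord0 = lshift n (ord0 : 'I_1) :> 'I_(1 + n).
        exact/val_inj.
      by rewrite /cons_rV (@row_mxEl _ 1 1 n) mxE.
    move=> i; have := Axy (lift ord0 i).
    have -> : lift ord0 i = rshift 1 i :> 'I_(1 + n) by exact/val_inj.
    by rewrite /cons_rV (@row_mxEr _ 1 1 n).
  case: (unliftP ord0 i) => [j|] ->.
    have := Ay j; have -> : lift ord0 j = rshift 1 j :> 'I_(1 + n) by exact/val_inj.
    by rewrite /cons_rV (@row_mxEr _ 1 1 n).
  move: Ax; have -> : ord0 = lshift n (ord0 : 'I_1) :> 'I_(1 + n) by exact/val_inj.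
  by rewrite /cons_rV (@row_mxEl _ 1 1 n) mxE.
exact: mA.
Qed.

End lebesgue_rV.
Arguments lebesgue_rV {R n}.

Section euclidean.
Context {R : realType} {n : nat}.
Implicit Types (x c : 'rV[R]_n) (r : R).

Definition enorm x : R := Num.sqrt (\sum_(i < n) x ord0 i ^+ 2).

Definition eball c r : set 'rV[R]_n := [set x | enorm (x - c) < r].

Lemma measurable_enorm_sub c :
  measurable_fun [set: 'rV[R]_n] (fun x => enorm (x - c)).
Proof.
apply: (@measurableT_comp _ _ _ _ _ _ (@Num.sqrt R)).
  by apply: continuous_measurable_fun; exact: sqrt_continuous.
apply: measurable_sum => i; apply: measurable_funX.
rewrite (_ : (fun x => _) = fun x : 'rV[R]_n => x ord0 i - c ord0 i).
  by apply: measurable_funB; [exact: measurable_coord|exact: measurable_cst].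
by apply/funext => x; rewrite !mxE.
Qed.

Lemma measurable_eball c r : measurable (eball c r).
Proof.
rewrite (_ : eball c r = (fun x => enorm (x - c)) @^-1` `]-oo, r[%classic).
  by rewrite -[X in measurable X]setTI; exact: measurable_enorm_sub.
by apply/seteqP; split => x /=; rewrite /eball /= in_itv.
Qed.

(* Vector of partial derivatives, meaningful only where [derivable] holds in
   every coordinate direction. *)
Definition gradient (psi : 'rV[R]_n -> R) x : 'rV[R]_n :=
  \row_(i < n) 'D_(delta_mx ord0 i) psi x.

End euclidean.

Section bmo_blo.
Context {R : realType} {n : nat}.
Implicit Types (f : 'rV[R]_n -> R) (g : 'rV[R]_n -> \bar R).
Local Open Scope ereal_scope.
Local Notation mu := (@lebesgue_rV R n).

(* [lebesgue_rV] lives on the Borel sigma-algebra; Lebesgue measurability is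
   measurability for its completion.  The integral against [lebesgue_rV] of a
   Lebesgue measurable function is the usual one: the library integral of the
   positive and negative parts is a supremum over Borel simple functions. *)
Definition lebesgue_measurable_fun f :=
  forall Y : set R, measurable Y -> completed_algebra_gen mu (f @^-1` Y).

Definition locally_integrable_rV f := lebesgue_measurable_fun f /\
  forall K : set 'rV[R]_n, compact K -> \int[mu]_(x in K) `|f x|%:E < +oo.

Definition mean (B : set 'rV[R]_n) g : \bar R :=
  ((fine (mu B))^-1)%:E * \int[mu]_(x in B) g x.

Definition BMO_norm f : \bar R :=
  ereal_sup [set mean (eball c r)
                   (fun x => `|(f x)%:E - mean (eball c r) (EFin \o f)|)
            | c in [set: 'rV[R]_n] & r in [set r : R | (0 < r)%R]].

Definition BMO : set ('rV[R]_n -> R) :=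
  [set f | locally_integrable_rV f /\ BMO_norm f < +oo].

Definition ess_inf_ball c r g : \bar R :=
  ess_inf (mrestr mu (measurable_eball c r)) g.

(* Stated for extended-real functions since square functions may take the
   value +oo (on a null set). *)
Definition BLO_norm g : \bar R :=
  ereal_inf [set C%:E | C in [set C : R | forall c r, (0 < r)%R ->
    mean (eball c r) (fun x => g x - ess_inf_ball c r g) <= C%:E]].

End bmo_blo.

Section square_function.
Context {R : realType} {n : nat}.
Implicit Types (psi f : 'rV[R]_n -> R) (x : 'rV[R]_n) (t : R).
Local Open Scope ereal_scope.

Definition dilate psi t x : R := (t ^- n * psi (t^-1 *: x))%R.

Definition convolution psi f x : \bar R :=
  \int[@lebesgue_rV R n]_y (psi (x - y) * f y)%:E.

Definition square_fun psi f x : \bar R :=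
  sqrte (\int[lebesgue_measure]_(t in `]0%R, +oo[%classic)
    (`|convolution (dilate psi t) f x| ^+ 2 * (t^-1)%:E)).

End square_function.

(* Main.v *)
(* Write p_t for the dilate of psi: it is dominated by t / (t + |x|)^(n+1),
   Lipschitz at scale t, and has mean zero.  These properties make the kernel of
   the composition of convolution by p_s and by p_t decay like
   (min(s,t) / max(s,t))^(1/2), so Schur's test and a TT* argument give
   \int \int |p_t * h|^2 dx dt/t <= C \int h^2.
   On a ball B of radius r, split f - f_Q (Q a cube containing the double of B)
   into its restrictions to Q and to the complement: the first one is bounded in
   L2 by the John-Nirenberg inequality, which is proved on dyadic trees, and the
   convolution of p_t with the second one is O(t/r) on B.  Hence
   S(x) = \int_0^r |p_t * f(x)|^2 dt/t satisfies
   \int_B S <= C N^2 |B|, where N is the BMO norm.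
   For t > r and x, x' in B, |p_t * f(x) - p_t * f(x')| <= C N r/t; integrating
   in t gives G(x) <= S(x)/N + C N + G(x') for all x, x' in B.
   Finiteness of G at one point x' thus gives finiteness almost everywhere on
   every ball around it, and taking the essential infimum over x', then the mean
   over x, gives the BLO bound. *)

From HB Require Import structures.
Require Import Defs.
From mathcomp Require Import all_boot all_order all_algebra.
From mathcomp Require Import all_classical all_reals all_analysis.
From mathcomp Require Import measurable_realfun ess_sup_inf ring lra.
Set Implicit Arguments.
Unset Strict Implicit.
Unset Printing Implicit Defensive.
Import Order.TTheory GRing.Theory Num.Theory.
Import numFieldNormedType.Exports.
Local Open Scope classical_set_scope.
Local Open Scope ring_scope.

(** * Integration *)

(** The square root in the decay of the composed kernels comes from the decay of [psi]. The mean
    zero of one kernel is paired with the smoothness of the other, which brings in a moment of t /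
    (t + |x|)^(n+1); the first moment diverges logarithmically and the moment of order 1/2 does not,
    so the Lipschitz bound is interpolated with the size bound. The local part of f is never itself
    bounded in L2. John-Nirenberg runs on finitely many generations of cubes and bounds the step
    functions made of averages of f, uniformly in the number of generations. These are bounded with
    bounded support, as the exchanges of integrals in the TT* argument require. Their convolutions
    with p_t converge at every point because p_t is Lipschitz, and Fatou's lemma gives the estimate
    for f without any differentiation theorem. N is any positive bound of the BMO norm, since the
    comparison divides by it: sqrt(S) <= S/N + N makes the local energy enter linearly, so that its
    integral over the ball suffices. A zero norm is reached by letting N tend to it. *)

Section integral_no_measurability.
Local Open Scope ereal_scope.
Context d (T : measurableType d) (R : realType) (mu : {measure set T -> \bar R}).
Import HBNNSimple.

(* Monotonicity holds without measurability, since the library integral of a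
   nonnegative function is a supremum over the simple functions below it. *)
Lemma le_integral_gen (D : set T) (f g : T -> \bar R) :
  (forall x, D x -> 0 <= g x) -> (forall x, D x -> f x <= g x) ->
  \int[mu]_(x in D) f x <= \int[mu]_(x in D) g x.
Proof.
move=> g0 fg.
rewrite integralE (le_trans (y := \int[mu]_(x in D) f^\+ x))//.
  by rewrite geeDl// oppe_le0 integral_ge0.
rewrite !ge0_integralE//; apply: ge_ereal_sup => _ [h /= hf <-].
apply: ereal_sup_ubound; exists h; last by []. move=> x /=.
apply: le_trans (hf x) _; rewrite /patch; case: ifP => //; rewrite inE => Dx.
by rewrite funeposE ge_max fg// g0.
Qed.

(** A simple function below [f] can be integrated off [N] only, and there it lies below [g]. The
    argument applies to nonmeasurable integrands too. *)
Lemma integral_null_le (N : set T) (f g : T -> \bar R) :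
  measurable N -> mu N = 0 -> (forall x, 0 <= f x) -> (forall x, 0 <= g x) ->
  (forall x, ~ N x -> f x <= g x) -> \int[mu]_x f x <= \int[mu]_x g x.
Proof.
move=> mN N0 f0 g0 fg.
rewrite [leLHS]ge0_integralTE//; apply: ge_ereal_sup => _ [h /= hf <-].
have mh : measurable_fun [set: T] (fun x => (h x)%:E) by exact/measurable_EFinP.
rewrite -integralT_nnsfun (@ge0_negligible_integral _ _ _ _ _ N)//; last first.
  by move=> x _; rewrite lee_fin.
rewrite integral_mkcond; apply: le_integral_gen => // x _.
rewrite /patch; case: ifP => //; rewrite inE /= => -[_ Nx].
by rewrite (le_trans (hf x))// fg.
Qed.

(** Lets a Lebesgue measurable integrand be replaced by a Borel one, with one null set serving all
    domains [D]. *)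
Lemma integral_null_eq (N D : set T) (f g : T -> \bar R) :
  measurable N -> mu N = 0 -> (forall x, ~ N x -> f x = g x) ->
  \int[mu]_(x in D) f x = \int[mu]_(x in D) g x.
Proof.
move=> mN N0 fg; rewrite [LHS]integral_mkcond [RHS]integral_mkcond.
rewrite [LHS]integralE [RHS]integralE; congr (_ - _); apply/eqP;
  rewrite eq_le; apply/andP; split; apply: (integral_null_le mN) => // x Nx;
  by rewrite ?funeposE ?funenegE /patch fg.
Qed.

End integral_no_measurability.

Section borel_version.
Context d (T : measurableType d) (R : realType) (mu : {measure set T -> \bar R}).

(** For rational q the set where f > q agrees with a Borel set A_q off a null set. The union [N] of
    these countably many null sets is null; [g] is [f] off [N] and 0 on it, and off [N] the set
    where g > a is the union of the A_q over q > a. Unions over rationals are taken along their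
    codes in [nat]. *)
Lemma completed_measurable_borel (f : T -> R) :
  (forall Y : set R, measurable Y -> completed_algebra_gen mu (f @^-1` Y)) ->
  exists g N, [/\ measurable_fun [set: T] g, measurable N, mu N = 0%E &
    forall x, ~ N x -> f x = g x].
Proof.
move=> mf.
have H (q : rat) : exists AM : set T * set T, [/\ measurable AM.1,
    measurable AM.2, mu AM.2 = 0%E &
    forall x, ~ AM.2 x -> (ratr q < f x)%R <-> AM.1 x].
  have := mf `]ratr q, +oo[%classic (measurable_itv _).
  move=> [A mA [N [M [mM M0 NM]]] AN].
  exists (A, M); split => //= x Mx.
  have -> : (ratr q < f x) = (f @^-1` `]ratr q, +oo[%classic) x :> Prop.
    by rewrite /= in_itv/= andbT.
  rewrite -AN; split => [[//|/NM//]|Ax]; by left.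
have [AM AMP] := choice H.
pose F k := if @unpickle rat k is Some q then (AM q).2 else set0.
have mF k : measurable (F k).
  by rewrite /F; case: unpickle => [q|//]; case: (AMP q).
have F0 k : mu (F k) = 0%E.
  by rewrite /F; case: unpickle => [q|]; [case: (AMP q)|exact: measure0].
pose N := \bigcup_k F k.
have mN : measurable N by exact: bigcupT_measurable.
have N0 : mu N = 0%E.
  by apply/negligibleP => //; apply: negligible_bigcup => k;
    apply/negligibleP; [exact: mF|exact: F0].
have NP x q : ~ N x -> (ratr q < f x) <-> (AM q).1 x.
  move=> Nx; case: (AMP q) => _ _ _; apply => AMx; apply: Nx.
  exists (pickle q); [exact: I|by rewrite /F pickleK].
exists (fun x => if x \in N then 0 else f x), N; split => //; last first.
  by move=> x Nx; rewrite memNset.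
apply: (measurability _ (RGenOInfty.measurableE R)) => _ [_ [a ->] <-].
rewrite setTI.
have -> : (fun x => if x \in N then 0 else f x) @^-1` `]a, +oo[ =
   (N `&` [set x | a < 0]) `|` (~` N `&` \bigcup_(q in [set q : rat | a < ratr q]) (AM q).1).
  apply/seteqP; split => x /=; rewrite in_itv/= andbT.
    case: ifPn => [/set_mem|]; first by left.
    rewrite notin_setE => Nx /rat_in_itvoo[q]; rewrite in_itv/= => /andP[aq qf].
    by right; split => //; exists q => //; apply/NP.
  move=> [[Nx a0]|[Nx [q /= aq /NP]]]; first by rewrite mem_set.
  by move=> qf; rewrite memNset// (lt_trans aq)// qf.
apply: measurableU.
  apply: measurableI => //; have [a0|a0] := boolP (a < 0).
    rewrite [X in measurable X](_ : _ = setT); first exact: measurableT.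
    by apply/seteqP; split.
  rewrite [X in measurable X](_ : _ = set0); first exact: measurable0.
  by apply/seteqP; split => x //=; rewrite (negbTE a0).
apply: measurableI; first exact: measurableC.
have -> : \bigcup_(q in [set q : rat | a < ratr q]) (AM q).1 =
    \bigcup_k (if @unpickle rat k is Some q then
                if a < ratr q then (AM q).1 else set0 else set0).
  apply/seteqP; split => x [].
    move=> q /= aq Ax; exists (pickle q); [exact: I|by rewrite pickleK aq].
  by move=> k _; case: unpickle => [q|//]; case: ifP => // aq Ax; exists q.
apply: bigcupT_measurable => k; case: unpickle => [q|//]; case: ifP => // _.
by case: (AMP q).
Qed.

End borel_version.

Section integral_param.
Local Open Scope ereal_scope.
Context d1 d2 (X : measurableType d1) (Z : measurableType d2) (R : realType).
Context (m1 : {sigma_finite_measure set X -> \bar R}).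
Context (m2 : {sigma_finite_measure set Z -> \bar R}).

Lemma measurable_integral_param (g : X * Z -> \bar R) :
  measurable_fun [set: X * Z] g ->
  measurable_fun [set: X] (fun x => \int[m2]_z g (x, z)).
Proof.
move=> mg; rewrite (_ : (fun x => _) =
    (fun x => \int[m2]_z g^\+ (x, z) - \int[m2]_z g^\- (x, z))); last first.
  apply/funext => x; rewrite [LHS]integralE.
  by congr (_ - _); apply: eq_integral => z _; rewrite ?funeposE ?funenegE.
apply: emeasurable_funB.
  apply: (measurable_fun_fubini_tonelli_F (m2 := m2)) => [|x'].
    exact: measurable_funepos.
  by rewrite funepos_ge0.
by apply: (measurable_fun_fubini_tonelli_F (m2 := m2)); first exact: measurable_funeneg.
Qed.

Lemma measurable_Rintegral_param (g : X * Z -> R) :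
  measurable_fun [set: X * Z] g ->
  measurable_fun [set: X] (fun x => \int[m2]_z g (x, z))%R.
Proof.
move=> mg; apply: (@measurableT_comp _ _ _ _ _ _ (@fine R)) => //.
by apply: (measurable_integral_param (g := EFin \o g)); exact/measurable_EFinP.
Qed.

(** All slices, and not just almost all, are assumed integrable, so that [fine] loses nothing inside
    the iterated real integrals. *)
Lemma Rfubini (g : X * Z -> R) : measurable_fun [set: X * Z] g ->
  (forall x, \int[m2]_z `|g (x, z)|%:E < +oo) ->
  (forall z, \int[m1]_x `|g (x, z)|%:E < +oo) ->
  \int[m1]_x \int[m2]_z `|g (x, z)|%:E < +oo ->
  (\int[m1]_x (\int[m2]_z g (x, z)) = \int[m2]_z (\int[m1]_x g (x, z)))%R.
Proof.
move=> mg fx fz fxz.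
have mG : measurable_fun [set: X * Z] (EFin \o g) by exact/measurable_EFinP.
have ix x : m2.-integrable setT (fun z => (g (x, z))%:E).
  by apply/integrableP; split; [exact: (measurableT_comp mG)|exact: fx].
have iz z : m1.-integrable setT (fun x => (g (x, z))%:E).
  by apply/integrableP; split; [exact: (measurableT_comp mG)|exact: fz].
have := @Fubini _ _ _ _ _ m1 m2 (EFin \o g).
rewrite /Rintegral => H; congr fine.
under eq_integral do rewrite fineK ?integrable_fin_num//.
under [RHS]eq_integral do rewrite fineK ?integrable_fin_num//.
apply: H; apply/integrableP; split => //.
by rewrite (fubini_tonelli1 (fun z => `|(EFin \o g) z|))//; exact: measurableT_comp.
Qed.

End integral_param.

(** * Schur test for TT* *)

Section bounds.
Local Open Scope ereal_scope.
Context d (T : measurableType d) (R : realType) (mu : {measure set T -> \bar R}).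

(** The form given to most estimates below: only the majorant [g] has to be measurable, and a real
    bound on its integral gives finiteness at the same time. *)
Lemma integral_le_mul (D : set T) (b c : R) (f g : T -> R) : measurable D ->
  (0 <= b)%R -> measurable_fun D g -> (forall x, D x -> (0 <= g x)%R) ->
  (forall x, D x -> (f x <= b * g x)%R) -> \int[mu]_(x in D) (g x)%:E <= c%:E ->
  \int[mu]_(x in D) (f x)%:E <= (b * c)%:E.
Proof.
move=> mD b0 mg g0 fg gc.
apply: (@le_trans _ _ (\int[mu]_(x in D) (b%:E * (g x)%:E))).
  apply: le_integral_gen => x Dx; first by rewrite -EFinM lee_fin mulr_ge0// g0.
  by rewrite -EFinM lee_fin fg.
have mG : measurable_fun D (EFin \o g) by exact/measurable_EFinP.
by rewrite ge0_integralZl// EFinM lee_wpmul2l.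
Qed.

Lemma integral_lty_mul (D : set T) (b c : R) (f g : T -> R) : measurable D ->
  (0 <= b)%R -> measurable_fun D g -> (forall x, D x -> (0 <= g x)%R) ->
  (forall x, D x -> (f x <= b * g x)%R) -> \int[mu]_(x in D) (g x)%:E <= c%:E ->
  \int[mu]_(x in D) (f x)%:E < +oo.
Proof.
move=> mD b0 mg g0 fg gc.
by apply: le_lt_trans (integral_le_mul mD b0 mg g0 fg gc) _; rewrite ltry.
Qed.

Lemma integrable_abs_lty (D : set T) (f : T -> R) :
  measurable_fun D f -> \int[mu]_(x in D) `|f x|%:E < +oo ->
  mu.-integrable D (EFin \o f).
Proof.
by move=> mf foo; apply/integrableP; split; [exact/measurable_EFinP|exact: foo].
Qed.

Lemma integrable_scale (D : set T) (r : R) (f : T -> R) : measurable D ->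
  mu.-integrable D (EFin \o f) -> mu.-integrable D (EFin \o (fun x => r * f x)%R).
Proof.
move=> mD fi; rewrite (_ : _ \o _ = fun x => r%:E * (f x)%:E); last first.
  by apply/funext => x; rewrite /= EFinM.
exact: integrableZl.
Qed.

Lemma integrable_addr (D : set T) (f g : T -> R) : measurable D ->
  mu.-integrable D (EFin \o f) -> mu.-integrable D (EFin \o g) ->
  mu.-integrable D (EFin \o (fun x => f x + g x)%R).
Proof. by move=> mD fi gi; exact: (integrableD mD fi gi). Qed.

Lemma integrable_subr (D : set T) (f g : T -> R) : measurable D ->
  mu.-integrable D (EFin \o f) -> mu.-integrable D (EFin \o g) ->
  mu.-integrable D (EFin \o (fun x => f x - g x)%R).
Proof. by move=> mD fi gi; exact: (integrableB mD fi gi). Qed.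

Lemma le_abs_Rintegral (D : set T) (f : T -> R) : measurable D ->
  measurable_fun D f ->
  `|\int[mu]_(x in D) f x|%R%:E <= \int[mu]_(x in D) `|f x|%:E.
Proof.
move=> mD mf; have [foo|] := ltP (\int[mu]_(x in D) `|f x|%:E) +oo; last first.
  by rewrite leye_eq => /eqP ->; rewrite leey.
have fi : mu.-integrable D (EFin \o f) by exact: integrable_abs_lty.
by rewrite EFin_normr_Rintegral//; apply: le_abse_integral => //; exact/measurable_EFinP.
Qed.

End bounds.

Section schur_TTstar.
Local Open Scope ereal_scope.
Context d1 d2 (X : measurableType d1) (Z : measurableType d2) (R : realType).
Context (m1 : {sigma_finite_measure set X -> \bar R}).
Context (m2 : {sigma_finite_measure set Z -> \bar R}).
Variables (k : X * Z -> R) (w : X -> R) (h : Z -> R) (H c c' C Kb : R).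
Hypothesis mk : measurable_fun [set: X * Z] k.
Hypothesis mw : measurable_fun [set: X] w.
Hypothesis mh : measurable_fun [set: Z] h.
Hypothesis w0 : forall x, (0 <= w x)%R.
Hypothesis hH : forall z, (`|h z| <= H)%R.
Hypothesis kK : forall p, (`|k p| <= Kb)%R.
Hypothesis h1 : \int[m2]_z `|h z|%:E < +oo.
Hypothesis kz : forall x, \int[m2]_z `|k (x, z)|%:E <= c%:E.
Hypothesis kx : forall z, \int[m1]_x (`|k (x, z)| * w x)%:E <= c'%:E.
(** With T the operator of kernel [k] and T^t its adjoint for the density [w] on [X], this is the
    kernel of T T^t; [u] is T [h] and [F] is T^t [u]. The bounds [H], [c], [c'], [Kb] justify the
    exchanges of integrals; [C] alone enters the final estimate. *)
Let K x x' : R := (\int[m2]_z (k (x, z) * k (x', z)))%R.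
Hypothesis KC : forall x, \int[m1]_x' (`|K x x'| * w x')%:E <= C%:E.
Hypothesis C0 : (0 < C)%R.
Let u x : R := (\int[m2]_z (k (x, z) * h z))%R.
Let F z : R := (\int[m1]_x (k (x, z) * (u x * w x)))%R.

Let H0 : (0 <= H)%R. Proof. by apply: le_trans (hH point). Qed.
Let c0 : (0 <= c)%R.
Proof. by rewrite -lee_fin; apply: le_trans (kz point); exact: integral_ge0. Qed.
Let c'0 : (0 <= c')%R.
Proof.
rewrite -lee_fin; apply: le_trans (kx point); apply: integral_ge0 => x _.
by rewrite lee_fin mulr_ge0.
Qed.

Let mkx x : measurable_fun [set: Z] (fun z => k (x, z)).
Proof. exact: (measurableT_comp mk). Qed.
Let mkz z : measurable_fun [set: X] (fun x => k (x, z)).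
Proof. exact: (measurableT_comp mk). Qed.
Let mu' : measurable_fun [set: X] u.
Proof.
apply: (@measurable_Rintegral_param _ _ _ _ _ m2 (fun p => k p * h p.2)%R).
by apply: measurable_funM => //; exact: measurableT_comp.
Qed.
Let muw : measurable_fun [set: X] (fun x => u x * w x)%R.
Proof. exact: measurable_funM. Qed.
Let mF : measurable_fun [set: Z] F.
Proof.
apply: (@measurable_Rintegral_param _ _ _ _ _ m1 (fun p => k (p.2, p.1) * (u p.2 * w p.2))%R).
apply: measurable_funM; last exact: (measurableT_comp muw).
apply: (measurableT_comp mk); apply: measurable_fun_pair.
  exact: measurable_snd.
exact: measurable_fst.
Qed.

Let nk x (b : R) (f : Z -> R) : (forall z, `|f z| <= b * `|k (x, z)|)%R ->
  (0 <= b)%R -> \int[m2]_z `|f z|%:E <= (b * c)%:E.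
Proof.
by move=> fb b0; apply: integral_le_mul (kz x) => //; exact: measurableT_comp.
Qed.

Let nkw z (b : R) (f : X -> R) :
  (forall x, `|f x| <= b * (`|k (x, z)| * w x))%R ->
  (0 <= b)%R -> \int[m1]_x `|f x|%:E <= (b * c')%:E.
Proof.
move=> fb b0; apply: integral_le_mul (kx z) => //.
- by apply: measurable_funM => //; exact: measurableT_comp.
- by move=> x _; rewrite mulr_ge0.
Qed.

Let uH x : (`|u x| <= H * c)%R.
Proof.
rewrite -lee_fin; apply: le_trans (le_abs_Rintegral _ _ _) _ => //.
  exact: measurable_funM.
apply: (@nk x) => // z.
by rewrite normrM mulrC ler_wpM2r.
Qed.

Let L1h := fine (\int[m2]_z `|h z|%:E).
Let L1hE : \int[m2]_z `|h z|%:E = L1h%:E.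
Proof. by rewrite fineK// ge0_fin_numE// integral_ge0. Qed.

Let uw1 : \int[m1]_x `|u x * w x|%:E <= (c' * L1h)%:E.
Proof.
apply: (@le_trans _ _ (\int[m1]_x \int[m2]_z `|k (x, z) * h z * w x|%:E)).
  apply: le_integral_gen => x _; first exact: integral_ge0.
  rewrite normrM (ger0_norm (w0 x)) mulrC EFinM.
  under eq_integral do rewrite normrM (ger0_norm (w0 x)) mulrC EFinM.
  rewrite ge0_integralZl//; last 2 first.
  - by apply/measurable_EFinP/measurableT_comp => //; exact: measurable_funM.
  - by rewrite lee_fin.
  rewrite lee_wpmul2l ?lee_fin//; apply: le_abs_Rintegral => //.
  exact: measurable_funM.
rewrite (fubini_tonelli (fun p => `|k p * h p.2 * w p.1|%:E))//; last first.
  apply/measurable_EFinP/measurableT_comp => //; apply: measurable_funM.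
    by apply: measurable_funM => //; exact: (measurableT_comp mh).
  exact: (measurableT_comp mw).
apply: (@le_trans _ _ (\int[m2]_z (`|h z| * c')%:E)).
  apply: le_integral_gen => z _; first by rewrite lee_fin mulr_ge0.
  apply: (@nkw z) => // x /=.
  by rewrite !normrM (ger0_norm (w0 x)) [(_ * `|h z|)%R]mulrC mulrA.
have h1' : \int[m2]_z `|h z|%R%:E <= L1h%:E by rewrite L1hE.
apply: (integral_le_mul _ _ _ _ _ h1') => //.
- exact: measurableT_comp.
- by move=> z _; rewrite mulrC.
Qed.

Let FH z : (`|F z| <= H * c * c')%R.
Proof.
rewrite -lee_fin; apply: le_trans (le_abs_Rintegral _ _ _) _ => //.
  by apply: measurable_funM.
apply: (@nkw z) => [x|]; last by rewrite mulr_ge0.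
rewrite !normrM (ger0_norm (w0 x)) mulrCA ler_wpM2r ?uH// mulr_ge0//.
Qed.

Let A := (\int[m1]_x (u x ^+ 2 * w x))%R.

Let integrable_u2w : m1.-integrable setT (fun x => (u x ^+ 2 * w x)%:E).
Proof.
apply: (integrable_abs_lty (f := fun x => u x ^+ 2 * w x)%R).
  by apply: measurable_funM => //; exact: measurable_funX.
have uw1' : \int[m1]_x `|u x * w x|%R%:E <= (c' * L1h)%:E := uw1.
have Hc0 : (0 <= H * c)%R by rewrite mulr_ge0.
apply: (integral_lty_mul measurableT Hc0 _ _ _ uw1') => //.
- exact: measurableT_comp.
- by move=> x _; rewrite expr2 -mulrA normrM ler_wpM2r.
Qed.

Let integrable_kuw z : m1.-integrable setT (fun x => (k (x, z) * (u x * w x))%:E).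
Proof.
apply: (integrable_abs_lty (f := fun x => k (x, z) * (u x * w x))%R).
  exact: measurable_funM.
apply: le_lt_trans (@nkw z (H * c)%R _ _ _) _.
- move=> x; rewrite !normrM (ger0_norm (w0 x)) mulrCA ler_wpM2r ?uH//.
  by rewrite mulr_ge0.
- by rewrite mulr_ge0.
- by rewrite ltry.
Qed.

(* Fubini for the integrands [k (x, z) * (u x * w x) * G z], [G] being [h] or [F]. *)
Let fubini_kuw (G : Z -> R) (B : R) : measurable_fun [set: Z] G ->
  (forall z, `|G z| <= B)%R ->
  (\int[m2]_z (F z * G z) = \int[m1]_x (u x * w x * \int[m2]_z (k (x, z) * G z)))%R.
Proof.
move=> mG GB; have B0 : (0 <= B)%R by apply: le_trans (GB point).
pose g (p : X * Z) := (k p * (u p.1 * w p.1) * G p.2)%R.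
have mg : measurable_fun setT g.
  apply: measurable_funM; last exact: (measurableT_comp mG).
  by apply: measurable_funM => //; exact: (measurableT_comp muw).
have gx x : \int[m2]_z `|g (x, z)|%:E <= (`|u x * w x| * B * c)%:E.
  apply: (@nk x) => [z|].
    rewrite /g/=.
    have := ler_wpM2l (mulr_ge0 (normr_ge0 (k (x, z))) (normr_ge0 (u x * w x)%R)) (GB z).
    by rewrite !normrM; lra.
  by rewrite mulr_ge0.
have gz z : \int[m1]_x `|g (x, z)|%:E <= (B * (H * c) * c')%:E.
  apply: (@nkw z) => [x|]; last by rewrite !mulr_ge0.
  rewrite /g/= !normrM (ger0_norm (w0 x)) [leLHS]mulrC -!mulrA ler_pM//.
    by rewrite !mulr_ge0.
  by rewrite mulrCA !mulrA ler_wpM2r// ler_wpM2r ?uH.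
have E x : (\int[m2]_z g (x, z) = u x * w x * \int[m2]_z (k (x, z) * G z))%R.
  rewrite -RintegralZl//; last first.
    apply: (integrable_abs_lty (f := fun z => k (x, z) * G z)%R).
      exact: measurable_funM.
    apply: le_lt_trans (@nk x B _ _ _) _ => //.
      by move=> z; rewrite normrM mulrC ler_wpM2r.
    by rewrite ltry.
  by apply: eq_Rintegral => z _; rewrite /g/= [(k _ * _)%R]mulrC mulrA.
under [RHS]eq_Rintegral do rewrite -E.
rewrite (@Rfubini _ _ _ _ _ m1 m2 g mg).
- by apply: eq_Rintegral => z _; rewrite /F -RintegralZr//; exact: integrable_kuw.
- by move=> x; rewrite (le_lt_trans (gx x))// ltry.
- by move=> z; rewrite (le_lt_trans (gz z))// ltry.
- apply: le_lt_trans (_ : (B * c * (c' * L1h))%:E < +oo)%E; last by rewrite ltry.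
  have uw1' : \int[m1]_x `|u x * w x|%R%:E <= (c' * L1h)%:E := uw1.
  apply: (@le_trans _ _ (\int[m1]_x (`|u x * w x| * B * c)%:E)).
    by apply: le_integral_gen => x _ //; rewrite lee_fin !mulr_ge0.
  apply: (integral_le_mul _ _ _ _ _ uw1') => //.
  + by rewrite mulr_ge0.
  + exact: measurableT_comp.
  + by move=> x _; rewrite -mulrA mulrC.
Qed.

Let intFh : (\int[m2]_z (F z * h z) = A)%R.
Proof.
rewrite (fubini_kuw mh hH) /A; apply: eq_Rintegral => x _.
by rewrite -/(u x) expr2 mulrAC.
Qed.

Let mK x : measurable_fun [set: X] (K x).
Proof.
apply: (@measurable_Rintegral_param _ _ _ _ _ m2 (fun p => k (x, p.2) * k p)%R).
by apply: measurable_funM => //; exact: (measurableT_comp (mkx x)).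
Qed.

Let mK2 : measurable_fun [set: X * X] (fun p => K p.1 p.2).
Proof.
apply: (@measurable_Rintegral_param _ _ _ _ _ m2
  (fun p => k (p.1.1, p.2) * k (p.1.2, p.2))%R).
apply: measurable_funM; apply: (measurableT_comp mk); apply: measurable_fun_pair => //.
- by apply: measurableT_comp.
- by apply: measurableT_comp.
Qed.

Let KE x x' : K x x' = K x' x.
Proof. by apply: eq_Rintegral => z _; rewrite mulrC. Qed.

Let vE x : (\int[m2]_z (k (x, z) * F z) = \int[m1]_x' (K x x' * (u x' * w x')))%R.
Proof.
pose g (p : X * Z) := (k (x, p.2) * (k p * (u p.1 * w p.1)))%R.
have mg : measurable_fun setT g.
  apply: measurable_funM; first exact: (measurableT_comp (mkx x)).
  by apply: measurable_funM => //; exact: (measurableT_comp muw).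
have Kb0 : (0 <= Kb)%R by apply: le_trans (kK point).
have gx x' : \int[m2]_z `|g (x', z)|%:E <= (Kb * `|u x' * w x'| * c)%:E.
  apply: (@nk x') => [z|].
    rewrite /g/= 2!normrM -mulrA [(`|u _ * _| * _)%R]mulrC ler_wpM2r//.
    by rewrite mulr_ge0.
have gz z : \int[m1]_x' `|g (x', z)|%:E <= (`|k (x, z)| * (H * c) * c')%:E.
  apply: (@nkw z) => [x'|]; last by rewrite !mulr_ge0.
  rewrite /g/= !normrM (ger0_norm (w0 _)) -!mulrA ler_wpM2l//.
  by rewrite mulrCA !mulrA ler_wpM2r// ler_wpM2r ?uH.
transitivity (\int[m2]_z (\int[m1]_x' g (x', z)))%R.
  by apply: eq_Rintegral => z _; rewrite /g/= RintegralZl//; exact: integrable_kuw.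
rewrite -(@Rfubini _ _ _ _ _ m1 m2 g mg).
- apply: eq_Rintegral => x' _; rewrite -RintegralZr//; last first.
    apply: (integrable_abs_lty (f := fun z => k (x, z) * k (x', z))%R).
      exact: measurable_funM.
    apply: le_lt_trans (@nk x' Kb _ _ _) _ => //.
      by move=> z; rewrite normrM ler_wpM2r.
    by rewrite ltry.
  by apply: eq_Rintegral => z _; rewrite /g/= mulrA.
- by move=> x'; rewrite (le_lt_trans (gx x'))// ltry.
- by move=> z; rewrite (le_lt_trans (gz z))// ltry.
- rewrite (fubini_tonelli (fun p => `|g p|%:E))//; last first.
    by apply/measurable_EFinP/measurableT_comp.
  apply: le_lt_trans (_ : (H * c * c' * c)%:E < +oo)%E; last by rewrite ltry.
  apply: (@le_trans _ _ (\int[m2]_z (`|k (x, z)| * (H * c) * c')%:E)).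
    by apply: le_integral_gen => z _ //; rewrite lee_fin !mulr_ge0.
  apply: (integral_le_mul _ _ _ _ _ (kz x)) => //.
  + by rewrite !mulr_ge0.
  + exact: measurableT_comp.
  + by move=> z _; rewrite -mulrA mulrC.
Qed.

Let u2w0 x : (0 <= u x ^+ 2 * w x)%R.
Proof. by rewrite mulr_ge0// sqr_ge0. Qed.

Let AE : \int[m1]_x (u x ^+ 2 * w x)%:E = A%:E.
Proof. by rewrite fineK// integrable_fin_num. Qed.

(* Schur test: [K] is symmetric and [|u x| * |u x'| <= (u x ^+ 2 + u x' ^+ 2) / 2]. *)
Let uKu : \int[m1]_x \int[m1]_x' (`|u x * w x| * `|K x x' * (u x' * w x')|)%:E
  <= (C * A)%:E.
Proof.
pose g (p : X * X) := (`|K p.1 p.2| * w p.1 * w p.2 * (u p.1 ^+ 2 / 2))%R.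
pose g' (p : X * X) := (`|K p.1 p.2| * w p.1 * w p.2 * (u p.2 ^+ 2 / 2))%R.
have mKw : measurable_fun setT (fun p : X * X => `|K p.1 p.2| * w p.1 * w p.2)%R.
  apply: measurable_funM; last exact: (measurableT_comp mw).
  by apply: measurable_funM; [exact: measurableT_comp|exact: (measurableT_comp mw)].
have mg : measurable_fun setT (EFin \o g).
  by apply/measurable_EFinP/measurable_funM => //; apply: measurable_funM => //;
    apply: measurable_funX; exact: (measurableT_comp mu').
have mg' : measurable_fun setT (EFin \o g').
  by apply/measurable_EFinP/measurable_funM => //; apply: measurable_funM => //;
    apply: measurable_funX; exact: (measurableT_comp mu').
have g0 p : 0 <= (EFin \o g) p by rewrite lee_fin mulr_ge0 ?divr_ge0 ?sqr_ge0// !mulr_ge0.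
have g'0 p : 0 <= (EFin \o g') p by rewrite lee_fin mulr_ge0 ?divr_ge0 ?sqr_ge0// !mulr_ge0.
have Ig : \int[m1]_x \int[m1]_x' (EFin \o g) (x, x') <= (C / 2 * A)%:E.
  apply: (@le_trans _ _ (\int[m1]_x (u x ^+ 2 * w x / 2 * C)%:E)).
    apply: le_integral_gen => x _; first by rewrite lee_fin mulr_ge0 ?divr_ge0// ltW.
    apply: (integral_le_mul _ _ _ _ _ (KC x)) => //.
    - by rewrite divr_ge0.
    - by apply: measurable_funM => //; exact: measurableT_comp.
    - by move=> x' _; rewrite mulr_ge0.
    - by move=> x' _; rewrite /g/=; lra.
  have AE' : \int[m1]_x (u x ^+ 2 * w x)%R%:E <= A%:E by rewrite AE.
  apply: (integral_le_mul _ _ _ _ _ AE') => //.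
  - by rewrite divr_ge0// ltW.
  - by apply: measurable_funM => //; exact: measurable_funX.
  - by move=> x _; lra.
have Ig' : \int[m1]_x \int[m1]_x' (EFin \o g') (x, x') <= (C / 2 * A)%:E.
  rewrite fubini_tonelli//; apply: le_trans Ig; rewrite le_eqVlt; apply/orP; left.
  apply/eqP/eq_integral => x _; apply: eq_integral => x' _.
  by rewrite /g/g'/= KE; congr (_%:E); ring.
have -> : (C * A)%:E = (C / 2 * A)%:E + (C / 2 * A)%:E.
  by rewrite -EFinD; congr (_%:E); field.
apply: le_trans (leeD Ig Ig').
rewrite -ge0_integralD//; last 4 first.
- by move=> x _; exact: integral_ge0.
- exact: (measurable_integral_param m1 mg).
- by move=> x _; exact: integral_ge0.
- exact: (measurable_integral_param m1 mg').
have mgx x : measurable_fun setT (fun x' => (EFin \o g) (x, x')) by exact: (measurableT_comp mg).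
have mgx' x : measurable_fun setT (fun x' => (EFin \o g') (x, x')) by exact: (measurableT_comp mg').
apply: le_integral_gen => x _.
  by rewrite adde_ge0// integral_ge0.
rewrite -ge0_integralD//.
apply: le_integral_gen => x' _; first by rewrite adde_ge0.
rewrite /= -EFinD lee_fin /g/g'/= !normrM (ger0_norm (w0 _)) (ger0_norm (w0 x')).
have := sqr_ge0 (`|u x| - `|u x'|)%R; rewrite sqrrB !real_normK ?num_real// => h2.
have p0 : (0 <= `|K x x'| * w x * w x')%R by rewrite !mulr_ge0.
by have := mulr_ge0 p0 h2; lra.
Qed.

Let F2int : m2.-integrable setT (fun z => (F z * F z)%:E).
Proof.
have FF : \int[m2]_z `|F z|%R%:E < +oo.
  apply: (@le_lt_trans _ _ (\int[m2]_z \int[m1]_x `|k (x, z) * (u x * w x)|%R%:E)).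
    apply: le_integral_gen => z _; first exact: integral_ge0.
    by apply: le_abs_Rintegral => //; exact: measurable_funM.
  have mkuw : measurable_fun setT (fun p : X * Z => `|k p * (u p.1 * w p.1)|%R%:E).
    apply/measurable_EFinP/measurableT_comp => //; apply: measurable_funM => //.
    exact: (measurableT_comp muw).
  rewrite -(fubini_tonelli _ mkuw)//.
  apply: (@le_lt_trans _ _ (\int[m1]_x (`|u x * w x| * c)%:E)).
    apply: le_integral_gen => x _; first by rewrite lee_fin mulr_ge0.
    by apply: (@nk x) => // z; rewrite normrM mulrC.
  have uw1' : \int[m1]_x `|u x * w x|%R%:E <= (c' * L1h)%:E := uw1.
  apply: (integral_lty_mul _ c0 _ _ _ uw1') => //; first exact: measurableT_comp.
  by move=> x _; rewrite mulrC.
apply: (integrable_abs_lty (f := fun z => F z * F z)%R); first exact: measurable_funM.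
have Hcc : (0 <= H * c * c')%R by rewrite !mulr_ge0.
have FF' : \int[m2]_z `|F z|%R%:E <= (fine (\int[m2]_z `|F z|%R%:E))%:E.
  by rewrite fineK// ge0_fin_numE// integral_ge0.
apply: (integral_lty_mul _ Hcc _ _ _ FF') => //; first exact: measurableT_comp.
by move=> z _; rewrite normrM ler_wpM2r.
Qed.

(** The integral of [F] squared is the inner product of T [F] and [u], hence the quadratic form of
    [K] at [u], which [uKu] controls. *)
Let intF2 : (\int[m2]_z (F z * F z) <= C * A)%R.
Proof.
rewrite (fubini_kuw mF FH) -lee_fin.
under eq_Rintegral do rewrite vE.
have mv : measurable_fun setT (fun x => \int[m1]_x' (K x x' * (u x' * w x')))%R.
  apply: (@measurable_Rintegral_param _ _ _ _ _ m1 (fun p => K p.1 p.2 * (u p.2 * w p.2))%R).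
  by apply: measurable_funM => //; exact: (measurableT_comp muw).
apply: le_trans uKu; apply: le_trans (lee_abs _) _.
rewrite -[leLHS]/((`|_|%R)%:E); apply: le_trans (le_abs_Rintegral _ _ _) _ => //.
  exact: measurable_funM.
apply: le_integral_gen => x _; first exact: integral_ge0.
rewrite normrM EFinM.
under [leRHS]eq_integral do rewrite EFinM.
rewrite ge0_integralZl//; last first.
  by apply/measurable_EFinP/measurableT_comp => //; exact: measurable_funM.
rewrite lee_wpmul2l//; apply: le_abs_Rintegral => //.
exact: measurable_funM.
Qed.

(* Expand [0 <= \int (C * h - F)^2] and use [\int F * h = A] and [\int F^2 <= C * A]. *)
Lemma schur_TTstar : \int[m1]_x ((\int[m2]_z (k (x, z) * h z)) ^+ 2 * w x)%R%:E
  <= C%:E * \int[m2]_z (h z ^+ 2)%:E.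
Proof.
have h2i : m2.-integrable setT (fun z => (h z ^+ 2)%:E).
  apply: (integrable_abs_lty (f := fun z => h z ^+ 2)%R).
    exact: measurable_funX.
  have h1' : \int[m2]_z `|h z|%R%:E <= L1h%:E by rewrite L1hE.
  apply: (integral_lty_mul _ H0 _ _ _ h1') => //; first exact: measurableT_comp.
  by move=> z _; rewrite expr2 normrM ler_wpM2r.
have Fhi : m2.-integrable setT (fun z => (F z * h z)%:E).
  apply: (integrable_abs_lty (f := fun z => F z * h z)%R).
    exact: measurable_funM.
  have h1' : \int[m2]_z `|h z|%R%:E <= L1h%:E by rewrite L1hE.
  have Hcc : (0 <= H * c * c')%R by rewrite !mulr_ge0.
  apply: (integral_lty_mul _ Hcc _ _ _ h1') => //; first exact: measurableT_comp.
  by move=> z _; rewrite normrM ler_wpM2r.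
rewrite -/u -[\int[m1]_x _]/(\int[m1]_x (u x ^+ 2 * w x)%:E) AE.
rewrite -[X in C%:E * X]fineK ?integrable_fin_num// -EFinM lee_fin.
rewrite -/(\int[m2]_z (h z ^+ 2))%R; set B := (\int[m2]_z _)%R.
have : (0 <= \int[m2]_z (C * h z - F z) ^+ 2)%R.
  by apply: Rintegral_ge0 => z _; exact: sqr_ge0.
have -> : (\int[m2]_z (C * h z - F z) ^+ 2 =
    C ^+ 2 * B - 2 * C * A + \int[m2]_z (F z * F z))%R.
  rewrite -intFh -RintegralZl// -RintegralZl// -RintegralB//; last 2 first.
  - exact: integrable_scale.
  - exact: integrable_scale.
  rewrite -RintegralD//; last first.
    by apply: integrable_subr => //; exact: integrable_scale.
  by apply: eq_Rintegral => z _; ring.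
by move: intF2; move: (\int[m2]_z (F z * F z))%R A B => E a b EC h0;
  rewrite -(ler_pM2l C0); lra.
Qed.

End schur_TTstar.

(** * John-Nirenberg inequality on trees *)

Section tree_averages.
Context {R : realFieldType} {T : Type} {I : finType} (child : I -> T -> T).
Hypothesis I_gt0 : (0 < #|I|)%N.
Implicit Types (F G : T -> R) (Q : T) (k : nat).

(** The tree abstracts dyadic subdivision: all descendants at depth [k] count equally, as the
    children of a cube have equal volume. Below, [a] plays the role of the averages of a function
    over cubes, and [a_mean] makes it a martingale. *)
Fixpoint tree_avg F k Q : R :=
  if k is k'.+1 then #|I|%:R^-1 * \sum_(i : I) tree_avg F k' (child i Q) else F Q.

Let M : R := #|I|%:R.
Let M_gt0 : 0 < M. Proof. by rewrite ltr0n. Qed.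

Lemma tree_avg_cst c k Q : tree_avg (fun=> c) k Q = c.
Proof.
elim: k Q => //= k IH Q.
under eq_bigr do rewrite IH.
by rewrite sumr_const -[c *+ _]mulr_natl mulrA mulVf ?mul1r// gt_eqF.
Qed.

Lemma tree_avgD F G k Q :
  tree_avg (fun Q => F Q + G Q) k Q = tree_avg F k Q + tree_avg G k Q.
Proof.
elim: k Q => //= k IH Q.
by under eq_bigr do rewrite IH; rewrite big_split/= mulrDr.
Qed.

Lemma tree_avgZ c F k Q : tree_avg (fun Q => c * F Q) k Q = c * tree_avg F k Q.
Proof.
elim: k Q => //= k IH Q.
by under eq_bigr do rewrite IH; rewrite -mulr_sumr mulrCA.
Qed.

Lemma le_tree_avg F G k Q : (forall Q, F Q <= G Q) ->
  tree_avg F k Q <= tree_avg G k Q.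
Proof.
move=> FG; elim: k Q => //= k IH Q.
by rewrite ler_wpM2l ?invr_ge0 ?ler0n// ler_sum.
Qed.

Lemma eq_tree_avg F G k Q : (forall Q, F Q = G Q) ->
  tree_avg F k Q = tree_avg G k Q.
Proof. by move=> FG; apply/eqP; rewrite eq_le !le_tree_avg// => ?; rewrite FG. Qed.

Lemma ler_norm_tree_avg F k Q : `|tree_avg F k Q| <= tree_avg (fun Q => `|F Q|) k Q.
Proof.
elim: k Q => //= k IH Q.
rewrite normrM ger0_norm ?invr_ge0 ?ler0n// ler_wpM2l ?invr_ge0 ?ler0n//.
by apply: le_trans (ler_norm_sum _ _ _) _; exact: ler_sum.
Qed.

Variable a : T -> R.
Hypothesis a_mean : forall Q, a Q = M^-1 * \sum_(i : I) a (child i Q).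

Lemma tree_avg_martingale k Q : tree_avg a k Q = a Q.
Proof.
by elim: k Q => //= k IH Q; under eq_bigr do rewrite IH; rewrite -a_mean.
Qed.

(** Pythagoras: the cross term vanishes because [a] is a martingale. *)
Lemma tree_avg_sqr c k Q : tree_avg (fun Q' => (a Q' - c) ^+ 2) k Q =
  tree_avg (fun Q' => (a Q' - a Q) ^+ 2) k Q + (a Q - c) ^+ 2.
Proof.
rewrite (@eq_tree_avg _ (fun Q' => (a Q' - a Q) ^+ 2 +
    ((2 * (a Q - c)) * a Q' + (- 2 * (a Q - c) * a Q + (a Q - c) ^+ 2)))).
  rewrite !(tree_avgD, tree_avgZ, tree_avg_cst) tree_avg_martingale; lra.
by move=> Q'; lra.
Qed.

Variable N : R.
Hypothesis N_gt0 : 0 < N.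
Hypothesis a_osc : forall k Q, tree_avg (fun Q' => `|a Q' - a Q|) k Q <= N.

(* Proportion of the descendants of [Q] at depth [k] having an ancestor on which
   [a] deviates from [c] by more than [2 * N]. *)
Let stopped c := fix stopped k Q : R :=
  if 2 * N < `|a Q - c| then 1 else
  if k is k'.+1 then M^-1 * \sum_(i : I) stopped k' (child i Q) else 0.

(** Chebyshev's inequality for the stopped cubes. On a stopped cube the deviation exceeds [2 * N],
    and by the martingale property it is at most the mean deviation over the descendants. *)
Let stopped_le c k Q : stopped c k Q * (2 * N) <= tree_avg (fun Q => `|a Q - c|) k Q.
Proof.
elim: k Q => [|k IH] Q /=; first by case: ifPn => [/ltW|_]; rewrite ?mul1r ?mul0r.
case: ifPn => [/ltW H|_].
  rewrite mul1r (le_trans H)// -[leLHS]/(`|a Q - c|).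
  have := ler_norm_tree_avg (fun Q => a Q + - c) k.+1 Q.
  by rewrite tree_avgD tree_avg_cst tree_avg_martingale.
by rewrite -mulrA mulr_suml ler_wpM2l ?invr_ge0 ?ler0n// ler_sum.
Qed.

(** One nonnegative term is at most the sum, so a jump to a child costs at most [M] times the mean
    jump. *)
Let child_osc i Q : `|a (child i Q) - a Q| <= M * N.
Proof.
have := a_osc 1 Q; rewrite /= mulrC ler_pdivrMr// mulrC; apply: le_trans.
by rewrite (bigD1 i)//= lerDl sumr_ge0.
Qed.

Let K := 2 * (2 + M) ^+ 2.

(** Strong induction on the depth. Before stopping, [a] stays within [2 * N] of [a Q], and one more
    jump costs [M * N], whence [L]. The induction hypothesis restarts the estimate on each stopped
    cube, and by [stopped_le] at most half of the tree is stopped. The constant [K] solves K N^2 =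
    L^2 + K N^2 / 2. *)
Lemma tree_john_nirenberg k Q :
  tree_avg (fun Q' => (a Q' - a Q) ^+ 2) k Q <= K * N ^+ 2.
Proof.
elim/ltn_ind: k Q => k0 IH Q0.
have N0 := ltW N_gt0; have M0 := ltW M_gt0.
have N2 : 0 <= N ^+ 2 by rewrite sqr_ge0.
pose L := (2 + M) * N.
(* The disjunction makes the recursion well founded: a cube can be stopped only strictly below the
   root, so the induction hypothesis is used at a depth smaller than [k0]. *)
have claim j Q : (j <= k0)%N -> `|a Q - a Q0| <= L ->
    (j < k0)%N || (`|a Q - a Q0| <= 2 * N) ->
    tree_avg (fun Q' => (a Q' - a Q0) ^+ 2) j Q <=
    L ^+ 2 + K * N ^+ 2 * stopped (a Q0) j Q.
  elim: j Q => [|j IHj] Q jk0 aL.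
    move=> _ /=; rewrite -[leLHS]real_normK ?num_real//.
    apply: (@le_trans _ _ (L ^+ 2)); first by rewrite lerXn2r ?nnegrE// (le_trans _ aL).
    by rewrite lerDl; case: ifP => _; rewrite ?mulr0 ?mulr1// mulr_ge0// /K; nra.
  rewrite [stopped _ _ _]/=; case: ifPn => [H|].
    rewrite leNgt H orbF => jk.
    rewrite tree_avg_sqr addrC mulr1 lerD ?IH//.
    rewrite -real_normK ?num_real//; rewrite lerXn2r ?nnegrE// (le_trans _ aL)//.
  rewrite -leNgt => aN _ /=.
  apply: (@le_trans _ _ (M^-1 * \sum_(i : I) (L ^+ 2 + K * N ^+ 2 *
    stopped (a Q0) j (child i Q)))).
    rewrite ler_wpM2l ?invr_ge0 ?ler0n// ler_sum// => i _.
    apply: IHj; [exact: ltnW| |by rewrite jk0].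
    have := ler_normD (a (child i Q) - a Q) (a Q - a Q0).
    rewrite addrA subrK => /le_trans; apply.
    by rewrite /L; have := child_osc i Q; lra.
  rewrite big_split/= mulrDr.
  rewrite sumr_const -[L ^+ 2 *+ _]mulr_natl mulrA mulVf ?mul1r ?gt_eqF//.
  by rewrite -mulr_sumr mulrCA.
have L0 : 0 <= L by rewrite /L mulr_ge0// addr_ge0.
have := claim k0 Q0 (leqnn _); rewrite subrr normr0 L0 mulr_ge0// orbT.
move=> /(_ isT isT) /le_trans; apply.
have p12 : stopped (a Q0) k0 Q0 <= 1 / 2.
  have := le_trans (stopped_le (a Q0) k0 Q0) (a_osc k0 Q0).
  move: (stopped _ _ _) => s sN.
  by rewrite -(ler_pM2r N_gt0); lra.
have K0 : 0 <= K by rewrite /K; nra.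
have : K * N ^+ 2 * stopped (a Q0) k0 Q0 <= K * N ^+ 2 * (1 / 2).
  by rewrite ler_wpM2l// mulr_ge0.
have -> : L ^+ 2 = K * N ^+ 2 * (1 / 2) by rewrite /L /K; field.
lra.
Qed.

End tree_averages.

(** * Euclidean space *)

Section euclidean_norm.
Context {R : realType} {n : nat}.
Implicit Types (x y z : 'rV[R]_n) (c r : R).

Lemma enorm_ge0 x : 0 <= enorm x. Proof. exact: sqrtr_ge0. Qed.

Lemma sqr_enorm x : enorm x ^+ 2 = \sum_(i < n) x ord0 i ^+ 2.
Proof. by rewrite sqr_sqrtr// sumr_ge0// => i _; exact: sqr_ge0. Qed.

Lemma enormN x : enorm (- x) = enorm x.
Proof. by congr Num.sqrt; apply: eq_bigr => i _; rewrite mxE sqrrN. Qed.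

Lemma enormB x y : enorm (x - y) = enorm (y - x).
Proof. by rewrite -enormN opprB. Qed.

Lemma enormZ c x : enorm (c *: x) = `|c| * enorm x.
Proof.
rewrite /enorm -sqrtr_sqr -sqrtrM ?sqr_ge0// mulr_sumr; congr Num.sqrt.
by apply: eq_bigr => i _; rewrite mxE exprMn.
Qed.

Lemma ler_coord_enorm x i : `|x ord0 i| <= enorm x.
Proof.
rewrite -sqrtr_sqr ler_wsqrtr// (bigD1 i)//= lerDl sumr_ge0// => j _.
exact: sqr_ge0.
Qed.

(** Cauchy-Schwarz, by expanding a sum of squares of s x - y with [s] chosen so that both vectors
    get the same norm. *)
Lemma ler_sum_coordM x y : \sum_(i < n) x ord0 i * y ord0 i <= enorm x * enorm y.
Proof.
have [x0|x0] := eqVneq (enorm x) 0.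
  rewrite x0 mul0r big1// => i _.
  have := ler_coord_enorm x i; rewrite x0 normr_le0 => /eqP ->; exact: mul0r.
have [y0|y0] := eqVneq (enorm y) 0.
  rewrite y0 mulr0 big1// => i _.
  have := ler_coord_enorm y i; rewrite y0 normr_le0 => /eqP ->; exact: mulr0.
have px : 0 < enorm x by rewrite lt_def x0 enorm_ge0.
have py : 0 < enorm y by rewrite lt_def y0 enorm_ge0.
pose s : R := enorm y / enorm x.
have : 0 <= \sum_(i < n) (s * x ord0 i - y ord0 i) ^+ 2.
  by apply: sumr_ge0 => i _; exact: sqr_ge0.
have -> : \sum_(i < n) (s * x ord0 i - y ord0 i) ^+ 2 =
    s ^+ 2 * enorm x ^+ 2 + enorm y ^+ 2 - (2 * s) * \sum_(i < n) x ord0 i * y ord0 i.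
  rewrite !sqr_enorm !mulr_sumr -big_split -sumrB/=.
  by apply: eq_bigr => i _; ring.
have -> : s ^+ 2 * enorm x ^+ 2 = enorm y ^+ 2 by rewrite /s; field; rewrite x0.
set S := \sum_(i < n) _ => H.
have s0 : 0 < s by rewrite divr_gt0.
rewrite -(ler_pM2l s0) [leRHS](_ : _ = enorm y ^+ 2); last first.
  by rewrite /s; field; rewrite x0.
lra.
Qed.

Lemma ler_enormD x y : enorm (x + y) <= enorm x + enorm y.
Proof.
rewrite -(@ler_sqr R) ?nnegrE ?addr_ge0 ?enorm_ge0// sqrrD !sqr_enorm.
have := ler_sum_coordM x y.
have -> : \sum_(i < n) (x + y) ord0 i ^+ 2 = \sum_(i < n) x ord0 i ^+ 2 +
    2 * (\sum_(i < n) x ord0 i * y ord0 i) + \sum_(i < n) y ord0 i ^+ 2.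
  by rewrite mulr_sumr -!big_split/=; apply: eq_bigr => i _; rewrite mxE; ring.
lra.
Qed.

Lemma ler_enorm_dist x y z : enorm (x - z) <= enorm (x - y) + enorm (y - z).
Proof. by have := ler_enormD (x - y) (y - z); rewrite addrA subrK. Qed.

Lemma enorm_lt x r : (0 < n)%N -> (forall i, `|x ord0 i| < r / n%:R) -> enorm x < r.
Proof.
move=> n0 xr; have n0' : 0 < n%:R :> R by rewrite ltr0n.
have r0 : 0 < r.
  have := le_lt_trans (normr_ge0 _) (xr (Ordinal n0)).
  by rewrite pmulr_lgt0// invr_gt0.
rewrite -(@ltr_pXn2r R 2)// ?nnegrE ?enorm_ge0 ?ltW// sqr_enorm.
have H i : x ord0 i ^+ 2 < (r / n%:R) ^+ 2.
  by rewrite -real_normK ?num_real// ltr_pXn2r ?nnegrE ?normr_ge0// divr_ge0// ltW.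
apply: (@lt_le_trans _ _ (\sum_(i < n) (r / n%:R) ^+ 2)).
  by apply: ltr_sum => //; apply/hasP; exists (Ordinal n0) => //; rewrite mem_index_enum.
rewrite sumr_const card_ord -[leLHS]mulr_natl expr_div_n mulrA expr2 [n%:R ^+ 2]expr2.
rewrite ler_pdivrMr ?mulr_gt0// mulrC ler_wpM2l ?mulr_ge0 ?(ltW r0)//.
by rewrite ler_peMr ?ler1n// ltW.
Qed.

Lemma enorm_le_coord x r : 0 <= r -> (forall i, `|x ord0 i| <= r) -> enorm x <= n%:R * r.
Proof.
move=> r0 xr.
rewrite -(@ler_sqr R) ?nnegrE ?enorm_ge0 ?mulr_ge0// sqr_enorm.
apply: (@le_trans _ _ (\sum_(i < n) r ^+ 2)).
  apply: ler_sum => i _.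
  by rewrite -real_normK ?num_real// lerXn2r ?nnegrE ?normr_ge0.
rewrite sumr_const card_ord -[leLHS]mulr_natl exprMn ler_wpM2r ?sqr_ge0//.
by rewrite -natrX ler_nat; case: (n) => // m; rewrite leq_pmulr.
Qed.

Lemma measurable_subrV : measurable_fun [set: 'rV[R]_n * 'rV[R]_n] (fun p => p.1 - p.2).
Proof.
apply: measurable_fun_rVP => i.
rewrite (_ : (fun q => _) = fun p : 'rV[R]_n * 'rV[R]_n => p.1 ord0 i - p.2 ord0 i).
  by apply: measurable_funB; apply: (measurableT_comp (measurable_coord i)).
by apply/funext => p; rewrite !mxE.
Qed.

Lemma measurable_enorm : measurable_fun [set: 'rV[R]_n] enorm.
Proof.
have := @measurable_enorm_sub R n 0.
by rewrite (_ : (fun x => _) = enorm)//; apply/funext => x; rewrite subr0.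
Qed.

Lemma measurable_scalerV : measurable_fun [set: R * 'rV[R]_n] (fun p => p.1 *: p.2).
Proof.
apply: measurable_fun_rVP => i.
rewrite (_ : (fun q => _) = fun p : R * 'rV[R]_n => p.1 * p.2 ord0 i).
  by apply: measurable_funM => //; apply: (measurableT_comp (measurable_coord i)).
by apply/funext => p; rewrite !mxE.
Qed.

End euclidean_norm.

(** * Affine changes of variables, volumes of cubes and balls *)

Section change_of_variables.
Local Open Scope ereal_scope.
Context {R : realType}.
Local Notation mu := (@lebesgue_rV R _).

(** Uniqueness of Lebesgue measure: the image of the measure under the affine map, scaled by [t^-1],
    gives each interval its length. The reflection exchanges the open and closed ends, which does
    not change the length. *)
Lemma ge0_integral_lebesgue_affine (x t : R) (g : R -> \bar R) : (0 < t)%R ->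
  measurable_fun [set: R] g -> (forall a, 0 <= g a) ->
  \int[lebesgue_measure]_a g (t^-1 * (x - a))%R = t%:E * \int[lebesgue_measure]_a g a.
Proof.
move=> t0 mg g0; have t0' : (0 <= t^-1)%R by rewrite invr_ge0 ltW.
pose phi : R -> measurableTypeR R := (fun a => t^-1 * (x - a))%R.
have mphi : measurable_fun [set: measurableTypeR R] phi.
  apply: measurable_funM; first exact: measurable_cst.
  by apply: measurable_funB; [exact: measurable_cst|exact: measurable_id].
pose P := measure_function_pushforward__canonical__measure_function_Measure
  (@lebesgue_measure R) mphi.
have PE (A : set R) : measurable A -> lebesgue_measure A = mscale (NngNum t0') P A.
  apply: (@lebesgue_measure_unique R (mscale (NngNum t0') P)) => _ [[a b]] _ <-.
  have E : phi @^-1` `]a, b]%classic = `[(x - t * b)%R, (x - t * a)%R[%classic.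
    apply/seteqP; split => y; rewrite /phi /= !in_itv/= => /andP[h1 h2];
      apply/andP; split; move: h1 h2; rewrite ?ltr_pdivlMl// ?ler_pdivrMl//; lra.
  transitivity (t^-1%:E * lebesgue_measure (phi @^-1` `]a, b]%classic)); last by [].
  rewrite E !lebesgue_measure_itv/= !lte_fin.
  have -> : (x - t * b < x - t * a)%R = (a < b)%R by rewrite ltrD2l ltrN2 ltr_pM2l.
  case: ifPn => ab; last by rewrite mule0.
  by rewrite -!EFinD -EFinM; congr (_%:E); field; rewrite gt_eqF.
have -> : \int[lebesgue_measure]_a g a = \int[mscale (NngNum t0') P]_a g a.
  by apply: eq_measure_integral => A mA _; exact: PE.
rewrite ge0_integral_mscale//= ge0_integral_pushforward//.
rewrite preimage_setT muleA -EFinM divff ?gt_eqF// mul1e.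
by apply: eq_integral.
Qed.

Lemma ge0_integral_lebesgue_rVS n (g : 'rV[R]_n.+1 -> \bar R) :
  measurable_fun [set: 'rV[R]_n.+1] g -> (forall x, 0 <= g x) ->
  \int[mu]_x g x = \int[lebesgue_measure]_a \int[mu]_b g (cons_rV (a, b)).
Proof.
move=> mg g0.
pose P := measure_function_pushforward__canonical__measure_function_Measure
  (lebesgue_measure \x @lebesgue_rV R n)%E (@measurable_cons_rV R n).
have -> : \int[mu]_x g x = \int[P]_x g x.
  by apply: eq_measure_integral => A mA _.
rewrite (ge0_integral_pushforward (@measurable_cons_rV R n))//.
rewrite preimage_setT (fubini_tonelli1 (g \o @cons_rV R n)) => [//||p].
  by apply: measurableT_comp => //; exact: measurable_cons_rV.
exact: g0.
Qed.

Lemma measurable_affine_rV n (x : 'rV[R]_n) (t : R) :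
  measurable_fun [set: 'rV[R]_n] (fun y => t^-1 *: (x - y))%R.
Proof.
apply: measurable_fun_rVP => i.
rewrite (_ : (fun q => _) = fun y : 'rV[R]_n => (t^-1 * (x ord0 i - y ord0 i))%R).
  apply: measurable_funM => //; apply: measurable_funB => //.
  exact: measurable_coord.
by apply/funext => y; rewrite !mxE.
Qed.

Lemma cons_rV_affine n (x : 'rV[R]_n.+1) (t a : R) (b : 'rV[R]_n) :
  (t^-1 *: (x - cons_rV (a, b)) = cons_rV
    (t^-1 * (x ord0 ord0 - a), t^-1 *: ((\row_j x ord0 (rshift 1 j)) - b)) :> 'rV[R]_n.+1)%R.
Proof.
apply/rowP => i; rewrite !mxE /cons_rV.
case: (@splitP 1 n i) => j ij.
- have -> : i = lshift n j by exact/val_inj.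
  rewrite !mxE/=; congr (_ * (x _ _ - _))%R.
  by apply/val_inj => /=; case: j ij => -[].
- have -> : i = rshift 1 j by exact/val_inj.
  by rewrite /= !mxE.
Qed.

(** Reflection, translation and dilation are treated together because convolution with a dilate
    involves exactly this map. Induction on the dimension, splitting off one coordinate by
    Tonelli. *)
Lemma ge0_integral_affine n (x : 'rV[R]_n) (t : R) (g : 'rV[R]_n -> \bar R) :
  (0 < t)%R -> measurable_fun [set: 'rV[R]_n] g -> (forall a, 0 <= g a) ->
  \int[mu]_y g (t^-1 *: (x - y))%R = (t ^+ n)%:E * \int[mu]_y g y.
Proof.
move=> t0; elim: n x g => [|n IHn] x g mg g0.
  by rewrite expr0 mul1e; apply: eq_integral => y _; congr g; apply/rowP => -[].
have mgc : measurable_fun setT (g \o @cons_rV R n).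
  by apply: measurableT_comp => //; exact: measurable_cons_rV.
have mga a : measurable_fun setT (fun b => g (cons_rV (a, b))).
  exact: (measurableT_comp mgc).
rewrite [LHS]ge0_integral_lebesgue_rVS//; last first.
  by apply: measurableT_comp => //; exact: measurable_affine_rV.
under eq_integral => a _.
  under eq_integral do rewrite cons_rV_affine.
  rewrite (IHn _ (fun b => g (cons_rV (t^-1 * (x ord0 ord0 - a), b)%R)))//.
  over.
have mI : measurable_fun setT (fun a => \int[mu]_b g (cons_rV (a, b))).
  exact: (measurable_integral_param (@lebesgue_rV R n) mgc).
rewrite ge0_integralZl//; last 3 first.
- apply: (measurableT_comp mI).
  apply: measurable_funM; first exact: measurable_cst.
  by apply: measurable_funB; [exact: measurable_cst|exact: measurable_id].
- by move=> a _; exact: integral_ge0.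
- by rewrite lee_fin exprn_ge0// ltW.
rewrite (ge0_integral_lebesgue_affine _ _ mI)//; last first.
  by move=> a; exact: integral_ge0.
by rewrite -ge0_integral_lebesgue_rVS// exprSr EFinM muleA.
Qed.

Lemma integral_affine n (x : 'rV[R]_n) (t : R) (g : 'rV[R]_n -> R) :
  (0 < t)%R -> mu.-integrable [set: 'rV[R]_n] (EFin \o g) ->
  \int[mu]_y (g (t^-1 *: (x - y))%R)%:E = (t ^+ n)%:E * \int[mu]_y (g y)%:E.
Proof.
move=> t0 gi; have mg := measurable_int _ gi.
rewrite [LHS]integralE [X in _ * X]integralE.
have -> : \int[mu]_y ((fun y => (g (t^-1 *: (x - y))%R)%:E)^\+ y) =
    (t ^+ n)%:E * \int[mu]_y ((EFin \o g)^\+ y).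
  rewrite -(ge0_integral_affine x t0 (measurable_funepos mg))//.
  by apply: eq_integral => y _; rewrite !funeposE.
have -> : \int[mu]_y ((fun y => (g (t^-1 *: (x - y))%R)%:E)^\- y) =
    (t ^+ n)%:E * \int[mu]_y ((EFin \o g)^\- y).
  rewrite -(ge0_integral_affine x t0 (measurable_funeneg mg))//.
  by apply: eq_integral => y _; rewrite !funenegE.
rewrite [RHS]muleBr//.
exact: (integrable_add_def measurableT gi).
Qed.

End change_of_variables.

Section boxes.
Local Open Scope ereal_scope.
Context {R : realType} {n : nat}.
Local Notation mu := (@lebesgue_rV R n).
Implicit Types (a c : 'rV[R]_n) (l r : R).

(** Half open, so that a cube is the disjoint union of its dyadic children. *)
Definition cube a l : set 'rV[R]_n :=
  [set x | forall i, (a ord0 i <= x ord0 i < a ord0 i + l)%R].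

Lemma measurable_box (A : 'I_n -> set R) : (forall i, measurable (A i)) ->
  measurable [set x : 'rV[R]_n | forall i, A i (x ord0 i)].
Proof.
move=> mA; rewrite (_ : mkset _ = \bigcap_(i in [set: 'I_n])
    ((fun x : 'rV[R]_n => x ord0 i) @^-1` A i)).
  apply: fin_bigcap_measurable => // i _.
  by rewrite -[X in measurable X]setTI; exact: measurable_coord.
by apply/seteqP; split => x /= Ax i; [move=> _; exact: Ax|exact: Ax].
Qed.

Lemma cubeE a l : cube a l =
  [set x | forall i, (fun i => `[a ord0 i, (a ord0 i + l)%R[%classic) i (x ord0 i)].
Proof. by apply/seteqP; split => x xa i /=; have := xa i; rewrite /= in_itv. Qed.

Lemma measurable_cube a l : measurable (cube a l).
Proof.
rewrite cubeE; apply: (@measurable_box (fun i => `[a ord0 i, (a ord0 i + l)%R[%classic)).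
by move=> i; exact: measurable_itv.
Qed.

Lemma lebesgue_cube a l : (0 < l)%R -> mu (cube a l) = (l ^+ n)%:E.
Proof.
move=> l0.
rewrite cubeE (@lebesgue_rV_box R n (fun i => `[a ord0 i, (a ord0 i + l)%R[%classic)); last first.
  by move=> i; exact: measurable_itv.
rewrite (eq_bigr (fun=> l%:E)).
  by rewrite prodEFin prodr_const card_ord.
by move=> i _; rewrite lebesgue_measure_itv/= lte_fin ltrDl l0 -EFinD addrAC subrr add0r.
Qed.

Lemma lebesgue_eball_le c r : (0 < r)%R -> mu (eball c r) <= ((2 * r) ^+ n)%:E.
Proof.
move=> r0; pose a : 'rV[R]_n := \row_i (c ord0 i - r)%R.
rewrite -(@lebesgue_cube a)// ?mulr_gt0//; apply: le_measure; rewrite ?inE.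
- exact: measurable_eball.
- exact: measurable_cube.
move=> x /= xc i; rewrite mxE.
have := le_lt_trans (ler_coord_enorm (x - c) i) xc.
by rewrite !mxE ltr_norml => /andP[h1 h2]; apply/andP; split; lra.
Qed.

(** The ball contains a box of half side r / n. Together with the circumscribed cube of side 2 r
    this replaces the exact volume of balls everywhere below. *)
Lemma lebesgue_eball_ge c r : (0 < n)%N -> (0 < r)%R ->
  ((2 * r / n%:R) ^+ n)%:E <= mu (eball c r).
Proof.
move=> n0 r0; have n0' : (0 < n%:R :> R)%R by rewrite ltr0n.
pose A i := `](c ord0 i - r / n%:R)%R, (c ord0 i + r / n%:R)%R[%classic.
have rn : (0 < r / n%:R)%R by rewrite divr_gt0.
have <- : mu [set x | forall i, A i (x ord0 i)] = ((2 * r / n%:R) ^+ n)%:E.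
  rewrite lebesgue_rV_box//; last by move=> i; exact: measurable_itv.
  rewrite (eq_bigr (fun=> (2 * r / n%:R)%:E)).
    by rewrite prodEFin prodr_const card_ord.
  move=> i _; rewrite lebesgue_measure_itv/= lte_fin ifT; last by lra.
  by rewrite -EFinD; congr (_%:E); lra.
apply: le_measure; rewrite ?inE.
- by apply: measurable_box => i; exact: measurable_itv.
- exact: measurable_eball.
move=> x /= xA; apply: enorm_lt => // i; have := xA i.
by rewrite /A/= in_itv/= !mxE ltr_norml => /andP[h1 h2]; apply/andP; split; lra.
Qed.

End boxes.

(** * Dyadic sums and kernels *)

(** The square makes the base of the power nonnegative, where [powR] agrees with the inverse; at 0
    the outer factor gives the default value 0. *)
Lemma measurable_inv (R : realType) : measurable_fun [set: R] (@GRing.inv R).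
Proof.
rewrite (_ : @GRing.inv R = fun x => x * (x ^+ 2) `^ (-1)).
  apply: measurable_funM => //; apply: (@measurableT_comp _ _ _ _ _ _ (@powR R ^~ (-1))).
    exact: measurable_powR.
  exact: measurable_funX.
apply/funext => x; rewrite powR_inv1 ?sqr_ge0//.
have [->|x0] := eqVneq x 0; first by rewrite invr0 mul0r.
by field.
Qed.

Section dyadic_sums.
Local Open Scope ereal_scope.
Context d (T : measurableType d) (R : realType) (mu : {measure set T -> \bar R}).

(** At each point a single term already dominates [g], so the sets [B k] may be nested balls rather
    than disjoint annuli; the integrals of the terms form a geometric series. *)
Lemma integral_dyadic_le (B : nat -> set T) (h g : T -> R) (b : nat -> R) (A q : R) :
  (0 <= q < 1)%R -> (0 <= A)%R -> (forall k, measurable (B k)) ->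
  measurable_fun [set: T] h -> (forall x, (0 <= h x)%R) -> (forall k, (0 <= b k)%R) ->
  (forall x, (0 < g x)%R -> exists2 k, B k x & (g x <= b k * h x)%R) ->
  (forall k, \int[mu]_(x in B k) (b k * h x)%:E <= (A * q ^+ k)%:E) ->
  \int[mu]_x (g x)%:E <= (A / (1 - q))%:E.
Proof.
move=> /andP[q0 q1] A0 mB mh h0 b0 gbh BA.
pose F k x := ((fun x => (b k * h x)%:E) \_ (B k)) x.
have F0 k x : 0 <= F k x.
  by rewrite /F /patch; case: ifP => // _; rewrite lee_fin mulr_ge0.
have mF k : measurable_fun setT (F k).
  apply/(measurable_restrictT _ (mB k)) => //.
  by apply/measurable_EFinP/measurable_funM => //; exact: measurable_funTS.
apply: (@le_trans _ _ (\int[mu]_x \sum_(0 <= k <oo) F k x)).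
  apply: le_integral_gen => x _; first exact: nneseries_ge0.
  have [gx0|/gbh[k Bkx gk]] := leP (g x) 0%R.
    by apply: le_trans (nneseries_ge0 _); rewrite ?lee_fin.
  apply: (@le_trans _ _ (F k x)); first by rewrite /F /patch mem_set// lee_fin.
  apply: le_trans (nneseries_lim_ge k.+1 _) => //.
  by rewrite big_nat_recr//= leeDr// sume_ge0.
rewrite integral_nneseries//; apply: lime_le.
  by apply: is_cvg_nneseries => k _ _; exact: integral_ge0.
apply: nearW => m.
apply: (@le_trans _ _ (\sum_(0 <= k < m) (A * q ^+ k)%:E)).
  by apply: lee_sum => k _; rewrite /F -integral_mkcond.
rewrite sumEFin lee_fin -[X in (X <= _)%R]/(series (geometric A q) m).
rewrite geometric_seriesE ?lt_eqF//=.
rewrite ler_wpM2r ?invr_ge0 ?subr_ge0 ?(ltW q1)//.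
by rewrite ler_piMr// lerBlDr lerDl exprn_ge0.
Qed.

End dyadic_sums.

Section dyadic_scale.
Context {R : realType}.

(** The least k with s < 2^k r; the upper bound is minimality for k > 0 and is trivial for k = 0. *)
Lemma dyadic_scale (r s : R) : 0 < r -> 0 <= s ->
  exists k, s < 2 ^+ k * r /\ 2 ^+ k * r <= 2 * (r + s).
Proof.
move=> r0 s0.
have ex : exists k, s < 2 ^+ k * r.
  exists (Num.bound (s / r)).+1; rewrite -ltr_pdivrMr//.
  have := archi_boundP (divr_ge0 s0 (ltW r0)); move=> /lt_trans; apply.
  by rewrite -natrX ltr_nat (ltn_trans (ltn_expl _ (ltnSn 1)))// ltn_exp2l.
case: (ex_minnP ex) => k sk kmin; exists k; split => //.
case: k sk kmin => [_ _|k sk kmin]; first by rewrite expr0; lra.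
have := kmin k; rewrite ltnn => H.
have : 2 ^+ k * r <= s by rewrite leNgt; apply/negP => /H.
by rewrite exprS; lra.
Qed.

Definition isqrt2 : R := (Num.sqrt 2)^-1.

Lemma isqrt2_gt0 : 0 < isqrt2. Proof. by rewrite invr_gt0 sqrtr_gt0. Qed.

Lemma isqrt2_lt1 : isqrt2 < 1.
Proof.
rewrite invf_lt1 ?sqrtr_gt0// -(@ltr_pXn2r R 2)// ?nnegrE ?sqrtr_ge0//.
by rewrite sqr_sqrtr// expr1n ltr1n.
Qed.

Lemma sqr_isqrt2 : isqrt2 ^+ 2 = 2^-1.
Proof. by rewrite exprVn sqr_sqrtr. Qed.

End dyadic_scale.

Section kernels.
Context {R : realType} {n : nat}.
Local Notation mu := (@lebesgue_rV R n).
Implicit Types (x y z : 'rV[R]_n) (r s t : R).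

(** The size of a kernel of scale [t] with the decay of [psi], comparable to the Poisson kernel. *)
Definition wker t x : R := t / (t + enorm x) ^+ n.+1.

(** The factor t / (t + |x|) of [wker] is replaced by its square root. This dominates both [wker]
    and its product with sqrt(|x| / t), and its integral is still bounded independently of [t]. *)
Definition vker t x : R :=
  Num.sqrt t / ((t + enorm x) ^+ n * Num.sqrt (t + enorm x)).

Let te t x : 0 < t -> 0 < t + enorm x.
Proof. by move=> t0; rewrite ltr_wpDr ?enorm_ge0. Qed.

Lemma wker_ge0 t x : 0 < t -> 0 <= wker t x.
Proof. by move=> t0; rewrite divr_ge0 ?ltW// exprn_gt0// te. Qed.

Lemma vker_ge0 t x : 0 <= vker t x.
Proof.
have [t0|t0] := ltP 0 t; last by rewrite /vker ler0_sqrtr// mul0r.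
by rewrite divr_ge0 ?sqrtr_ge0// mulr_ge0 ?sqrtr_ge0// exprn_ge0// ltW// te.
Qed.

Lemma vkerB t x y : vker t (x - y) = vker t (y - x).
Proof. by rewrite /vker enormB. Qed.

Lemma measurable_wker : measurable_fun [set: R * 'rV[R]_n] (fun p => wker p.1 p.2).
Proof.
apply: measurable_funM => //; apply: (measurableT_comp (@measurable_inv R)).
apply: measurable_funX; apply: measurable_funD => //.
exact: (measurableT_comp measurable_enorm).
Qed.

Lemma measurable_vker : measurable_fun [set: R * 'rV[R]_n] (fun p => vker p.1 p.2).
Proof.
have ms : measurable_fun [set: R] (@Num.sqrt R).
  by apply: continuous_measurable_fun; exact: sqrt_continuous.
have mD : measurable_fun [set: R * 'rV[R]_n] (fun p => p.1 + enorm p.2).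
  by apply: measurable_funD => //; exact: (measurableT_comp measurable_enorm).
apply: measurable_funM; first exact: (measurableT_comp ms).
apply: (measurableT_comp (@measurable_inv R)).
by apply: measurable_funM; [exact: measurable_funX|exact: (measurableT_comp ms)].
Qed.

Lemma measurable_wker_sub t x : measurable_fun [set: 'rV[R]_n] (fun y => wker t (x - y)).
Proof.
apply: (measurableT_comp measurable_wker (g := fun y => (t, x - y))).
apply: measurable_fun_pair => //.
apply: (measurableT_comp measurable_subrV (g := fun y => (x, y))).
by apply: measurable_fun_pair.
Qed.

Lemma measurable_vker_sub t x : measurable_fun [set: 'rV[R]_n] (fun y => vker t (x - y)).
Proof.
apply: (measurableT_comp measurable_vker (g := fun y => (t, x - y))).
apply: measurable_fun_pair => //.
apply: (measurableT_comp measurable_subrV (g := fun y => (x, y))).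
by apply: measurable_fun_pair.
Qed.

Lemma wker_le_vker t x : 0 < t -> wker t x <= vker t x.
Proof.
move=> t0; have e0 := te x t0; rewrite /wker /vker.
rewrite ler_pdivrMr ?exprn_gt0// mulrAC ler_pdivlMr ?mulr_gt0 ?exprn_gt0 ?sqrtr_gt0//.
rewrite exprSr mulrCA [leRHS]mulrCA ler_wpM2l ?exprn_ge0 ?(ltW e0)//.
rewrite -[X in X * _ <= _](sqr_sqrtr (ltW t0)) -[X in _ <= _ * X](sqr_sqrtr (ltW e0)).
rewrite !expr2 -mulrA.
rewrite ler_wpM2l ?sqrtr_ge0// ler_wpM2r ?sqrtr_ge0// ler_wsqrtr//.
by rewrite lerDl enorm_ge0.
Qed.

Lemma sqrt_wker_le_vker t x : 0 < t -> Num.sqrt (enorm x / t) * wker t x <= vker t x.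
Proof.
move=> t0; have e0 := te x t0; rewrite /wker /vker sqrtrM ?enorm_ge0// sqrtrV ?(ltW t0)//.
rewrite mulrA ler_pdivrMr ?exprn_gt0// [leRHS]mulrAC ler_pdivlMr ?mulr_gt0 ?exprn_gt0 ?sqrtr_gt0//.
rewrite exprSr mulrCA [leRHS]mulrCA ler_wpM2l ?exprn_ge0 ?(ltW e0)//.
rewrite -[X in _ / _ * X * _ <= _](sqr_sqrtr (ltW t0)).
rewrite -[X in _ <= _ * X](sqr_sqrtr (ltW e0)).
rewrite (_ : _ / _ * _ ^+ 2 * _ =
    Num.sqrt t * Num.sqrt (enorm x) * Num.sqrt (t + enorm x)); last first.
  by field; rewrite sqrtr_eq0 -ltNge.
rewrite expr2 mulrA ler_wpM2r ?sqrtr_ge0// ler_wpM2l ?sqrtr_ge0// ler_wsqrtr//.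
by rewrite lerDr ltW.
Qed.

(** On the ball of radius 2 D, contained in a cube of side 4 D, the kernel is at most sqrt(t) / D^(n
    + 1/2). The volume gives 4^n, and sqrt(t / D) gives sqrt(2) times a geometric sequence of ratio
    [isqrt2]. *)
Definition vmass : R := 4 ^+ n * Num.sqrt 2 / (1 - isqrt2).

Lemma vmass_ge0 : 0 <= vmass.
Proof.
by rewrite !mulr_ge0 ?invr_ge0 ?subr_ge0 ?exprn_ge0 ?sqrtr_ge0 ?(ltW isqrt2_lt1).
Qed.

Lemma integral_vker_le t x : 0 < t ->
  (\int[mu]_z (vker t (x - z))%:E <= vmass%:E)%E.
Proof.
move=> t0; have st0 : 0 < Num.sqrt t by rewrite sqrtr_gt0.
pose D k : R := 2 ^+ k * t / 2.
have D0 k : 0 < D k by rewrite divr_gt0// mulr_gt0// exprn_gt0.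
apply: (@integral_dyadic_le _ _ _ _ (fun k => eball x (2 ^+ k * t)) (fun=> 1) _
  (fun k => Num.sqrt t / (D k ^+ n * Num.sqrt (D k)))) => //.
- by rewrite (ltW isqrt2_gt0) isqrt2_lt1.
- by move=> k; exact: measurable_eball.
- by move=> k; rewrite divr_ge0 ?mulr_ge0 ?exprn_ge0 ?sqrtr_ge0// ltW.
- move=> z _; have [k [xk kx]] := dyadic_scale t0 (enorm_ge0 (z - x)).
  exists k => //; rewrite mulr1 enormB in kx *; rewrite /vker.
  have Dk : D k <= t + enorm (x - z) by rewrite /D ler_pdivrMr// [leRHS]mulrC.
  rewrite ler_wpM2l ?sqrtr_ge0// lef_pV2 ?posrE ?mulr_gt0 ?exprn_gt0 ?sqrtr_gt0 ?te//.
  rewrite ler_pM ?exprn_ge0 ?sqrtr_ge0 ?(ltW (D0 k))//.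
    by rewrite lerXn2r ?nnegrE ?(ltW (D0 k)) ?(ltW (te _ t0)).
  by rewrite ler_wsqrtr.
move=> k; rewrite integral_cst; last exact: measurable_eball.
have tk : 0 < 2 ^+ k * t by rewrite mulr_gt0 ?exprn_gt0.
rewrite mulr1; set b := _ / _.
have b0 : 0 <= b by rewrite divr_ge0 ?mulr_ge0 ?exprn_ge0 ?sqrtr_ge0// ltW.
apply: (@le_trans _ _ (b%:E * ((2 * (2 ^+ k * t)) ^+ n)%:E)%E).
  by rewrite lee_wpmul2l ?lee_fin// lebesgue_eball_le.
rewrite -EFinM lee_fin /b.
have -> : 2 * (2 ^+ k * t) = 4 * D k by rewrite /D; field.
have s2 : 0 < Num.sqrt 2 :> R by rewrite sqrtr_gt0.
have sD : Num.sqrt (D k) = Num.sqrt t * Num.sqrt 2 ^+ k / Num.sqrt 2.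
  rewrite -[RHS]gtr0_norm ?divr_gt0 ?mulr_gt0 ?exprn_gt0// -sqrtr_sqr.
  congr Num.sqrt; rewrite expr_div_n exprMn -exprM mulnC exprM !sqr_sqrtr ?ltW//.
  by rewrite /D [t * _]mulrC.
rewrite sD; move: (D k) (D0 k) => e e0.
rewrite [(4 * e) ^+ n]exprMn /isqrt2 exprVn le_eqVlt; apply/orP; left; apply/eqP.
by field; rewrite !expf_neq0 ?gt_eqF.
Qed.

End kernels.

(** * Dyadic cubes *)

Section dyadic_cubes.
Context {R : realType} {n : nat}.
Local Notation mu := (@lebesgue_rV R n).
Local Notation cubeT := ('rV[R]_n * {posnum R})%type.
Implicit Types (Q : cubeT) (f g : 'rV[R]_n -> R) (b : {ffun 'I_n -> bool}).

Definition qset Q : set 'rV[R]_n := cube Q.1 Q.2%:num.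

Definition qchild b Q : cubeT :=
  (Q.1 + (Q.2%:num / 2) *: (\row_i (b i)%:R), (Q.2%:num / 2)%:pos).

Definition qvol Q : R := Q.2%:num ^+ n.

Definition qavg f Q : R := (qvol Q)^-1 * \int[mu]_(y in qset Q) f y.

Lemma qvol_gt0 Q : 0 < qvol Q. Proof. by rewrite exprn_gt0. Qed.

Lemma lebesgue_qset Q : mu (qset Q) = (qvol Q)%:E.
Proof. exact: lebesgue_cube. Qed.

Lemma measurable_qset Q : measurable (qset Q).
Proof. exact: measurable_cube. Qed.

Lemma qvol_child b Q : qvol Q = 2 ^+ n * qvol (qchild b Q).
Proof. by rewrite /qvol -exprMn/= mulrC divfK. Qed.

Lemma qchildP b Q y : qset (qchild b Q) y <-> qset Q y /\
  forall i, b i = (Q.1 ord0 i + Q.2%:num / 2 <= y ord0 i).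
Proof.
have l0 : 0 < Q.2%:num / 2 by [].
split => [H|[H1 H2] i].
  split=> i; have := H i; rewrite /= !mxE; case: (b i) => /=; lra.
have := H1 i; rewrite /= !mxE; have := H2 i; case: (b i) => /= E h.
  have {}E : Q.1 ord0 i + Q.2%:num / 2 <= y ord0 i by rewrite -E.
  lra.
have {}E : y ord0 i < Q.1 ord0 i + Q.2%:num / 2 by rewrite ltNge -E.
lra.
Qed.

Let chs : seq {ffun 'I_n -> bool} := index_enum _.

Lemma qsetE Q : qset Q = \big[setU/set0]_(b <- chs) qset (qchild b Q).
Proof.
rewrite -bigcup_seq; apply/seteqP; split => y.
  move=> Qy; exists [ffun i => Q.1 ord0 i + Q.2%:num / 2 <= y ord0 i].
    by rewrite /= mem_index_enum.
  by apply/qchildP; split => // i; rewrite ffunE.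
by move=> [b _ /qchildP[]].
Qed.

Lemma qchild_sub b Q : qset (qchild b Q) `<=` qset Q.
Proof. by move=> y /qchildP[]. Qed.

Lemma trivIset_qchild Q : trivIset [set` chs] (fun b => qset (qchild b Q)).
Proof.
move=> b b' _ _ [y [/qchildP[_ h] /qchildP[_ h']]].
by apply/ffunP => i; rewrite h h'.
Qed.

Lemma integral_qset Q f : measurable_fun (qset Q) f ->
  (\int[mu]_(y in qset Q) (f y)%:E =
   \sum_b \int[mu]_(y in qset (qchild b Q)) (f y)%:E)%E.
Proof.
move=> mf; rewrite [in LHS]qsetE integral_bigsetU_EFin//.
- by move=> b; exact: measurable_qset.
- exact: index_enum_uniq.
- exact: trivIset_qchild.
- by rewrite -qsetE; exact/measurable_EFinP.
Qed.

Lemma Rintegral_qset Q f : mu.-integrable (qset Q) (EFin \o f) ->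
  \int[mu]_(y in qset Q) f y = \sum_b \int[mu]_(y in qset (qchild b Q)) f y.
Proof.
move=> fi; have mf := measurable_int _ fi.
have ic b : mu.-integrable (qset (qchild b Q)) (EFin \o f).
  by apply: integrableS fi; [exact: measurable_qset|exact: measurable_qset|exact: qchild_sub].
rewrite /Rintegral integral_qset; last exact/measurable_EFinP.
rewrite -sum_fine// => b _; apply: integrable_fin_num => //; exact: measurable_qset.
Qed.

Definition qintegrable f := forall Q, mu.-integrable (qset Q) (EFin \o f).

Let I_gt0 : (0 < #|{: {ffun 'I_n -> bool}}|)%N.
Proof. by rewrite card_ffun card_bool card_ord expn_gt0. Qed.

Lemma qavg_child f Q : qintegrable f -> qavg f Q =
  #|{: {ffun 'I_n -> bool}}|%:R^-1 * \sum_b qavg f (qchild b Q).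
Proof.
move=> fi; rewrite /qavg Rintegral_qset// card_ffun card_bool card_ord natrX.
rewrite !mulr_sumr; apply: eq_bigr => b _.
by rewrite mulrA (qvol_child b) invfM.
Qed.

Lemma tree_avg_qavg f k Q : qintegrable f -> tree_avg qchild (qavg f) k Q = qavg f Q.
Proof.
by move=> fi; apply: tree_avg_martingale => //; move=> Q'; exact: qavg_child.
Qed.

Lemma qavg_cst c Q : qavg (fun=> c) Q = c.
Proof.
rewrite /qavg Rintegral_cst; last exact: measurable_qset.
rewrite [X in fine X]lebesgue_qset/=.
by rewrite mulrCA mulVf ?mulr1// gt_eqF// qvol_gt0.
Qed.

Lemma qintegrable_cst c : qintegrable (fun=> c).
Proof.
move=> Q; apply: integrable_abs_lty; first exact: measurable_cst.
rewrite integral_cst; last exact: measurable_qset.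
by rewrite [X in (_ * X)%E]lebesgue_qset -EFinM ltry.
Qed.

Lemma qintegrableD f g : qintegrable f -> qintegrable g ->
  qintegrable (fun y => f y + g y).
Proof. by move=> fi gi Q; apply: integrable_addr => //; exact: measurable_qset. Qed.

Lemma qintegrableB f g : qintegrable f -> qintegrable g ->
  qintegrable (fun y => f y - g y).
Proof. by move=> fi gi Q; apply: integrable_subr => //; exact: measurable_qset. Qed.

Lemma qintegrable_norm f : qintegrable f -> qintegrable (fun y => `|f y|).
Proof. by move=> fi Q; exact: integrable_norm. Qed.

Lemma qavgB f g Q : qintegrable f -> qintegrable g ->
  qavg (fun y => f y - g y) Q = qavg f Q - qavg g Q.
Proof.
by move=> fi gi; rewrite /qavg RintegralB ?mulrBr//; exact: measurable_qset.
Qed.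

Lemma qavgD f g Q : qintegrable f -> qintegrable g ->
  qavg (fun y => f y + g y) Q = qavg f Q + qavg g Q.
Proof.
by move=> fi gi; rewrite /qavg RintegralD ?mulrDr//; exact: measurable_qset.
Qed.

Lemma le_qavg f g Q : qintegrable f -> qintegrable g ->
  (forall y, f y <= g y) -> qavg f Q <= qavg g Q.
Proof.
move=> fi gi fg; rewrite /qavg ler_wpM2l ?invr_ge0 ?(ltW (qvol_gt0 _))//.
by apply: le_Rintegral => //; exact: measurable_qset.
Qed.

Lemma normr_qavg f Q : qintegrable f -> `|qavg f Q| <= qavg (fun y => `|f y|) Q.
Proof.
move=> fi; rewrite /qavg normrM gtr0_norm ?invr_gt0 ?qvol_gt0//.
rewrite ler_wpM2l ?invr_ge0 ?(ltW (qvol_gt0 _))//.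
by apply: le_normr_Rintegral => //; exact: measurable_qset.
Qed.

(** Up to the factor 2, the mean is as good a centre as any other constant, for instance the average
    over a nearby ball. *)
Lemma qavg_osc f c Q : qintegrable f ->
  qavg (fun y => `|f y - qavg f Q|) Q <= 2 * qavg (fun y => `|f y - c|) Q.
Proof.
move=> fi; set m := qavg f Q.
have fci : qintegrable (fun y => f y - c) by apply: qintegrableB => //; exact: qintegrable_cst.
have fni := qintegrable_norm fci.
have mc : `|m - c| <= qavg (fun y => `|f y - c|) Q.
  apply: le_trans (normr_qavg _ fci).
  by rewrite qavgB ?qavg_cst//; exact: qintegrable_cst.
apply: (@le_trans _ _ (qavg (fun y => `|f y - c| + `|m - c|) Q)).
  apply: le_qavg => [||y].
  - by apply/qintegrable_norm/qintegrableB => //; exact: qintegrable_cst.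
  - by apply: qintegrableD => //; exact: qintegrable_cst.
  - by rewrite [`|m - c|]distrC -[X in `|X|](subrKA c) ler_normD.
rewrite qavgD// ?qavg_cst; last exact: qintegrable_cst.
lra.
Qed.

(** The triangle inequality for the average over each small cube, followed by the martingale
    property of the averages of |f - c|. *)
Lemma tree_avg_osc f c k Q : qintegrable f ->
  tree_avg qchild (fun Q' => `|qavg f Q' - c|) k Q <= qavg (fun y => `|f y - c|) Q.
Proof.
move=> fi.
have fci : qintegrable (fun y => f y - c) by apply: qintegrableB => //; exact: qintegrable_cst.
rewrite -(tree_avg_qavg k Q (qintegrable_norm fci)).
apply: le_tree_avg => Q'; apply: le_trans (normr_qavg _ fci).
by rewrite qavgB ?qavg_cst//; exact: qintegrable_cst.
Qed.

Lemma qavg_john_nirenberg f (N : R) : qintegrable f -> 0 < N ->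
  (forall Q, qavg (fun y => `|f y - qavg f Q|) Q <= N) ->
  forall k Q, tree_avg qchild (fun Q' => (qavg f Q' - qavg f Q) ^+ 2) k Q <=
    2 * (2 + 2 ^+ n) ^+ 2 * N ^+ 2.
Proof.
move=> fi N0 osc k Q.
have := @tree_john_nirenberg R _ _ qchild I_gt0 (qavg f) _ N N0 _ k Q.
rewrite card_ffun card_bool card_ord natrX; apply.
- by move=> Q'; have := qavg_child Q' fi; rewrite card_ffun card_bool card_ord natrX.
- by move=> k' Q'; apply: le_trans (tree_avg_osc _ _ _ fi) (osc Q').
Qed.

(** On [Q], the step function equal to [F Q'] on each descendant [Q'] of depth [k]; for
    [F := qavg f] it is the conditional expectation of f. It vanishes off [Q] if k > 0, but is
    constant on the whole space if k = 0. *)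
Fixpoint qstep (F : cubeT -> R) k Q (y : 'rV[R]_n) : R :=
  if k is k'.+1 then \sum_b \1_(qset (qchild b Q)) y * qstep F k' (qchild b Q) y
  else F Q.

Lemma qstep_child F k Q b y : qset (qchild b Q) y ->
  qstep F k.+1 Q y = qstep F k (qchild b Q) y.
Proof.
move=> Qy /=; rewrite (bigD1 b)//= indicE mem_set// mul1r big1 ?addr0// => b' bb'.
rewrite indicE memNset ?mul0r// => Qy'; move/eqP: bb'; apply.
by apply: (@trivIset_qchild Q b' b); rewrite /= ?mem_index_enum//; exists y.
Qed.

Lemma measurable_qstep F k Q : measurable_fun [set: 'rV[R]_n] (qstep F k Q).
Proof.
elim: k Q => [|k IH] Q; first exact: measurable_cst.
apply: measurable_sum => b; apply: measurable_funM => //.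
exact: measurable_indic (measurable_qset _).
Qed.

Lemma qstep_bounded F k Q : exists H : R, forall y, `|qstep F k Q y| <= H.
Proof.
elim: k Q => [|k IH] Q; first by exists `|F Q|.
have [H HP] := choice (fun b => IH (qchild b Q)).
exists (\sum_b H b) => y /=; apply: le_trans (ler_norm_sum _ _ _) _.
apply: ler_sum => b _; rewrite normrM -[leRHS]mul1r ler_pM//.
by rewrite indicE; case: (_ \in _); rewrite ?normr1 ?normr0.
Qed.

Lemma integral_sqr_qstep F k Q : (\int[mu]_(y in qset Q) (qstep F k Q y ^+ 2)%:E =
  (qvol Q * tree_avg qchild (fun Q => F Q ^+ 2) k Q)%:E)%E.
Proof.
elim: k Q => [|k IH] Q.
  rewrite /= integral_cst; last exact: measurable_qset.
  by rewrite [X in (_ * X)%E]lebesgue_qset -EFinM mulrC.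
rewrite integral_qset; last first.
  by apply: measurable_funX; apply: measurable_funTS; exact: measurable_qstep.
rewrite (eq_bigr (fun b => (qvol (qchild b Q) *
    tree_avg qchild (fun Q => F Q ^+ 2) k (qchild b Q))%:E)); last first.
  move=> b _; rewrite -IH; apply: eq_integral => y /set_mem Qy.
  by rewrite (qstep_child _ _ Qy).
rewrite sumEFin /= card_ffun card_bool card_ord natrX; congr (_%:E).
rewrite !mulr_sumr; apply: eq_bigr => b _.
by rewrite (qvol_child b Q); field; rewrite expf_neq0.
Qed.

Lemma qset_diam Q y : qset Q y -> enorm (y - Q.1) <= n%:R * Q.2%:num.
Proof.
move=> Qy; apply: enorm_le_coord => // i; have := Qy i.
by rewrite !mxE => h; rewrite ger0_norm; lra.
Qed.

Lemma qintegrableM (phi : 'rV[R]_n -> R) (B : R) f : measurable_fun [set: 'rV[R]_n] phi ->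
  (forall y, `|phi y| <= B) -> qintegrable f -> qintegrable (fun y => phi y * f y).
Proof.
move=> mphi phiB fi Q; have mQ := measurable_qset Q.
have mf : measurable_fun (qset Q) f.
  by have := measurable_int _ (fi Q); move/measurable_EFinP.
apply: integrable_abs_lty; first by apply: measurable_funM => //; exact: measurable_funTS.
have fn : (\int[mu]_(y in qset Q) `|f y|%:E <= (\int[mu]_(y in qset Q) `|f y|)%:E)%E.
  by rewrite fineK// integrable_fin_num//; exact: (qintegrable_norm fi).
apply: (integral_lty_mul mQ _ _ _ _ fn).
- by apply: le_trans (phiB point).
- exact: measurableT_comp.
- by move=> y _.
- by move=> y _; rewrite normrM ler_wpM2r.
Qed.

Lemma qintegrable_bounded (phi : 'rV[R]_n -> R) (B : R) : measurable_fun [set: 'rV[R]_n] phi ->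
  (forall y, `|phi y| <= B) -> qintegrable phi.
Proof.
move=> mphi phiB; have := qintegrableM mphi phiB (qintegrable_cst 1).
by rewrite (_ : (fun y => _) = phi)//; apply/funext => y; rewrite mulr1.
Qed.

(* The step functions converge weakly to [f] against Lipschitz functions. *)
Lemma qstep_weak f (phi : 'rV[R]_n -> R) (L B : R) k Q : qintegrable f ->
  measurable_fun [set: 'rV[R]_n] phi -> 0 <= L ->
  (forall y, `|phi y| <= B) ->
  (forall y z, `|phi y - phi z| <= L * enorm (y - z)) ->
  `|\int[mu]_(y in qset Q) (phi y * (f y - qstep (qavg f) k Q y))| <=
  2 * L * n%:R * Q.2%:num / 2 ^+ k * \int[mu]_(y in qset Q) `|f y|.
Proof.
move=> fi mphi L0 phiB phiL; elim: k Q => [|k IH] Q; last first.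
  rewrite Rintegral_qset; last first.
    apply: (qintegrableM mphi phiB); apply: qintegrableB => //.
    have [H HP] := qstep_bounded (qavg f) k.+1 Q.
    by apply: qintegrable_bounded HP; exact: measurable_qstep.
  rewrite [in leRHS]Rintegral_qset; last exact: (qintegrable_norm fi).
  apply: le_trans (ler_norm_sum _ _ _) _.
  rewrite mulr_sumr; apply: ler_sum => b _.
  apply: (@le_trans _ _ (2 * L * n%:R * (qchild b Q).2%:num / 2 ^+ k *
     \int[mu]_(y in qset (qchild b Q)) `|f y|)).
    apply: le_trans (IH (qchild b Q)); rewrite le_eqVlt; apply/orP; left.
    apply/eqP; congr (`|_|); apply: eq_Rintegral => y /set_mem Qy.
    by rewrite (qstep_child _ _ Qy).
  by rewrite /= exprS invfM !mulrA [_ * 2^-1 * _]mulrAC.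
rewrite /= expr0 divr1.
set m := qavg f Q.
have mQ := measurable_qset Q.
have fmi : qintegrable (fun y => f y - m) by apply: qintegrableB => //; exact: qintegrable_cst.
have i1 : qintegrable (fun y => (phi y - phi Q.1) * (f y - m)).
  apply: (@qintegrableM _ (B + B)) => //; first exact: measurable_funB.
  by move=> y; apply: le_trans (ler_normB _ _) _; rewrite lerD.
have fm0 : \int[mu]_(y in qset Q) (f y - m) = 0.
  have : qavg (fun y => f y - m) Q = 0.
    by rewrite qavgB ?qavg_cst ?subrr//; exact: qintegrable_cst.
  by move=> /eqP; rewrite mulf_eq0 invr_eq0 gt_eqF ?qvol_gt0//= => /eqP.
(* On a terminal cube [f - m] has mean zero, so [phi Q.1] can be subtracted from [phi]; the
   Lipschitz bound then gains the diameter of the cube. *)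
have -> : \int[mu]_(y in qset Q) (phi y * (f y - m)) =
    \int[mu]_(y in qset Q) ((phi y - phi Q.1) * (f y - m)).
  rewrite -[RHS]addr0 -[X in _ = _ + X](mulr0 (phi Q.1)) -fm0.
  rewrite -(RintegralZl (phi Q.1) mQ (fmi Q)).
  have i2 : qintegrable (fun y => phi Q.1 * (f y - m)).
    by apply: (@qintegrableM (fun=> phi Q.1) `|phi Q.1|) => //; exact: measurable_cst.
  rewrite -(RintegralD mQ (i1 Q) (i2 Q)).
  by apply: eq_Rintegral => y _; ring.
apply: le_trans (le_normr_Rintegral mQ (i1 Q)) _.
apply: (@le_trans _ _ (\int[mu]_(y in qset Q) (L * n%:R * Q.2%:num * `|f y - m|))).
  apply: le_Rintegral => //.
  - exact: (qintegrable_norm i1).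
  - by apply: integrable_scale => //; exact: (qintegrable_norm fmi).
  - move=> y Qy; rewrite normrM ler_wpM2r//; apply: le_trans (phiL _ _) _.
    by rewrite -mulrA ler_wpM2l// qset_diam.
rewrite RintegralZl//; last exact: (qintegrable_norm fmi).
(* The centre 0 bounds the integral of |f - m| by twice that of |f|, which is additive over the
   children. *)
have := qavg_osc 0 Q fi; rewrite /qavg mulrCA ler_pM2l ?invr_gt0 ?qvol_gt0//.
under [X in _ <= _ * X -> _]eq_Rintegral do rewrite subr0.
move=> /(ler_wpM2l (_ : 0 <= L * n%:R * Q.2%:num)) H.
by apply: le_trans (H _) _; [rewrite !mulr_ge0|rewrite le_eqVlt; apply/orP; left; apply/eqP; ring].
Qed.

End dyadic_cubes.

(** * Mean oscillation on balls *)

Section bmo.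
Context {R : realType} {n : nat}.
Hypothesis n_gt0 : (0 < n)%N.
Local Notation mu := (@lebesgue_rV R n).
Local Notation cubeT := ('rV[R]_n * {posnum R})%type.
Implicit Types (Q : cubeT) (f g : 'rV[R]_n -> R) (c : 'rV[R]_n) (r : R).

Definition ball_vol c r : R := fine (mu (eball c r)).

Definition ball_avg f c r : R :=
  (ball_vol c r)^-1 * \int[mu]_(y in eball c r) f y.

(** A real bound [N] rather than the norm itself, so that [N] can be taken positive; [f] is Borel
    measurable here, whereas [BMO] only asks for Lebesgue measurability. *)
Record bmo_le f (N : R) : Prop := BmoLe {
  bmo_measurable : measurable_fun [set: 'rV[R]_n] f ;
  bmo_integrable : forall c r, 0 < r -> mu.-integrable (eball c r) (EFin \o f) ;
  bmo_osc : forall c r, 0 < r ->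
    \int[mu]_(y in eball c r) `|f y - ball_avg f c r| <= N * ball_vol c r }.

Let n0 : 0 < n%:R :> R. Proof. by rewrite ltr0n. Qed.

Lemma lebesgue_eball c r : 0 < r -> mu (eball c r) = (ball_vol c r)%:E.
Proof.
move=> r0; rewrite /ball_vol fineK// ge0_fin_numE//.
by apply: le_lt_trans (lebesgue_eball_le c r0) _; rewrite ltry.
Qed.

Lemma ball_vol_le c r : 0 < r -> ball_vol c r <= (2 * r) ^+ n.
Proof. by move=> r0; rewrite -lee_fin -lebesgue_eball// lebesgue_eball_le. Qed.

Lemma ball_vol_ge c r : 0 < r -> (2 * r / n%:R) ^+ n <= ball_vol c r.
Proof. by move=> r0; rewrite -lee_fin -lebesgue_eball// lebesgue_eball_ge. Qed.

Lemma ball_vol_gt0 c r : 0 < r -> 0 < ball_vol c r.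
Proof.
move=> r0; apply: lt_le_trans (ball_vol_ge c r0).
by rewrite exprn_gt0// divr_gt0// mulr_gt0.
Qed.

Lemma ball_integrable_cst c r (m : R) : 0 < r ->
  mu.-integrable (eball c r) (EFin \o (fun=> m)).
Proof.
move=> r0; apply: integrable_abs_lty; first exact: measurable_cst.
rewrite integral_cst; last exact: measurable_eball.
by rewrite [X in (_ * X)%E]lebesgue_eball// -EFinM ltry.
Qed.

Lemma qset_sub_ball Q r : n%:R * Q.2%:num < r -> qset Q `<=` eball Q.1 r.
Proof. by move=> lr y /qset_diam; rewrite /eball/= => /le_lt_trans; apply. Qed.

Variables (f : 'rV[R]_n -> R) (N : R).
Hypothesis fN : bmo_le f N.

Let mf := bmo_measurable fN.

Lemma ball_integrableB c r (m : R) : 0 < r ->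
  mu.-integrable (eball c r) (EFin \o (fun y => f y - m)).
Proof.
move=> r0; apply: integrable_subr; first exact: measurable_eball.
  exact: (bmo_integrable fN).
exact: ball_integrable_cst.
Qed.

Lemma bmo_le_ge0 : 0 <= N.
Proof.
have := bmo_osc fN 0 ltr01; rewrite -ler_pdivrMr ?ball_vol_gt0//; apply: le_trans.
by rewrite divr_ge0 ?(ltW (ball_vol_gt0 _ _))//; apply: Rintegral_ge0.
Qed.

Lemma bmo_qintegrable : qintegrable f.
Proof.
move=> Q; have r0 : 0 < n%:R * Q.2%:num * 2 by rewrite !mulr_gt0.
apply: integrableS (bmo_integrable fN Q.1 r0).
- exact: measurable_eball.
- exact: measurable_qset.
- by apply: qset_sub_ball; rewrite ltr_pMr ?ltr1n// mulr_gt0.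
Qed.

Lemma avg_sub_le c r (S : set 'rV[R]_n) : 0 < r -> measurable S ->
  S `<=` eball c r ->
  \int[mu]_(y in S) `|f y - ball_avg f c r| <= N * (2 * r) ^+ n.
Proof.
move=> r0 mS SB; have fi := ball_integrableB c (ball_avg f c r) r0.
have mB := measurable_eball c r.
have ni : mu.-integrable (eball c r) (fun y => `|f y - ball_avg f c r|%:E).
  exact: integrable_norm.
have niS : mu.-integrable S (fun y => `|f y - ball_avg f c r|%:E).
  exact: integrableS ni.
apply: (@le_trans _ _ (\int[mu]_(y in eball c r) `|f y - ball_avg f c r|)).
  rewrite -lee_fin !fineK ?integrable_fin_num//; apply: ge0_subset_integral => //.
  exact: (measurable_int _ ni).
apply: le_trans (bmo_osc fN c r0) _.
by rewrite ler_wpM2l ?bmo_le_ge0// ball_vol_le.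
Qed.

Lemma qavg_ball_dist Q r : n%:R * Q.2%:num < r ->
  `|qavg f Q - ball_avg f Q.1 r| <= (2 * r / Q.2%:num) ^+ n * N.
Proof.
move=> lr; have r0 : 0 < r by apply: lt_trans lr; rewrite mulr_gt0.
have fmi : qintegrable (fun y => f y - ball_avg f Q.1 r).
  by apply: qintegrableB; [exact: bmo_qintegrable|exact: qintegrable_cst].
have := normr_qavg Q fmi.
rewrite qavgB; [|exact: bmo_qintegrable|exact: qintegrable_cst].
rewrite qavg_cst => /le_trans; apply.
rewrite /qavg mulrC ler_pdivrMr ?qvol_gt0//.
apply: le_trans (avg_sub_le r0 (measurable_qset Q) (qset_sub_ball lr)) _.
rewrite /qvol expr_div_n mulrAC divfK ?expf_neq0//.
by rewrite mulrC.
Qed.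

(** The ball of radius 2 n l about the corner contains the cube of side l and lies in a cube of side
    4 n l, whence (4 n)^n; the factor 2 pays for recentring at the average over [Q]. *)
Lemma qavg_bmo Q : qavg (fun y => `|f y - qavg f Q|) Q <= 2 * (4 * n%:R) ^+ n * N.
Proof.
have l0 : 0 < Q.2%:num by [].
have lr : n%:R * Q.2%:num < 2 * n%:R * Q.2%:num.
  by rewrite -mulrA ltr_pMl ?ltr1n// mulr_gt0.
have r0 : 0 < 2 * n%:R * Q.2%:num by rewrite !mulr_gt0.
apply: le_trans (qavg_osc (ball_avg f Q.1 (2 * n%:R * Q.2%:num)) _ bmo_qintegrable) _.
rewrite -[leRHS]mulrA ler_pM2l// /qavg mulrC ler_pdivrMr ?qvol_gt0//.
apply: le_trans (avg_sub_le r0 (measurable_qset Q) (qset_sub_ball lr)) _.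
have -> : 2 * (2 * n%:R * Q.2%:num) = 4 * n%:R * Q.2%:num :> R.
  by rewrite !mulrA -natrM.
rewrite /qvol.
by rewrite exprMn mulrC mulrAC.
Qed.

(** The oscillation on the large ball is integrated over the small one. The volume bounds (4 r)^n
    above and (2 r / n)^n below have quotient (2 n)^n. *)
Lemma ball_avg_double c r : 0 < r ->
  `|ball_avg f c r - ball_avg f c (2 * r)| <= (2 * n%:R) ^+ n * N.
Proof.
move=> r0; have r20 : 0 < 2 * r by rewrite mulr_gt0.
have mB := measurable_eball c r.
have sB : eball c r `<=` eball c (2 * r).
  by move=> y; rewrite /eball/= => /lt_le_trans; apply; lra.
have v0 := ball_vol_gt0 c r0.
have -> : ball_avg f c r - ball_avg f c (2 * r) =
    (ball_vol c r)^-1 * \int[mu]_(y in eball c r) (f y - ball_avg f c (2 * r)).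
  rewrite RintegralB//; [|exact: (bmo_integrable fN)|exact: ball_integrable_cst].
  rewrite Rintegral_cst// mulrBr -/(ball_vol c r); congr (_ - _).
  by rewrite mulrCA mulVf ?mulr1// gt_eqF.
rewrite normrM gtr0_norm ?invr_gt0// mulrC ler_pdivrMr//.
apply: le_trans (le_normr_Rintegral mB (ball_integrableB _ _ _)) _ => //.
apply: le_trans (avg_sub_le r20 mB sB) _.
rewrite [leRHS]mulrAC mulrC ler_wpM2r ?bmo_le_ge0//.
apply: (@le_trans _ _ ((2 * n%:R) ^+ n * (2 * r / n%:R) ^+ n)); last first.
  by rewrite ler_wpM2l ?ball_vol_ge// exprn_ge0// mulr_ge0.
by rewrite -exprMn le_eqVlt; apply/orP; left; apply/eqP; congr (_ ^+ _); field; rewrite gt_eqF.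
Qed.

Lemma ball_avg_dyadic c r k : 0 < r ->
  `|ball_avg f c r - ball_avg f c (2 ^+ k * r)| <= k%:R * ((2 * n%:R) ^+ n * N).
Proof.
move=> r0; elim: k => [|k IH]; first by rewrite expr0 mul1r subrr normr0 mul0r.
rewrite -(subrKA (ball_avg f c (2 ^+ k * r))); apply: le_trans (ler_normD _ _) _.
rewrite exprS -mulrA -[k.+1%:R]natr1 [leRHS]mulrDl mul1r lerD//.
by apply: ball_avg_double; rewrite mulr_gt0// exprn_gt0.
Qed.

Lemma integral_dyadic_ball c r (m K : R) k : 0 < r -> `|ball_avg f c r - m| <= K * N ->
  \int[mu]_(y in eball c (2 ^+ k * r)) `|f y - m| <=
  (1 + K + k%:R * (2 * n%:R) ^+ n) * N * (2 * (2 ^+ k * r)) ^+ n.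
Proof.
move=> r0 mK; set s := 2 ^+ k * r; have s0 : 0 < s by rewrite mulr_gt0// exprn_gt0.
have mB := measurable_eball c s.
have ms : `|ball_avg f c s - m| <= (K + k%:R * (2 * n%:R) ^+ n) * N.
  rewrite -(subrKA (ball_avg f c r)); apply: le_trans (ler_normD _ _) _.
  by rewrite mulrDl addrC lerD// distrC -mulrA ball_avg_dyadic.
have i1 : mu.-integrable (eball c s) (fun y => `|f y - ball_avg f c s|%:E).
  by apply: integrable_norm; exact: ball_integrableB.
have i2 : mu.-integrable (eball c s) (fun=> `|ball_avg f c s - m|%:E).
  exact: ball_integrable_cst.
apply: (@le_trans _ _ (\int[mu]_(y in eball c s)
    (`|f y - ball_avg f c s| + `|ball_avg f c s - m|))).
  apply: le_Rintegral => //.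
  - by apply: integrable_norm; exact: ball_integrableB.
  - exact: integrable_addr.
  - by move=> y _; rewrite -[X in `|X|](subrKA (ball_avg f c s)) ler_normD.
rewrite RintegralD// Rintegral_cst// -/(ball_vol c s) -addrA mulrDl mul1r mulrDl.
apply: lerD.
  apply: le_trans (bmo_osc fN c s0) _.
  by rewrite ler_wpM2l ?bmo_le_ge0// ball_vol_le.
by rewrite ler_pM ?ball_vol_le// (ltW (ball_vol_gt0 _ _)).
Qed.

(** Absorbs the linear growth of the averages over doubled balls: a series of ratio 1/2 with a
    factor k is bounded by one of ratio 1/sqrt(2). Bernoulli's inequality with sqrt(2) >= 5/4. *)
Lemma natr_le_sqrt2X k : k%:R <= 4 * Num.sqrt 2 ^+ k :> R.
Proof.
have s2 : 1 + 4^-1 <= Num.sqrt 2 :> R.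
  rewrite -(@ler_sqr R) ?nnegrE ?sqrtr_ge0// ?sqr_sqrtr//; lra.
suff : 1 + k%:R / 4 <= Num.sqrt 2 ^+ k :> R by lra.
elim: k => [|k IH]; first by rewrite expr0 mul0r addr0.
rewrite exprS; have k0 : 0 <= k%:R :> R by [].
rewrite -[k.+1%:R]natr1.
apply: (@le_trans _ _ ((1 + 4^-1) * (1 + k%:R / 4))); first lra.
by rewrite ler_pM//; lra.
Qed.

Definition tail_cst (K : R) : R :=
  2 * 4 ^+ n * (1 + K + 4 * (2 * n%:R) ^+ n) / (1 - isqrt2).

(** The classical tail estimate for BMO. On the ball of radius 2^k r the mean of |f - m| is
    controlled by 1 from the oscillation there, [K] from the choice of [m], and k (2 n)^n from k
    doublings, while the kernel decays by one more factor 2^-k than the volume grows. *)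
Lemma integral_bmo_tail c r (m K : R) : 0 < r -> 0 <= K ->
  `|ball_avg f c r - m| <= K * N ->
  (\int[mu]_y (wker r (c - y) * `|f y - m|)%:E <= (tail_cst K * N)%:E)%E.
Proof.
move=> r0 K0 mK; have N0 := bmo_le_ge0.
have K'0 : 0 <= 1 + K + 4 * (2 * n%:R) ^+ n.
  by rewrite !addr_ge0// mulr_ge0// exprn_ge0// mulr_ge0.
pose D k : R := 2 ^+ k * r / 2.
have D0 k : 0 < D k by rewrite divr_gt0// mulr_gt0// exprn_gt0.
have s2 : 0 < Num.sqrt 2 :> R by rewrite sqrtr_gt0.
rewrite /tail_cst mulrAC.
apply: (@integral_dyadic_le _ _ _ _ (fun k => eball c (2 ^+ k * r)) (fun y => `|f y - m|) _
  (fun k => r / D k ^+ n.+1)) => //.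
- by rewrite (ltW isqrt2_gt0) isqrt2_lt1.
- by rewrite !mulr_ge0// exprn_ge0.
- by move=> k; exact: measurable_eball.
- by apply: measurableT_comp => //; apply: measurable_funB.
- by move=> k; rewrite divr_ge0 ?exprn_ge0// ltW.
- move=> y _; have [k [xk kx]] := dyadic_scale r0 (enorm_ge0 (y - c)).
  exists k => //; rewrite ler_wpM2r// /wker enormB.
  rewrite ler_wpM2l ?(ltW r0)// lef_pV2 ?posrE ?exprn_gt0//; last first.
    by rewrite ltr_wpDr ?enorm_ge0.
  rewrite lerXn2r ?nnegrE ?(ltW (D0 k)) ?addr_ge0 ?enorm_ge0 ?(ltW r0)//.
  by rewrite /D ler_pdivrMr// [leRHS]mulrC.
move=> k; have tk : 0 < 2 ^+ k * r by rewrite mulr_gt0 ?exprn_gt0.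
have b0 : 0 <= r / D k ^+ n.+1 by rewrite divr_ge0 ?exprn_ge0// ltW.
have i1 : mu.-integrable (eball c (2 ^+ k * r)) (fun y => `|f y - m|%:E).
  by apply: integrable_norm; exact: ball_integrableB.
under eq_integral do rewrite EFinM.
rewrite ge0_integralZl//; last 2 first.
- exact: measurable_eball.
- exact: (measurable_int _ i1).
rewrite -[X in (_ * X)%E]fineK; last first.
  by apply: integrable_fin_num => //; exact: measurable_eball.
rewrite -EFinM lee_fin.
apply: le_trans (ler_wpM2l b0 (integral_dyadic_ball k r0 mK)) _.
have kk : (1 + K + k%:R * (2 * n%:R) ^+ n) <=
    (1 + K + 4 * (2 * n%:R) ^+ n) * Num.sqrt 2 ^+ k.
  have p0 : 0 <= (2 * n%:R) ^+ n :> R by rewrite exprn_ge0// mulr_ge0.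
  have := ler_wpM2r p0 (natr_le_sqrt2X k).
  have : 1 <= Num.sqrt 2 ^+ k :> R.
    by rewrite exprn_ege1// -(@ler_sqr R) ?nnegrE ?sqrtr_ge0// ?sqr_sqrtr//; lra.
  by nra.
apply: (@le_trans _ _ (r / D k ^+ n.+1 *
   ((1 + K + 4 * (2 * n%:R) ^+ n) * Num.sqrt 2 ^+ k * N * (4 * D k) ^+ n))).
  have -> : 2 * (2 ^+ k * r) = 4 * D k by rewrite /D; field.
  rewrite ler_wpM2l//.
  have e4 : 0 <= (4 * D k) ^+ n by rewrite exprn_ge0// mulr_ge0// ltW.
  by apply: (ler_wpM2r e4); apply: (ler_wpM2r N0).
rewrite [(4 * D k) ^+ n]exprMn exprS.
have -> : Num.sqrt 2 ^+ k = 2 ^+ k * isqrt2 ^+ k :> R.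
  rewrite /isqrt2 exprVn -[X in X ^+ k * _](sqr_sqrtr (ler0n R 2)) exprAC expr2.
  by rewrite mulfK// expf_neq0// gt_eqF.
rewrite le_eqVlt; apply/orP; left; apply/eqP.
have e0 := D0 k; have -> : r = 2 * D k / 2 ^+ k by rewrite /D; field; rewrite expf_neq0.
move: (D k) e0 => e e0.
by field; rewrite !expf_neq0 ?gt_eqF.
Qed.

End bmo.

(** * Square function bound on L2 *)

Section schur_weight.
Context {R : realType}.
Local Notation leb := (@lebesgue_measure R).
Local Open Scope ereal_scope.

Lemma integral_dyadic_itv (D : set R) (g : R -> R) (b rad : nat -> R) (A q : R) :
  measurable D -> D `<=` `]0%R, +oo[ ->
  (0 <= q)%R -> (q < 1)%R -> (0 <= A)%R ->
  (forall k, (0 <= b k)%R) -> (forall k, (0 < rad k)%R) ->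
  (forall s, D s -> exists2 k, (s <= rad k)%R & (g s <= b k)%R) ->
  (forall k, (b k * rad k <= A * q ^+ k)%R) ->
  \int[leb]_(s in D) (g s)%:E <= (A / (1 - q))%:E.
Proof.
move=> mD D0 q0 q1 A0 b0 rad0 gb bA; rewrite integral_mkcond.
pose g' s := if s \in D then g s else 0%R.
rewrite (_ : \int[leb]_x _ = \int[leb]_s (g' s)%:E); last first.
  by apply: eq_integral => s _; rewrite /patch /g'; case: ifP.
apply: (@integral_dyadic_le _ (measurableTypeR R) R leb (fun k => `[0%R, rad k]%classic)
  (\1_D : R -> R) _ b) => //.
- by rewrite q0 q1.
- move=> s; rewrite /g' indicE; case: ifPn => [/set_mem Ds _|]; last by rewrite ltxx.
  have [k sk gk] := gb s Ds; exists k => /=; last by rewrite mulr1.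
  by have := D0 s Ds; rewrite /= !in_itv/= andbT => /ltW ->.
- move=> k; apply: (@le_trans _ _ (\int[leb]_(s in `[0%R, rad k]) (b k)%:E)).
    apply: le_integral_gen => s _; first by rewrite lee_fin.
    by rewrite lee_fin ler_piMr// indicE; case: (_ \in _).
  rewrite integral_cst//= lebesgue_measure_itv/= lte_fin rad0 sube0.
  by rewrite -EFinM lee_fin.
Qed.

(** With [integral_sqrt_large], the two halves of Schur's integral of sqrt(min(s,t) / max(s,t))
    against ds/s. *)
Lemma integral_sqrt_small (t : R) : (0 < t)%R ->
  \int[leb]_(s in `]0%R, t]) (Num.sqrt (s / t) / s)%:E <= (4 / (1 - isqrt2))%:E.
Proof.
move=> t0; have s2 : (0 < Num.sqrt 2 :> R)%R by rewrite sqrtr_gt0.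
apply: (@integral_dyadic_itv _ _ (fun k => Num.sqrt 2 ^+ k / t)%R
  (fun k => 4 * t / 2 ^+ k)%R) => //.
- by move=> s /=; rewrite !in_itv/= andbT => /andP[].
- by rewrite (ltW isqrt2_gt0).
- by rewrite isqrt2_lt1.
- by move=> k; rewrite divr_ge0 ?exprn_ge0// ltW.
- by move=> k; rewrite divr_gt0 ?exprn_gt0// mulr_gt0.
- move=> s /=; rewrite in_itv/= => /andP[s0 st].
  have [k [tk ks]] := dyadic_scale s0 (ltW t0).
  exists k; first by rewrite ler_pdivlMr ?exprn_gt0// mulrC; lra.
  have -> : (Num.sqrt (s / t) / s = (Num.sqrt s * Num.sqrt t)^-1)%R.
    rewrite sqrtrM ?(ltW s0)// sqrtrV ?(ltW t0)// -[X in (_ / X)%R](sqr_sqrtr (ltW s0)).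
    by field; rewrite !sqrtr_eq0 -!ltNge s0 t0.
  rewrite -[leRHS]invrK lef_pV2 ?posrE ?invr_gt0 ?mulr_gt0 ?divr_gt0 ?exprn_gt0 ?sqrtr_gt0//;
    last by rewrite invr_gt0.
  rewrite invf_div ler_pdivrMr ?exprn_gt0// -[leLHS](sqr_sqrtr (ltW t0)) expr2.
  rewrite mulrAC ler_wpM2r ?sqrtr_ge0//.
  apply: (@le_trans _ _ (Num.sqrt (2 ^+ k * s))); first by rewrite ler_wsqrtr// ltW.
  rewrite sqrtrM ?exprn_ge0// mulrC ler_wpM2l ?sqrtr_ge0//.
  have -> : (2 ^+ k = (Num.sqrt 2 ^+ k) ^+ 2 :> R)%R by rewrite exprAC sqr_sqrtr.
  by rewrite sqrtr_sqr gtr0_norm ?exprn_gt0.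
- move=> k; rewrite /isqrt2 exprVn le_eqVlt; apply/orP; left; apply/eqP.
  have -> : (2 ^+ k = Num.sqrt 2 ^+ k * Num.sqrt 2 ^+ k :> R)%R.
    by rewrite -exprMn -expr2 sqr_sqrtr.
  by field; rewrite ?expf_neq0 ?gt_eqF.
Qed.

Lemma integral_sqrt_large (t : R) : (0 < t)%R ->
  \int[leb]_(s in `]t, +oo[) (Num.sqrt (t / s) / s)%:E <= (8 / (1 - isqrt2))%:E.
Proof.
move=> t0; have s2 : (0 < Num.sqrt 2 :> R)%R by rewrite sqrtr_gt0.
apply: (@integral_dyadic_itv _ _ (fun k => 8 / (2 ^+ k * t) * isqrt2 ^+ k)%R
  (fun k => 2 ^+ k * t)%R) => //.
- by move=> s /=; rewrite !in_itv/= !andbT => /(lt_trans t0).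
- by rewrite (ltW isqrt2_gt0).
- by rewrite isqrt2_lt1.
- move=> k; rewrite mulr_ge0 ?exprn_ge0 ?(ltW isqrt2_gt0)// divr_ge0 ?mulr_ge0 ?exprn_ge0//.
  exact: ltW.
- by move=> k; rewrite mulr_gt0 ?exprn_gt0.
- move=> s /=; rewrite in_itv/= andbT => ts; have s0 := lt_trans t0 ts.
  have [k [tk ks]] := dyadic_scale t0 (ltW s0).
  exists k; first exact: ltW.
  have e0 : (0 < 2 ^+ k * t / 4)%R by rewrite divr_gt0 ?mulr_gt0 ?exprn_gt0.
  have es : (2 ^+ k * t / 4 <= s)%R by lra.
  apply: (@le_trans _ _ (Num.sqrt (t / (2 ^+ k * t / 4)) / (2 ^+ k * t / 4))%R).
    rewrite ler_pM ?sqrtr_ge0 ?invr_ge0 ?(ltW s0)//.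
      by rewrite ler_wsqrtr// ler_wpM2l ?(ltW t0)// lef_pV2.
    by rewrite lef_pV2.
  have -> : (t / (2 ^+ k * t / 4) = (2 * isqrt2 ^+ k) ^+ 2)%R.
    rewrite exprMn exprAC sqr_isqrt2 exprVn; field.
    by rewrite expf_neq0//= gt_eqF.
  rewrite sqrtr_sqr ger0_norm ?mulr_ge0 ?exprn_ge0 ?(ltW isqrt2_gt0)//.
  rewrite le_eqVlt; apply/orP; left; apply/eqP; field.
  by rewrite expf_neq0//= gt_eqF.
- move=> k; rewrite le_eqVlt; apply/orP; left; apply/eqP; field.
  by rewrite expf_neq0//= gt_eqF.
Qed.

(** The exact value is 1/2; the crude dyadic bound is independent of [r], which is all that
    matters. *)
Lemma integral_inv_cube (r : R) : (0 < r)%R ->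
  \int[leb]_(s in `]r, +oo[) (r ^+ 2 / s ^+ 3)%:E <= (64 / (1 - 4^-1))%:E.
Proof.
move=> t0.
apply: (@integral_dyadic_itv _ _ (fun k => r ^+ 2 / (2 ^+ k * r / 4) ^+ 3)%R
  (fun k => 2 ^+ k * r)%R) => //.
- by move=> s /=; rewrite !in_itv/= !andbT => /(lt_trans t0).
- by lra.
- move=> k; rewrite divr_ge0 ?sqr_ge0// exprn_ge0// divr_ge0// mulr_ge0 ?exprn_ge0//.
  exact: ltW.
- by move=> k; rewrite mulr_gt0 ?exprn_gt0.
- move=> s /=; rewrite in_itv/= andbT => ts; have s0 := lt_trans t0 ts.
  have [k [tk ks]] := dyadic_scale t0 (ltW s0).
  exists k; first exact: ltW.
  have e0 : (0 < 2 ^+ k * r / 4)%R by rewrite divr_gt0 ?mulr_gt0 ?exprn_gt0.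
  have es : (2 ^+ k * r / 4 <= s)%R by lra.
  rewrite ler_wpM2l ?sqr_ge0// lef_pV2 ?posrE ?exprn_gt0//.
  by rewrite lerXn2r ?nnegrE ?(ltW e0) ?(ltW s0).
- move=> k; rewrite le_eqVlt; apply/orP; left; apply/eqP.
  have -> : (4^-1 ^+ k = (2 ^+ k) ^- 2 :> R)%R.
    by rewrite exprVn; congr (_^-1)%R; rewrite [RHS]exprAC; congr (_ ^+ k)%R; ring.
  have k0 : (2 ^+ k != 0 :> R)%R by rewrite expf_neq0.
  by field; rewrite k0 gt_eqF.
Qed.

End schur_weight.

Section square_kernel.
Context {R : realType} {n : nat}.
Local Notation mu := (@lebesgue_rV R n).
Local Notation leb := (@lebesgue_measure R).
Implicit Types (x y z : 'rV[R]_n) (s t : R).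
Local Notation W := (@vmass R n).

(** What remains of [psi] after this point; one constant serves both size and smoothness. *)
Record square_kernel (p : R -> 'rV[R]_n -> R) (A : R) : Prop := SquareKernel {
  kernel_measurable : measurable_fun [set: R * 'rV[R]_n] (fun q => p q.1 q.2) ;
  kernel_ge0 : 0 <= A ;
  kernel_size : forall t x, 0 < t -> `|p t x| <= A * wker t x ;
  kernel_lip : forall t x y, 0 < t ->
    `|p t x - p t y| <= A * (enorm (x - y) / t) * (wker t x + wker t y) ;
  kernel_mean : forall t x, 0 < t -> \int[mu]_y p t (x - y) = 0 }.

Variables (p : R -> 'rV[R]_n -> R) (A : R).
Hypothesis pA : square_kernel p A.
Let mp := kernel_measurable pA.
Let A0 := kernel_ge0 pA.

Lemma measurable_kernel_sub t x : measurable_fun [set: 'rV[R]_n] (fun y => p t (x - y)).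
Proof.
apply: (measurableT_comp mp (g := fun y => (t, x - y))).
apply: measurable_fun_pair => //.
apply: (measurableT_comp measurable_subrV (g := fun y => (x, y))).
by apply: measurable_fun_pair.
Qed.

(** With a = |x - y| / t: if a <= 1 the Lipschitz bound applies and a <= sqrt(a), otherwise sqrt(a)
    > 1 and the size bound suffices. The full power of a could not be integrated against [wker]. *)
Lemma kernel_sqrt t x y : 0 < t ->
  `|p t x - p t y| <= A * Num.sqrt (enorm (x - y) / t) * (wker t x + wker t y).
Proof.
move=> t0; have w0 : 0 <= wker t x + wker t y by rewrite addr_ge0 ?wker_ge0.
set a := enorm (x - y) / t; have a0 : 0 <= a by rewrite divr_ge0 ?enorm_ge0// ltW.
have [a1|a1] := leP a 1.
  apply: le_trans (kernel_lip pA x y t0) _; rewrite -/a ler_wpM2r// ler_wpM2l//.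
  rewrite -[leLHS](sqr_sqrtr a0) expr2 ler_piMr ?sqrtr_ge0//.
  by rewrite -(@ler_sqr R) ?nnegrE ?sqrtr_ge0// sqr_sqrtr// expr1n.
apply: le_trans (ler_normB _ _) _.
apply: (@le_trans _ _ (A * 1 * (wker t x + wker t y))).
  by rewrite mulr1 mulrDr lerD// kernel_size.
rewrite ler_wpM2r// ler_wpM2l//.
by rewrite -(@ler_sqr R) ?nnegrE ?sqrtr_ge0// sqr_sqrtr// expr1n ltW.
Qed.

Lemma integral_kernel_le t x : 0 < t ->
  (\int[mu]_y `|p t (x - y)|%:E <= (A * W)%:E)%E.
Proof.
move=> t0; apply: (integral_le_mul _ _ _ _ _ (integral_vker_le x t0)) => //.
- exact: measurable_vker_sub.
- by move=> y _; exact: vker_ge0.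
- move=> y _; apply: le_trans (kernel_size pA _ t0) _.
  by rewrite ler_wpM2l// wker_le_vker.
Qed.

Lemma measurable_subr_kernel t z : measurable_fun [set: 'rV[R]_n] (fun x => p t (x - z)).
Proof.
apply: (measurableT_comp mp (g := fun x => (t, x - z))).
apply: measurable_fun_pair => //.
apply: (measurableT_comp measurable_subrV (g := fun x => (x, z))).
by apply: measurable_fun_pair.
Qed.

Lemma integral_kernel_sub_le t z : 0 < t ->
  (\int[mu]_x `|p t (x - z)|%:E <= (A * W)%:E)%E.
Proof.
move=> t0; apply: (integral_le_mul _ _ _ _ _ (integral_vker_le z t0)) => //.
- exact: measurable_vker_sub.
- by move=> y _; exact: vker_ge0.
- move=> y _; apply: le_trans (kernel_size pA _ t0) _.
  by rewrite vkerB ler_wpM2l// wker_le_vker.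
Qed.

Lemma wker_le t x : 0 < t -> wker t x <= t ^- n.
Proof.
move=> t0; rewrite /wker ler_pdivrMr ?exprn_gt0 ?ltr_wpDr ?enorm_ge0//.
apply: (@le_trans _ _ (t ^- n * t ^+ n.+1)).
  by rewrite exprS mulrCA mulVf ?mulr1// expf_neq0// gt_eqF.
rewrite ler_wpM2l ?invr_ge0 ?exprn_ge0 ?(ltW t0)//.
by rewrite lerXn2r ?nnegrE ?addr_ge0 ?enorm_ge0 ?(ltW t0)// lerDl enorm_ge0.
Qed.

Lemma kernel_bounded t x : 0 < t -> `|p t x| <= A * t ^- n.
Proof.
move=> t0; apply: le_trans (kernel_size pA x t0) _.
by rewrite ler_wpM2l// wker_le.
Qed.

Lemma kernel_integrable t x : 0 < t ->
  mu.-integrable [set: 'rV[R]_n] (EFin \o (fun y => p t (x - y))).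
Proof.
move=> t0; apply: integrable_abs_lty; first exact: measurable_kernel_sub.
by apply: le_lt_trans (integral_kernel_le x t0) _; rewrite ltry.
Qed.

Definition kerK t x s y : R := \int[mu]_z (p t (x - z) * p s (y - z)).

Lemma measurable_kerK t x s : measurable_fun [set: 'rV[R]_n] (kerK t x s).
Proof.
apply: (@measurable_Rintegral_param _ _ _ _ _ mu (fun q : 'rV[R]_n * 'rV[R]_n =>
  p t (x - q.2) * p s (q.1 - q.2))).
apply: measurable_funM.
  apply: (measurableT_comp (f := fun z => p t (x - z))) => //.
  exact: measurable_kernel_sub.
apply: (measurableT_comp mp (g := fun q : 'rV[R]_n * 'rV[R]_n => (s, q.1 - q.2))).
by apply: measurable_fun_pair => //; exact: measurable_subrV.
Qed.

Lemma measurable_kernel_conv (h : 'rV[R]_n -> R) : measurable_fun [set: 'rV[R]_n] h ->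
  measurable_fun [set: R * 'rV[R]_n] (fun q => \int[mu]_y (p q.1 (q.2 - y) * h y)).
Proof.
move=> mh; apply: (@measurable_Rintegral_param _ _ _ _ _ mu
  (fun q : (R * 'rV[R]_n) * 'rV[R]_n => p q.1.1 (q.1.2 - q.2) * h q.2)).
apply: measurable_funM; last exact: (measurableT_comp mh).
apply: (measurableT_comp mp (g := fun q : (R * 'rV[R]_n) * 'rV[R]_n => (q.1.1, q.1.2 - q.2))).
apply: measurable_fun_pair; first exact: (measurableT_comp measurable_fst measurable_fst).
apply: (measurableT_comp measurable_subrV (g := fun q : (R * 'rV[R]_n) * 'rV[R]_n => (q.1.2, q.2))).
apply: measurable_fun_pair; last exact: measurable_snd.
exact: (measurableT_comp measurable_snd measurable_fst).
Qed.

Lemma kerKC t x s y : kerK t x s y = kerK s y t x.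
Proof. by apply: eq_Rintegral => z _; rewrite mulrC. Qed.

(* Subtract [p t (x - y) * \int p s (y - z) dz = 0]. *)
Lemma kerK_le t x s y : 0 < s -> 0 < t ->
  (`|kerK t x s y|%:E <= (A ^+ 2 * Num.sqrt (s / t))%:E *
    (\int[mu]_z (vker s (y - z) * vker t (x - z))%:E + (W * vker t (x - y))%:E))%E.
Proof.
move=> s0 t0.
have st0 : 0 <= A ^+ 2 * Num.sqrt (s / t) by rewrite mulr_ge0 ?sqr_ge0 ?sqrtr_ge0.
have mps := measurable_kernel_sub s y; have mpt := measurable_kernel_sub t x.
have i2 : mu.-integrable setT (EFin \o (fun z => p t (x - y) * p s (y - z))).
  by apply: integrable_scale => //; exact: kernel_integrable.
have i1 : mu.-integrable setT (EFin \o (fun z => p t (x - z) * p s (y - z))).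
  apply: integrable_abs_lty; first exact: measurable_funM.
  have B0 : 0 <= A * t ^- n by rewrite mulr_ge0// invr_ge0 exprn_ge0// ltW.
  apply: (integral_lty_mul _ B0 _ _ _ (integral_kernel_le y s0)) => //.
    exact: measurableT_comp.
  by move=> z _; rewrite normrM ler_wpM2r// kernel_bounded.
have -> : kerK t x s y = \int[mu]_z ((p t (x - z) - p t (x - y)) * p s (y - z)).
  transitivity (kerK t x s y - \int[mu]_z (p t (x - y) * p s (y - z))).
    by rewrite RintegralZl//; [rewrite (kernel_mean pA) // mulr0 subr0|exact: kernel_integrable].
  by rewrite -RintegralB//; apply: eq_Rintegral => z _; rewrite mulrBl.
have mvs := measurable_vker_sub s y; have mvt := measurable_vker_sub t x.
apply: le_trans (le_abs_Rintegral _ _ _) _ => //.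
  by apply: measurable_funM => //; exact: measurable_funB.
apply: (@le_trans _ _ (\int[mu]_z ((A ^+ 2 * Num.sqrt (s / t))%:E *
   ((vker s (y - z) * vker t (x - z))%:E + (vker s (y - z) * vker t (x - y))%:E)))%E).
  apply: le_integral_gen => z _.
    by rewrite -EFinD -EFinM lee_fin mulr_ge0// addr_ge0// mulr_ge0// vker_ge0.
  rewrite -EFinD -EFinM lee_fin normrM.
  apply: (@le_trans _ _ (A * Num.sqrt (enorm (y - z) / t) *
      (vker t (x - z) + vker t (x - y)) * (A * wker s (y - z)))).
    rewrite ler_pM ?kernel_size//.
    have -> : y - z = (x - z) - (x - y) by apply/rowP => i; rewrite !mxE; ring.
    apply: le_trans (kernel_sqrt _ _ t0) _.
    rewrite ler_wpM2l ?mulr_ge0 ?sqrtr_ge0// lerD// wker_le_vker//.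
  (* The first factor is the gain; the second one turns [wker s] into the still integrable
     [vker s]. *)
  have -> : Num.sqrt (enorm (y - z) / t) = Num.sqrt (s / t) * Num.sqrt (enorm (y - z) / s).
    rewrite -sqrtrM; last by rewrite divr_ge0// ltW.
    by congr Num.sqrt; field; rewrite !gt_eqF.
  rewrite (_ : _ * (A * wker s (y - z)) = A ^+ 2 * Num.sqrt (s / t) *
    (vker t (x - z) + vker t (x - y)) * (Num.sqrt (enorm (y - z) / s) * wker s (y - z))).
    rewrite [leRHS](_ : _ = A ^+ 2 * Num.sqrt (s / t) *
      (vker t (x - z) + vker t (x - y)) * vker s (y - z)); last by ring.
    by rewrite ler_wpM2l ?sqrt_wker_le_vker// mulr_ge0// addr_ge0// vker_ge0.
  by ring.
have m1 : measurable_fun setT (fun z => (vker s (y - z) * vker t (x - z))%:E).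
  by apply/measurable_EFinP/measurable_funM.
have m2 : measurable_fun setT (fun z => (vker s (y - z) * vker t (x - y))%:E).
  by apply/measurable_EFinP/measurable_funM.
rewrite ge0_integralZl//; last 2 first.
- exact: emeasurable_funD.
- by move=> z _; rewrite adde_ge0// lee_fin mulr_ge0// vker_ge0.
rewrite lee_wpmul2l// ge0_integralD//; last 2 first.
- by move=> z _; rewrite lee_fin mulr_ge0// vker_ge0.
- by move=> z _; rewrite lee_fin mulr_ge0// vker_ge0.
rewrite leeD2l// mulrC; apply: (integral_le_mul _ _ _ _ _ (integral_vker_le y s0)) => //.
- exact: vker_ge0.
- by move=> z _; exact: vker_ge0.
- by move=> z _; rewrite mulrC.
Qed.

Definition schur_ratio s t : R := if s <= t then Num.sqrt (s / t) else Num.sqrt (t / s).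

Let mv2 t : measurable_fun [set: 'rV[R]_n * 'rV[R]_n] (fun q => vker t (q.1 - q.2)).
Proof.
apply: (measurableT_comp measurable_vker (g := fun q : 'rV[R]_n * 'rV[R]_n => (t, q.1 - q.2))).
by apply: measurable_fun_pair => //; exact: measurable_subrV.
Qed.

(** [schur_ratio] is sqrt(min(s,t) / max(s,t)): the mean zero of the kernel of smaller scale is
    used, the symmetry [kerKC] exchanging the two roles. *)
Lemma integral_kerK_le t x s : 0 < s -> 0 < t ->
  (\int[mu]_y `|kerK t x s y|%:E <=
   (2 * A ^+ 2 * W ^+ 2 * schur_ratio s t)%:E)%E.
Proof.
move=> s0 t0; have V0 := @vmass_ge0 R n.
have dbl : (\int[mu]_y \int[mu]_z (vker s (y - z) * vker t (x - z))%:E <=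
    (W ^+ 2)%:E)%E.
  have m3 : measurable_fun setT (fun q : 'rV[R]_n * 'rV[R]_n =>
      (vker s (q.1 - q.2) * vker t (x - q.2))%:E).
    apply/measurable_EFinP/measurable_funM; first exact: mv2.
    exact: (measurableT_comp (measurable_vker_sub t x)).
  rewrite (fubini_tonelli _ m3)//; last by move=> q; rewrite lee_fin mulr_ge0// vker_ge0.
  apply: (@le_trans _ _ (\int[mu]_z (vker t (x - z) * W)%:E)%E).
    apply: le_integral_gen => z _; first by rewrite lee_fin mulr_ge0// vker_ge0.
    apply: (integral_le_mul _ _ _ _ _ (integral_vker_le z s0)) => //.
    - exact: vker_ge0.
    - exact: measurable_vker_sub.
    - by move=> y _; exact: vker_ge0.
    - by move=> y _; rewrite /= vkerB mulrC.
  rewrite expr2; apply: (integral_le_mul _ _ _ _ _ (integral_vker_le x t0)) => //.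
  - exact: measurable_vker_sub.
  - by move=> y _; exact: vker_ge0.
  - by move=> y _; rewrite mulrC.
(* Covers both orders of the scales: [I] is the double integral left after the subtraction, and [V]
   is [vker] at the larger scale. *)
have main (a : R) (I : 'rV[R]_n -> \bar R) (V : 'rV[R]_n -> R) : 0 <= a ->
    measurable_fun setT I -> (forall y, 0 <= I y)%E ->
    measurable_fun setT V -> (forall y, 0 <= V y) ->
    (\int[mu]_y I y <= (W ^+ 2)%:E)%E -> (\int[mu]_y (V y)%:E <= W%:E)%E ->
    (forall y, (`|kerK t x s y|%:E <= (A ^+ 2 * a)%:E * (I y + (W * V y)%:E))%E) ->
    (\int[mu]_y `|kerK t x s y|%:E <= (2 * A ^+ 2 * W ^+ 2 * a)%:E)%E.
  move=> a0 mI I0 mV Vge0 IV VV KI.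
  have mV' : measurable_fun setT (fun y => (W * V y)%:E).
    by apply/measurable_EFinP/measurable_funM.
  have V'0 y : (0 <= (W * V y)%:E)%E by rewrite lee_fin mulr_ge0.
  apply: (@le_trans _ _ (\int[mu]_y ((A ^+ 2 * a)%:E * (I y + (W * V y)%:E)))%E).
    apply: le_integral_gen => y _; last exact: KI.
    by rewrite mule_ge0 ?lee_fin ?mulr_ge0 ?sqr_ge0// adde_ge0.
  rewrite ge0_integralZl//; last 3 first.
  - exact: emeasurable_funD.
  - by move=> y _; rewrite adde_ge0.
  - by rewrite lee_fin mulr_ge0 ?sqr_ge0.
  have -> : 2 * A ^+ 2 * W ^+ 2 * a = (A ^+ 2 * a) * (W ^+ 2 + W ^+ 2).
    by ring.
  rewrite [leRHS]EFinM lee_wpmul2l ?lee_fin ?mulr_ge0 ?sqr_ge0//.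
  rewrite ge0_integralD// EFinD leeD//.
  by rewrite [X in (_ <= X%:E)%E]expr2; apply: (integral_le_mul _ _ _ _ _ VV).
have mI : measurable_fun setT (fun y => \int[mu]_z (vker s (y - z) * vker t (x - z))%:E)%E.
  apply: (measurable_integral_param mu (g := fun q : 'rV[R]_n * 'rV[R]_n =>
    (vker s (q.1 - q.2) * vker t (x - q.2))%:E)).
  apply/measurable_EFinP/measurable_funM; first exact: mv2.
  exact: (measurableT_comp (measurable_vker_sub t x)).
rewrite /schur_ratio; case: ifPn => st.
- apply: (main _ (fun y => \int[mu]_z (vker s (y - z) * vker t (x - z))%:E)%E
    (fun y => vker t (x - y))) => //.
  + by move=> y; apply: integral_ge0 => z _; rewrite lee_fin mulr_ge0// vker_ge0.
  + exact: measurable_vker_sub.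
  + by move=> y; exact: vker_ge0.
  + exact: integral_vker_le.
  + by move=> y; exact: kerK_le.
- apply: (main _ (fun y => \int[mu]_z (vker s (y - z) * vker t (x - z))%:E)%E
    (fun y => vker s (y - x))) => //.
  + by move=> y; apply: integral_ge0 => z _; rewrite lee_fin mulr_ge0// vker_ge0.
  + under eq_fun do rewrite vkerB; exact: measurable_vker_sub.
  + by move=> y; exact: vker_ge0.
  + under eq_integral do rewrite vkerB; exact: integral_vker_le.
  + move=> y; rewrite kerKC; apply: le_trans (kerK_le _ _ t0 s0) _.
    by under eq_integral do rewrite mulrC.
Qed.

End square_kernel.

Section sigma_finite_product.
Local Open Scope ereal_scope.
Context d1 d2 (X : measurableType d1) (Y : measurableType d2) (R : realType).
Context (m1 : {sigma_finite_measure set X -> \bar R}).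
Context (m2 : {sigma_finite_measure set Y -> \bar R}).

Let sigma_finite_prod : sigma_finite [set: X * Y] (m1 \x m2).
Proof.
have /sigma_finiteP[F [FT Fmono Ffin]] := sigma_finiteT m1.
have /sigma_finiteP[G [GT Gmono Gfin]] := sigma_finiteT m2.
exists (fun k => F k `*` G k) => [|k].
  apply/seteqP; split=> // -[x y] _.
  have [i _ Fx] : (\bigcup_i F i) x by rewrite -FT.
  have [j _ Gy] : (\bigcup_j G j) y by rewrite -GT.
  exists (maxn i j) => //; split.
    by move/subsetPset : (Fmono _ _ (leq_maxl i j)); exact.
  by move/subsetPset : (Gmono _ _ (leq_maxr i j)); exact.
have [mFk Fk] := Ffin k; have [mGk Gk] := Gfin k.
split; first exact: measurableX.
by rewrite product_measure1E// lte_mul_pinfty// ge0_fin_numE.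
Qed.

(* Canonical inference of this structure fails on [m1 \x m2]: the library also
   declares the finite measure structure there, for finite [m1] and [m2]. *)
Definition sigma_finite_prod_measure : {sigma_finite_measure set (X * Y)%type -> \bar R} :=
  HB.pack (m1 \x m2)
    (@Measure_isSigmaFinite.Build _ (X * Y)%type R (m1 \x m2) sigma_finite_prod).

Lemma integral_sigma_finite_prod (f : X * Y -> \bar R) :
  measurable_fun [set: X * Y] f -> (forall q, 0 <= f q) ->
  \int[sigma_finite_prod_measure]_q f q = \int[m1]_x \int[m2]_y f (x, y).
Proof.
by move=> mf f0; rewrite -[RHS]/(\int[m1]_x fubini_F m2 f x) -fubini_tonelli1//.
Qed.

End sigma_finite_product.

Section square_function_L2.
Context {R : realType} {n : nat}.
Local Notation mu := (@lebesgue_rV R n).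
Local Notation leb := (@lebesgue_measure R).
Implicit Types (x y z : 'rV[R]_n) (s t : R).
Local Notation W := (@vmass R n).
Local Notation X := (measurableTypeR R * 'rV[R]_n)%type.
Local Notation m1 := (leb \x mu)%E.

Variables (p : R -> 'rV[R]_n -> R) (A : R).
Hypothesis pA : square_kernel p A.
Let mp := kernel_measurable pA.
Let A0 := kernel_ge0 pA.

(** The factor 12 = 4 + 8 adds the small and large scales; the final 1 keeps the constant positive
    when [A] is 0, as the Schur test demands. *)
Definition square_cst : R := 2 * A ^+ 2 * W ^+ 2 * (12 / (1 - isqrt2)) + 1.

Lemma square_cst_gt0 : 0 < square_cst.
Proof.
rewrite ltr_wpDl// mulr_ge0 ?divr_ge0 ?subr_ge0 ?(ltW isqrt2_lt1)//.
by rewrite mulr_ge0 ?sqr_ge0// mulr_ge0 ?sqr_ge0.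
Qed.

Lemma schur_ratio_ge0 s t : 0 <= schur_ratio s t.
Proof. by rewrite /schur_ratio; case: ifP => _; exact: sqrtr_ge0. Qed.

Lemma measurable_schur_ratio t :
  measurable_fun [set: R] (fun s => schur_ratio s t / s).
Proof.
have ms : measurable_fun [set: R] (@Num.sqrt R).
  by apply: continuous_measurable_fun; exact: sqrt_continuous.
apply: measurable_funM => //; last exact: measurable_inv.
apply: measurable_fun_ifT.
- exact: measurable_fun_ler.
- by apply: (measurableT_comp ms); exact: measurable_funM.
- apply: (measurableT_comp ms); apply: measurable_funM => //.
  exact: measurable_inv.
Qed.

Lemma integral_schur_ratio t : 0 < t ->
  (\int[leb]_(s in `]0%R, +oo[) (schur_ratio s t / s)%:E <= (12 / (1 - isqrt2))%:E)%E.
Proof.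
move=> t0.
have -> : `]0%R, +oo[%classic = `]0%R, t]%classic `|` `]t, +oo[%classic.
  by rewrite -itv_bndbnd_setU// bnd_simp// ltW.
have mr : measurable_fun [set: R] (fun s => (schur_ratio s t / s)%:E).
  by apply/measurable_EFinP; exact: measurable_schur_ratio.
rewrite ge0_integral_setU//.
- rewrite (_ : (12 / _)%:E = (4 / (1 - isqrt2))%:E + (8 / (1 - isqrt2))%:E)%E; last first.
    by rewrite -EFinD -mulrDl -natrD.
  apply: leeD.
    apply: le_trans (integral_sqrt_small t0); rewrite le_eqVlt; apply/orP; left.
    apply/eqP/eq_integral => s; rewrite inE/= in_itv/= => /andP[_ st].
    by rewrite /schur_ratio st.
  apply: le_trans (integral_sqrt_large t0); rewrite le_eqVlt; apply/orP; left.
  apply/eqP/eq_integral => s; rewrite inE/= in_itv/= andbT => st.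
  by rewrite /schur_ratio leNgt st.
- exact: measurable_funTS.
- move=> s [|] /=; rewrite in_itv/= ?andbT; [move=> /andP[s0 _]|move=> ts].
    by rewrite lee_fin divr_ge0 ?schur_ratio_ge0// ltW.
  by rewrite lee_fin divr_ge0 ?schur_ratio_ge0// ltW// (lt_trans t0).
- apply/disj_setPS => s [] /=; rewrite !in_itv/= andbT => /andP[_ st] ts.
  by move: st; rewrite leNgt ts.
Qed.

Variables (e M : R).
Hypothesis e0 : 0 < e.
Hypothesis eM : e < M.
Let I : set R := `]e, M[%classic.
(** Cutting the scales off to [I] makes the kernel bounded and the measure dt/t, which is the weight
    [w], finite. The resulting bounds depend on [e] and [M] but only ensure integrability in the
    Schur test. *)
Let k (q : X * 'rV[R]_n) : R := \1_I q.1.1 * p q.1.1 (q.1.2 - q.2).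
Let w (q : X) : R := \1_I q.1 / q.1.

Let I0 t : I t -> 0 < t.
Proof. by rewrite /I/= in_itv/= => /andP[/(lt_trans e0)]. Qed.

Let mI : measurable_fun [set: R] (\1_I : R -> R).
Proof. by apply: measurable_indic; exact: measurable_itv. Qed.

Let indI t : (\1_I t : R) = 1 /\ I t \/ (\1_I t : R) = 0.
Proof.
rewrite indicE; have [/set_mem It|_] := boolP (t \in I); [left|right] => //.
Qed.

Let mp3 : measurable_fun [set: X * 'rV[R]_n] (fun q => p q.1.1 (q.1.2 - q.2)).
Proof.
apply: (measurableT_comp mp (g := fun q : X * 'rV[R]_n => (q.1.1, q.1.2 - q.2))).
apply: measurable_fun_pair; first exact: (measurableT_comp measurable_fst measurable_fst).
apply: (measurableT_comp measurable_subrV (g := fun q : X * 'rV[R]_n => (q.1.2, q.2))).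
apply: measurable_fun_pair; last exact: measurable_snd.
exact: (measurableT_comp measurable_snd measurable_fst).
Qed.

Let mk : measurable_fun [set: X * 'rV[R]_n] k.
Proof.
apply: measurable_funM => //.
apply: (measurableT_comp mI); exact: (measurableT_comp measurable_fst measurable_fst).
Qed.

Let mw : measurable_fun [set: X] w.
Proof.
apply: measurable_funM; first exact: (measurableT_comp mI measurable_fst).
exact: (measurableT_comp (@measurable_inv R) measurable_fst).
Qed.

Let w0 q : 0 <= w q.
Proof.
rewrite /w; have [[-> /I0 q0]|->] := indI q.1; last by rewrite mul0r.
by rewrite divr_ge0// ltW.
Qed.

Lemma kernel_square_le (h : 'rV[R]_n -> R) (H : R) :
  measurable_fun [set: 'rV[R]_n] h -> (forall z, `|h z| <= H) ->
  (\int[mu]_z `|h z|%:E < +oo)%E ->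
  (\int[leb]_(t in I) \int[mu]_x ((\int[mu]_z (p t (x - z) * h z))%R ^+ 2 / t)%:E <=
  square_cst%:E * \int[mu]_z (h z ^+ 2)%:E)%E.
Proof.
move=> mh hH h1.
have L := @schur_TTstar _ _ _ _ R (sigma_finite_prod_measure leb mu) mu k w h H (A * W)
  (e^-1 * (M - e) * (A * W)) square_cst (A * e ^- n) mk mw mh w0 hH.
have L' : (\int[m1]_q ((\int[mu]_z (k (q, z) * h z)) ^+ 2 * w q)%R%:E <=
    square_cst%:E * \int[mu]_z (h z ^+ 2)%:E)%E.
  apply: L => //.
  - move=> [[t x] z]; rewrite /k/= normrM.
    have [[-> It]|->] := indI t; last by rewrite normr0 mul0r mulr_ge0// invr_ge0 exprn_ge0// ltW.
    rewrite normr1 mul1r; have t0 := I0 It.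
    apply: le_trans (kernel_bounded pA _ t0) _; rewrite ler_wpM2l//.
    rewrite lef_pV2 ?posrE ?exprn_gt0// lerXn2r ?nnegrE ?(ltW e0) ?(ltW t0)//.
    by move: It; rewrite /I/= in_itv/= => /andP[/ltW].
  - move=> [t x]; rewrite /k/=.
    have [[-> It]|->] := indI t.
      under eq_integral do rewrite mul1r.
      exact: (integral_kernel_le pA x (I0 It)).
    under eq_integral do rewrite mul0r normr0.
    by rewrite integral0 lee_fin mulr_ge0// vmass_ge0.
  - move=> z; rewrite integral_sigma_finite_prod; last 2 first.
    + apply/measurable_EFinP/measurable_funM => //.
      by apply: measurableT_comp => //; apply: (measurableT_comp mk).
    + by move=> q; rewrite lee_fin mulr_ge0.
    apply: (@le_trans _ _ (\int[leb]_t (e^-1 * (A * W) * \1_I t)%:E)%E).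
      apply: le_integral_gen => t _.
        by rewrite lee_fin mulr_ge0// mulr_ge0 ?invr_ge0 ?(ltW e0)// mulr_ge0// vmass_ge0.
      rewrite /k /w /=; have [[-> It]|->] := indI t; last first.
        under eq_integral do rewrite !mul0r mulr0.
        by rewrite integral0 mulr0.
      have t0 := I0 It; rewrite mulr1.
      apply: (@le_trans _ _ (t^-1 * (A * W))%:E).
        apply: (integral_le_mul _ _ _ _ _ (integral_kernel_sub_le pA z t0)) => //.
        * by rewrite invr_ge0 ltW.
        * by apply: measurableT_comp => //; exact: (measurable_subr_kernel pA).
        * by move=> y _; rewrite !mul1r mulrC.
      have et : e <= t by move: It; rewrite /I/= in_itv/= => /andP[/ltW].
      rewrite lee_fin; apply: ler_wpM2r; first by rewrite mulr_ge0// vmass_ge0.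
      by rewrite lef_pV2.
    have eAW : 0 <= e^-1 * (A * W).
      by rewrite mulr_ge0 ?invr_ge0 ?(ltW e0)// mulr_ge0// vmass_ge0.
    rewrite [leRHS](_ : _ = (e^-1 * (A * W) * (M - e))%:E); last by congr (_%:E); ring.
    apply: (@integral_le_mul _ _ _ leb setT _ _ _ (\1_I : R -> R)) => //.
    rewrite integral_indic//; last exact: measurable_itv.
    by rewrite setIT [X in (X <= _)%E]lebesgue_measure_itv/= lte_fin eM EFinD.
  - move=> [t x]; have [[tI It]|tI] := indI t; last first.
      rewrite integral0_eq; first by rewrite lee_fin (ltW square_cst_gt0).
      move=> q _; rewrite /k/= tI; under eq_Rintegral do rewrite !mul0r.
      by rewrite Rintegral_cst ?mul0r ?normr0 ?mul0r.
    have t0 := I0 It.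
    have C2 : 0 <= 2 * A ^+ 2 * W ^+ 2 by rewrite mulr_ge0 ?sqr_ge0// mulr_ge0 ?sqr_ge0.
    have mKw : measurable_fun [set: X] (fun q =>
        (`|\int[mu]_z (k ((t, x), z) * k (q, z))| * w q)%:E).
      apply/measurable_EFinP/measurable_funM => //; apply: measurableT_comp => //.
      apply: (@measurable_Rintegral_param _ _ _ _ _ mu (fun q : X * 'rV[R]_n =>
        k ((t, x), q.2) * k q)).
      apply: measurable_funM => //.
      apply: (measurableT_comp (f := fun z => k ((t, x), z))).
        exact: (measurableT_comp mk).
      exact: measurable_snd.
    rewrite integral_sigma_finite_prod//; last by move=> q; rewrite lee_fin mulr_ge0.
    (* Extending the integral to all s > 0 makes the Schur constant independent of [e] and [M]. *)
    apply: (@le_trans _ _ (\int[leb]_(s in `]0%R, +oo[)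
       (2 * A ^+ 2 * W ^+ 2 * (schur_ratio s t / s))%:E)%E).
      rewrite [leRHS]integral_mkcond; apply: le_integral_gen => s _.
        rewrite /patch; case: ifPn => // /set_mem/=; rewrite in_itv/= andbT => s0.
        by rewrite lee_fin mulr_ge0// divr_ge0 ?schur_ratio_ge0// ltW.
      rewrite /k /w /patch /= tI; have [[-> Is]|->] := indI s; last first.
        under eq_integral do rewrite !mul0r mulr0.
        rewrite integral0; case: ifPn => // /set_mem/=; rewrite in_itv/= andbT => s0.
        by rewrite lee_fin mulr_ge0// divr_ge0 ?schur_ratio_ge0// ltW.
      have s0 := I0 Is; rewrite mem_set; last by rewrite /= in_itv/= andbT.
      rewrite [leRHS](_ : _ = (s^-1 * (2 * A ^+ 2 * W ^+ 2 * schur_ratio s t))%:E); last first.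
        by congr (_%:E); ring.
      apply: (integral_le_mul _ _ _ _ _ (integral_kerK_le pA x s0 t0)) => //.
      + by rewrite invr_ge0 ltW.
      + apply: measurableT_comp => //; exact: (measurable_kerK pA).
      + move=> y _; rewrite mul1r mulrC /kerK le_eqVlt; apply/orP; left; apply/eqP.
        by congr (_ * `|_|); apply: eq_Rintegral => z _; rewrite !mul1r.
    apply: (@le_trans _ _ (2 * A ^+ 2 * W ^+ 2 * (12 / (1 - isqrt2)))%:E); last first.
      by rewrite lee_fin /square_cst lerDl.
    apply: (integral_le_mul _ C2 _ _ _ (integral_schur_ratio t0)) => //.
    + by apply: measurable_funTS; exact: measurable_schur_ratio.
    + move=> s; rewrite /= in_itv/= andbT => s0.
      by rewrite divr_ge0 ?schur_ratio_ge0// ltW.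
  - exact: square_cst_gt0.
apply: le_trans L'; rewrite integral_sigma_finite_prod.
- rewrite integral_mkcond; apply: le_integral_gen => t _.
    by apply: integral_ge0 => x _; rewrite lee_fin mulr_ge0// sqr_ge0.
  rewrite /patch; case: ifPn => [/set_mem It|_]; last first.
    by apply: integral_ge0 => x _; rewrite lee_fin mulr_ge0// sqr_ge0.
  rewrite le_eqVlt; apply/orP; left; apply/eqP/eq_integral => x _.
  rewrite /k /w /= indicE mem_set// div1r; congr ((_ ^+ 2 * _)%:E).
  by apply: eq_Rintegral => z _; rewrite mul1r.
- apply/measurable_EFinP/measurable_funM => //; apply: measurable_funX.
  apply: (@measurable_Rintegral_param _ _ _ _ _ mu (fun q : X * 'rV[R]_n => k q * h q.2)).
  by apply: measurable_funM => //; exact: (measurableT_comp mh).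
- by move=> q; rewrite lee_fin mulr_ge0// sqr_ge0.
Qed.

End square_function_L2.

(** * Convolution with functions of bounded mean oscillation *)

Section bmo_convolution.
Context {R : realType} {n : nat}.
Hypothesis n_gt0 : (0 < n)%N.
Local Notation mu := (@lebesgue_rV R n).
Local Notation leb := (@lebesgue_measure R).
Local Notation cubeT := ('rV[R]_n * {posnum R})%type.
Implicit Types (x y z c : 'rV[R]_n) (s t r m : R).
Local Notation tcst := (@tail_cst R n).

Variables (p : R -> 'rV[R]_n -> R) (A : R).
Hypothesis pA : square_kernel p A.
Variables (f : 'rV[R]_n -> R) (N : R).
Hypothesis fN : bmo_le f N.

Let A0 := kernel_ge0 pA.
Let mf := bmo_measurable fN.

Definition kconv t x : R := \int[mu]_y (p t (x - y) * f y).

Let mpf t x m : measurable_fun [set: 'rV[R]_n] (fun y => p t (x - y) * (f y - m)).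
Proof.
apply: measurable_funM; first exact: (measurable_kernel_sub pA).
exact: measurable_funB.
Qed.

Lemma tail_cst_ge0 (K : R) : 0 <= K -> 0 <= tcst K.
Proof.
move=> K0; rewrite /tail_cst mulr_ge0 ?invr_ge0 ?subr_ge0 ?(ltW isqrt2_lt1)//.
by rewrite mulr_ge0 ?mulr_ge0 ?exprn_ge0// !addr_ge0// mulr_ge0// exprn_ge0// mulr_ge0.
Qed.

Let wtail t x : 0 < t ->
  (\int[mu]_y (wker t (x - y) * `|f y - ball_avg f x t|)%:E <= (tcst 0 * N)%:E)%E.
Proof.
by move=> t0; apply: (integral_bmo_tail n_gt0 fN) => //; rewrite subrr normr0 mul0r.
Qed.

(** Around the average over the ball of radius t about x, the tail estimate applies; the remaining
    constant multiplies an integrable kernel. *)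
Lemma kconv_integrable t x m : 0 < t ->
  mu.-integrable [set: 'rV[R]_n] (EFin \o (fun y => p t (x - y) * (f y - m))).
Proof.
move=> t0; pose a := ball_avg f x t.
have -> : (fun y => p t (x - y) * (f y - m)) =
    (fun y => p t (x - y) * (f y - a) + (a - m) * p t (x - y)).
  by apply/funext => y; ring.
apply: integrable_addr => //; last first.
  by apply: integrable_scale => //; exact: (kernel_integrable pA).
apply: integrable_abs_lty; first exact: mpf.
apply: (integral_lty_mul _ A0 _ _ _ (wtail x t0)) => //.
- apply: measurable_funM; first exact: measurable_wker_sub.
  by apply: measurableT_comp => //; exact: measurable_funB.
- by move=> y _; rewrite mulr_ge0// wker_ge0.
- by move=> y _; rewrite normrM mulrA ler_wpM2r// (kernel_size pA).
Qed.

Lemma kconvE t x m : 0 < t -> kconv t x = \int[mu]_y (p t (x - y) * (f y - m)).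
Proof.
move=> t0; have i0 := kconv_integrable x 0 t0.
have ip := kernel_integrable pA x t0.
transitivity (\int[mu]_y (p t (x - y) * (f y - 0) - m * p t (x - y))).
  rewrite RintegralB//; last exact: integrable_scale.
  rewrite RintegralZl// (kernel_mean pA)// mulr0 subr0.
  by apply: eq_Rintegral => y _; rewrite subr0.
by apply: eq_Rintegral => y _; ring.
Qed.

Lemma EFin_kconv t x : 0 < t -> (\int[mu]_y (p t (x - y) * f y)%:E = (kconv t x)%:E)%E.
Proof.
move=> t0; rewrite fineK//; apply: integrable_fin_num => //.
have := kconv_integrable x 0 t0.
by rewrite (_ : (fun y => _) = fun y => p t (x - y) * f y)//; apply/funext => y; rewrite subr0.
Qed.

(** t + |x| <= 3 (t + |x'|). The hypothesis suits two points of a ball of radius at most t. *)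
Lemma wker_shift t x x' : 0 < t -> enorm (x - x') <= 2 * t ->
  wker t x' <= 3 ^+ n.+1 * wker t x.
Proof.
move=> t0 xx'; rewrite /wker mulrCA ler_wpM2l ?(ltW t0)//.
have e0 y : 0 < t + enorm y by rewrite ltr_wpDr ?enorm_ge0.
rewrite -[leRHS]invrK lef_pV2 ?posrE ?invr_gt0 ?exprn_gt0//; last first.
  by rewrite mulr_gt0// ?invr_gt0 exprn_gt0.
rewrite invfM invrK mulrC ler_pdivrMr ?exprn_gt0// -exprMn.
rewrite lerXn2r ?nnegrE ?mulr_ge0 ?(ltW (e0 _))//.
have := ler_enormD (x - x') x'; rewrite subrK; have := enorm_ge0 x'; lra.
Qed.

Definition smooth_cst : R := A * (1 + 3 ^+ n.+1) * tcst 0.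

Lemma smooth_cst_ge0 : 0 <= smooth_cst.
Proof. by rewrite mulr_ge0 ?tail_cst_ge0// mulr_ge0// addr_ge0// exprn_ge0. Qed.

(** Mean zero allows the same constant [m] to be subtracted at both points. The Lipschitz bound for
    the kernel and [wker_shift] leave the tail integral centred at [x]. *)
Lemma kconv_smooth t x x' : 0 < t -> enorm (x - x') <= 2 * t ->
  `|kconv t x - kconv t x'| <= smooth_cst * N * (enorm (x - x') / t).
Proof.
move=> t0 xx'; pose m := ball_avg f x t.
have e0 : 0 <= enorm (x - x') / t by rewrite divr_ge0 ?enorm_ge0// ltW.
rewrite (kconvE x m t0) (kconvE x' m t0).
rewrite -RintegralB//; [|exact: kconv_integrable|exact: kconv_integrable].
rewrite -lee_fin; apply: le_trans (le_abs_Rintegral _ _ _) _ => //.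
  by apply: measurable_funB.
rewrite [leRHS](_ : _ = (A * (1 + 3 ^+ n.+1) * (enorm (x - x') / t) *
  (tcst 0 * N))%:E); last by rewrite /smooth_cst; congr (_%:E); ring.
have c0 : 0 <= A * (1 + 3 ^+ n.+1) * (enorm (x - x') / t).
  by rewrite mulr_ge0// mulr_ge0// addr_ge0// exprn_ge0.
apply: (integral_le_mul _ c0 _ _ _ (wtail x t0)) => //.
- apply: measurable_funM; first exact: measurable_wker_sub.
  by apply: measurableT_comp => //; exact: measurable_funB.
- by move=> y _; rewrite mulr_ge0// wker_ge0.
- move=> y _; rewrite -mulrBl normrM mulrA ler_wpM2r//.
  apply: le_trans (kernel_lip pA _ _ t0) _.
  have -> : x - y - (x' - y) = x - x' by apply/rowP => i; rewrite !mxE; ring.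
  rewrite [leRHS](_ : _ = A * (enorm (x - x') / t) *
    (wker t (x - y) + 3 ^+ n.+1 * wker t (x - y))); last by ring.
  apply: ler_wpM2l; first by rewrite mulr_ge0.
  apply: lerD => //; apply: wker_shift => //.
  by have -> : x - y - (x' - y) = x - x' by apply/rowP => i; rewrite !mxE; ring.
Qed.

Lemma measurable_kconv :
  measurable_fun [set: R * 'rV[R]_n] (fun q => kconv q.1 q.2).
Proof.
exact: (measurable_kernel_conv pA).
Qed.

End bmo_convolution.

(** * Fatou's lemma for iterated integrals, Tonelli on rectangles *)

Section fatou_bounds.
Local Open Scope ereal_scope.

Lemma fatou_le d (T : measurableType d) (R : realType) (mu : {measure set T -> \bar R})
  (f_ : nat -> T -> \bar R) (f : T -> \bar R) (C : \bar R) :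
  (forall k, measurable_fun [set: T] (f_ k)) -> (forall k x, 0 <= f_ k x) ->
  (forall x, f_ ^~ x @ \oo --> f x) -> (forall k, \int[mu]_x f_ k x <= C) ->
  \int[mu]_x f x <= C.
Proof.
move=> mf f0 ff fC.
under eq_integral do rewrite -(cvg_limn_einf_sup (ff _)).1.
apply: le_trans (fatou mu measurableT mf _) _; first by move=> k x _; exact: f0.
rewrite limn_einf_lim; apply: lime_le; first exact: is_cvg_einfs.
apply: nearW => k; apply: le_trans (fC k); apply: ereal_inf_lbound.
by exists k => //=.
Qed.

Lemma fatou_le_iterated d1 d2 (X : measurableType d1) (Y : measurableType d2)
  (R : realType) (m1 : {sigma_finite_measure set X -> \bar R})
  (m2 : {sigma_finite_measure set Y -> \bar R})
  (F_ : nat -> X * Y -> \bar R) (F : X * Y -> \bar R) (C : \bar R) :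
  (forall k, measurable_fun [set: X * Y] (F_ k)) -> (forall k q, 0 <= F_ k q) ->
  (forall q, F_ ^~ q @ \oo --> F q) ->
  (forall k, \int[m1]_x \int[m2]_y F_ k (x, y) <= C) ->
  \int[m1]_x \int[m2]_y F (x, y) <= C.
Proof.
move=> mF F0 FF FC.
have F0' q : 0 <= F q.
  rewrite -(cvg_lim _ (FF q))//; apply: lime_ge; first by apply/cvg_ex; exists (F q).
  exact: nearW.
have mF' : measurable_fun [set: X * Y] F.
  by apply: (emeasurable_fun_cvg _ _ mF) => q _; exact: FF.
rewrite -[X in X <= _]/(\int[m1]_x fubini_F m2 F x) -fubini_tonelli1//.
apply: (fatou_le mF F0 FF) => k.
by rewrite fubini_tonelli1//; exact: FC.
Qed.

Lemma fubini_tonelli_in d1 d2 (X : measurableType d1) (Y : measurableType d2)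
  (R : realType) (m1 : {sigma_finite_measure set X -> \bar R})
  (m2 : {sigma_finite_measure set Y -> \bar R})
  (A : set X) (B : set Y) (f : X -> Y -> \bar R) :
  measurable A -> measurable B ->
  measurable_fun [set: X * Y] (fun q => f q.1 q.2) ->
  (forall x y, A x -> B y -> 0 <= f x y) ->
  \int[m1]_(x in A) \int[m2]_(y in B) f x y = \int[m2]_(y in B) \int[m1]_(x in A) f x y.
Proof.
move=> mA mB mf f0; pose g := (fun q => f q.1 q.2) \_ (A `*` B).
have mg : measurable_fun [set: X * Y] g.
  apply/(measurable_restrictT _ (measurableX mA mB)).
  exact: measurable_funTS.
have g0 q : 0 <= g q.
  by rewrite /g /patch; case: ifP => // /set_mem[]; exact: f0.
have gE x y : g (x, y) = if (x \in A) && (y \in B) then f x y else 0.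
  by rewrite /g /patch in_setX.
transitivity (\int[m1]_x \int[m2]_y g (x, y)).
  rewrite integral_mkcond; apply: eq_integral => x _; rewrite /patch.
  case: ifPn => xA.
    by rewrite integral_mkcond; apply: eq_integral => y _; rewrite gE xA.
  by rewrite integral0_eq// => y _; rewrite gE (negbTE xA).
rewrite fubini_tonelli//.
rewrite [RHS]integral_mkcond; apply: eq_integral => y _; rewrite [RHS]/patch.
case: ifPn => yB.
  by rewrite [RHS]integral_mkcond; apply: eq_integral => x _; rewrite gE yB andbT.
by rewrite integral0_eq// => x _; rewrite gE (negbTE yB) andbF.
Qed.

Lemma measurable_integral_param_in d1 d2 (X : measurableType d1) (Y : measurableType d2)
  (R : realType) (m2 : {sigma_finite_measure set Y -> \bar R}) (B : set Y)
  (f : X * Y -> \bar R) :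
  measurable B -> measurable_fun [set: X * Y] f ->
  measurable_fun [set: X] (fun x => \int[m2]_(y in B) f (x, y)).
Proof.
move=> mB mf; pose g := f \_ ([set: X] `*` B).
have mg : measurable_fun [set: X * Y] g.
  apply/(measurable_restrictT _ (measurableX measurableT mB)).
  exact: measurable_funTS.
rewrite (_ : (fun x => _) = fun x => \int[m2]_y g (x, y)).
  exact: (measurable_integral_param m2 mg).
apply/funext => x; rewrite integral_mkcond; apply: eq_integral => y _.
by rewrite /g /patch in_setX in_setT.
Qed.

End fatou_bounds.

(** * Carleson measure estimate on a ball *)

Section carleson.
Context {R : realType} {n : nat}.
Hypothesis n_gt0 : (0 < n)%N.
Local Notation mu := (@lebesgue_rV R n).
Local Notation leb := (@lebesgue_measure R).
Local Notation cubeT := ('rV[R]_n * {posnum R})%type.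
Implicit Types (x y z c : 'rV[R]_n) (s t m : R).
Local Notation tcst := (@tail_cst R n).

Variables (p : R -> 'rV[R]_n -> R) (A : R).
Hypothesis pA : square_kernel p A.
Variables (f : 'rV[R]_n -> R) (N : R).
Hypothesis fN : bmo_le f N.
Hypothesis N_gt0 : 0 < N.

Let A0 := kernel_ge0 pA.
Let mf := bmo_measurable fN.
Let n0 : 0 < n%:R :> R. Proof. by rewrite ltr0n. Qed.

Variables (c : 'rV[R]_n) (r : R).
Hypothesis r0 : 0 < r.

Let r40 : 0 < 4 * r. Proof. by rewrite mulr_gt0. Qed.

(** Centre [c] and side 4 r: points outside are at distance at least 2 r from [c], hence at least r
    from every point of the ball. *)
Let Q : cubeT := (c - (2 * r) *: const_mx 1, PosNum r40).

Let QE : Q.2%:num = 4 * r. Proof. by []. Qed.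

Let m := qavg f Q.
Let g y := f y - m.

Let fi : qintegrable f := bmo_qintegrable n_gt0 fN.

Let gi : qintegrable g.
Proof. by apply: qintegrableB => //; exact: qintegrable_cst. Qed.

Let qavg_g Q' : qavg g Q' = qavg f Q' - m.
Proof. by rewrite qavgB ?qavg_cst//; exact: qintegrable_cst. Qed.

Let mQ : measurable (qset Q). Proof. exact: measurable_qset. Qed.

Let mg : measurable_fun [set: 'rV[R]_n] g.
Proof. exact: measurable_funB. Qed.

Let notQ y : ~ qset Q y -> 2 * r <= enorm (y - c).
Proof.
move=> Qy; rewrite leNgt; apply/negP => yc; apply: Qy => i.
have := le_lt_trans (ler_coord_enorm (y - c) i) yc.
rewrite !mxE ltr_norml mulr1 /=; lra.
Qed.

(** Bounded approximations of [g] restricted to [Q]. The indicator matters at depth 0, where [qstep]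
    is constant on the whole space. *)
Let h k y : R := \1_(qset Q) y * qstep (qavg g) k Q y.

Let mind : measurable_fun [set: 'rV[R]_n] (\1_(qset Q) : _ -> R).
Proof. exact: measurable_indic. Qed.

Let mh k : measurable_fun [set: 'rV[R]_n] (h k).
Proof. by apply: measurable_funM => //; exact: measurable_qstep. Qed.

Let hbound k : exists H, forall y, `|h k y| <= H.
Proof.
have [H HP] := qstep_bounded (qavg g) k Q; exists H => y.
rewrite normrM -[leRHS]mul1r ler_pM//.
by rewrite indicE; case: (_ \in _); rewrite ?normr1 ?normr0.
Qed.

Let int_ind : (\int[mu]_y (\1_(qset Q) y)%:E <= (qvol Q)%:E)%E.
Proof. by rewrite integral_indic// setIT [leLHS]lebesgue_qset. Qed.

Let h1 k : (\int[mu]_y `|h k y|%:E < +oo)%E.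
Proof.
have [H HP] := qstep_bounded (qavg g) k Q.
have H0 : 0 <= H by apply: le_trans (HP point).
apply: (integral_lty_mul _ H0 _ _ _ int_ind) => // y _.
by rewrite normrM mulrC (ger0_norm (_ : 0 <= \1_(qset Q) y))// ler_wpM2r.
Qed.

Definition jn_cst : R := 2 * (2 + 2 ^+ n) ^+ 2 * (2 * (4 * n%:R) ^+ n) ^+ 2.

Lemma jn_cst_ge0 : 0 <= jn_cst.
Proof. by rewrite /jn_cst mulr_ge0 ?sqr_ge0// mulr_ge0 ?sqr_ge0. Qed.

Let h2 k : (\int[mu]_y (h k y ^+ 2)%:E <= (qvol Q * (jn_cst * N ^+ 2))%:E)%E.
Proof.
apply: (@le_trans _ _ (\int[mu]_(y in qset Q) (qstep (qavg g) k Q y ^+ 2)%:E)%E).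
  rewrite [leRHS]integral_mkcond; apply: le_integral_gen => y _.
    by rewrite /patch; case: ifP => // _; rewrite lee_fin sqr_ge0.
  rewrite /patch /h indicE; case: ifP => _; first by rewrite mul1r.
  by rewrite mul0r expr0n.
rewrite integral_sqr_qstep lee_fin ler_wpM2l ?(ltW (qvol_gt0 _))//.
under eq_tree_avg do rewrite qavg_g.
have N0 : 0 < 2 * (4 * n%:R) ^+ n * N by rewrite !mulr_gt0// exprn_gt0// mulr_gt0.
have := qavg_john_nirenberg fi N0 (qavg_bmo n_gt0 fN) k Q.
by rewrite exprMn mulrA.
Qed.

(** The local part of the convolution; [ak] is its approximation by step functions and [b] the far
    part. *)
Let a t x : R := \int[mu]_(y in qset Q) (p t (x - y) * g y).
Let ak k t x : R := \int[mu]_y (p t (x - y) * h k y).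
Let b t x : R := \int[mu]_(y in ~` qset Q) (p t (x - y) * g y).

Let pB t x : 0 < t -> forall y, `|p t (x - y)| <= A * t ^- n.
Proof. by move=> t0 y; exact: (kernel_bounded pA). Qed.

Let akE k t x : ak k t x =
  \int[mu]_(y in qset Q) (p t (x - y) * qstep (qavg g) k Q y).
Proof.
rewrite [RHS]Rintegral_mkcond; apply: eq_Rintegral => y _.
rewrite /patch /h indicE; case: ifP => _; first by rewrite mul1r.
by rewrite mul0r mulr0.
Qed.

Let a_ak k t x : 0 < t ->
  `|a t x - ak k t x| <= 4 * A * t ^- n.+1 * n%:R * Q.2%:num *
     (\int[mu]_(y in qset Q) `|g y|) / 2 ^+ k.
Proof.
move=> t0; have mpx := measurable_kernel_sub pA t x.
have Ltn : 0 <= 2 * A * t ^- n.+1.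
  by rewrite !mulr_ge0// invr_ge0 exprn_ge0// ltW.
have [H HP] := qstep_bounded (qavg g) k Q.
rewrite akE -RintegralB//; last 2 first.
- exact: (qintegrableM mpx (pB x t0)).
- apply: (qintegrableM mpx (pB x t0)).
  by apply: qintegrable_bounded HP; exact: measurable_qstep.
rewrite (_ : \int[mu]_(y in _) _ =
    \int[mu]_(y in qset Q) (p t (x - y) * (g y - qstep (qavg g) k Q y))); last first.
  by apply: eq_Rintegral => y _; rewrite -mulrBr.
apply: le_trans (qstep_weak k Q gi mpx Ltn (pB x t0) _) _.
  move=> y z; apply: le_trans (kernel_lip pA _ _ t0) _.
  have -> : x - y - (x - z) = z - y by apply/rowP => i; rewrite !mxE; ring.
  rewrite enormB.
  have w1 := wker_le (x - y) t0; have w2 := wker_le (x - z) t0.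
  apply: (@le_trans _ _ (A * (enorm (y - z) / t) * (t ^- n + t ^- n))).
    by rewrite ler_wpM2l ?lerD// mulr_ge0// divr_ge0 ?enorm_ge0// ltW.
  by rewrite exprS invfM le_eqVlt; apply/orP; left; apply/eqP; ring.
by rewrite le_eqVlt; apply/orP; left; apply/eqP; ring.
Qed.

Let ak_cvg t x : 0 < t -> (fun k => ak k t x) @ \oo --> a t x.
Proof.
move=> t0; apply/cvgrPdist_le => e e0.
set K := 4 * A * t ^- n.+1 * n%:R * Q.2%:num * (\int[mu]_(y in qset Q) `|g y|).
have h1' : `|2^-1 : R| < 1 by rewrite ger0_norm; lra.
have /cvgrPdist_le/(_ e e0) := cvg_geometric K h1'.
apply: filterS => k; rewrite sub0r normrN /= exprVn => Kk.
exact: le_trans (a_ak k x t0) (le_trans (ler_norm _) Kk).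
Qed.

(** (4 n)^n bounds, in units of [N], the distance between the averages over [Q] and over the ball of
    radius 8 n r about its corner; 10 n + 2 compares distances to that corner with distances to
    [x]. *)
Definition off_cst : R := A * (10 * n%:R + 2) ^+ n.+1 * tcst ((4 * n%:R) ^+ n).

Let b_le t x : 0 < t -> eball c r x -> `|b t x| <= off_cst * N * (t / r).
Proof.
move=> t0 xB.
pose rho := 2 * n%:R * (4 * r).
have rho0 : 0 < rho by rewrite !mulr_gt0.
have nl : n%:R * Q.2%:num < rho by rewrite QE /rho -mulrA ltr_pMl ?ltr1n// mulr_gt0.
have dist : `|ball_avg f Q.1 rho - m| <= (4 * n%:R) ^+ n * N.
  rewrite distrC; apply: le_trans (qavg_ball_dist n_gt0 fN nl) _.
  rewrite QE (_ : 2 * rho / (4 * r) = 4 * n%:R)// /rho; field; exact: lt0r_neq0.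
have K0 : 0 <= (4 * n%:R) ^+ n :> R by rewrite exprn_ge0// mulr_ge0.
have tail := integral_bmo_tail n_gt0 fN rho0 K0 dist.
have mQc : measurable (~` qset Q) by exact: measurableC.
rewrite -lee_fin; apply: le_trans (le_abs_Rintegral _ _ _) _ => //.
  apply: measurable_funTS; apply: measurable_funM => //.
  exact: (measurable_kernel_sub pA).
(* For y outside [Q]: rho = 8 n r, the corner is within 2 n r of [c], and [x] is within r of [c], so
   rho + |Q.1 - y| <= (10 n + 1) r + |x - y|, where r <= |x - y|. *)
pose kap : R := 10 * n%:R + 2.
have kap0 : 0 < kap by rewrite ltr_wpDl// mulr_ge0.
have c0 : 0 <= A * kap ^+ n.+1 * (t / r).
  by rewrite !mulr_ge0 ?exprn_ge0 ?invr_ge0 ?(ltW kap0) ?(ltW t0) ?(ltW r0).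
rewrite (_ : off_cst * N * (t / r) = A * kap ^+ n.+1 * (t / r) *
   (tcst ((4 * n%:R) ^+ n) * N)); last by rewrite /off_cst -/kap; ring.
rewrite integral_mkcond.
apply: (@le_trans _ _ (\int[mu]_y (\1_(~` qset Q) y * `|p t (x - y) * g y|)%:E)%E).
  rewrite le_eqVlt; apply/orP; left; apply/eqP/eq_integral => y _.
  by rewrite /patch indicE; case: ifP => _; rewrite ?mul1r ?mul0r.
apply: (integral_le_mul _ c0 _ _ _ tail) => //.
- apply: measurable_funM; first exact: measurable_wker_sub.
  by apply: measurableT_comp.
- by move=> y _; rewrite mulr_ge0// wker_ge0.
move=> y _; rewrite indicE; have [/set_mem Qy|_] := boolP (y \in _); last first.
  by rewrite mul0r; apply: mulr_ge0 => //; apply: mulr_ge0 => //; exact: wker_ge0.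
rewrite mul1r normrM mulrA ler_wpM2r//.
apply: le_trans (kernel_size pA _ t0) _.
rewrite -2![A * _ * _]mulrA; apply: ler_wpM2l => //.
have yc := notQ Qy; move: xB; rewrite /eball/= => xB.
have xy : r <= enorm (x - y).
  have := ler_enorm_dist y x c; rewrite (enormB y x); lra.
have ya : rho + enorm (Q.1 - y) <= kap * enorm (x - y).
  have d1 := ler_enorm_dist Q.1 x y; have d2 := ler_enorm_dist Q.1 c x.
  have d3 : enorm (Q.1 - c) <= n%:R * (2 * r).
    apply: enorm_le_coord => [|i]; first by rewrite mulr_ge0// ltW.
    by rewrite !mxE mulr1 addrAC subrr sub0r normrN ger0_norm// mulr_ge0// ltW.
  rewrite (enormB c x) in d2.
  have : (10 * n%:R + 1) * r <= (10 * n%:R + 1) * enorm (x - y).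
    by rewrite ler_wpM2l// addr_ge0// mulr_ge0.
  by rewrite /rho /kap; lra.
have e0 : 0 < enorm (x - y) by exact: lt_le_trans xy.
have rr : r <= rho.
  rewrite /rho; have : 1 <= n%:R :> R by rewrite ler1n.
  by move=> n1; rewrite -[leLHS]mul1r mulrA ler_wpM2r ?(ltW r0)//; lra.
have E0 : 0 < rho + enorm (Q.1 - y) by rewrite ltr_wpDr ?enorm_ge0.
apply: (@le_trans _ _ (t / enorm (x - y) ^+ n.+1)).
  rewrite /wker ler_wpM2l ?(ltW t0)// lef_pV2 ?posrE ?exprn_gt0 ?addr_gt0//.
  by rewrite lerXn2r ?nnegrE ?(ltW e0) ?addr_ge0 ?(ltW e0) ?(ltW t0)// lerDr ltW.
apply: (@le_trans _ _ (t * (kap ^+ n.+1 / (rho + enorm (Q.1 - y)) ^+ n.+1))).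
  rewrite ler_wpM2l ?(ltW t0)// ler_pdivlMr ?exprn_gt0// ler_pdivrMl ?exprn_gt0//.
  rewrite mulrC -exprMn.
  by rewrite lerXn2r ?nnegrE ?(ltW E0) ?mulr_ge0 ?(ltW e0) ?(ltW kap0).
(* The numerator [rho] of [wker rho] against the [r] of t / r leaves a factor rho / r, which is at
   least 1. *)
rewrite /wker [leRHS](_ : _ = t * (kap ^+ n.+1 / (rho + enorm (Q.1 - y)) ^+ n.+1)
  * (rho / r)); last first.
  by move: (rho + _) E0 => E E0; field; rewrite expf_neq0 ?gt_eqF.
rewrite ler_peMr ?mulr_ge0 ?invr_ge0 ?exprn_ge0 ?(ltW t0) ?(ltW kap0) ?(ltW E0)//.
by rewrite ler_pdivlMr// mul1r.
Qed.

Let C1 := @square_cst R n A * (qvol Q * (jn_cst * N ^+ 2)).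

(** The depth of the step function and the lower cutoff of the scales tend to their limits together.
    The open interval ends at 2 r so that it contains t = r. *)
Let F_ k (q : R * 'rV[R]_n) : \bar R :=
  (\1_`]r / k.+1%:R, 2 * r[ q.1 * (ak k q.1 q.2 ^+ 2 / q.1))%:E.
Let Flim (q : R * 'rV[R]_n) : \bar R :=
  (\1_`]0, 2 * r[ q.1 * (a q.1 q.2 ^+ 2 / q.1))%:E.

Let rk0 k : 0 < r / k.+1%:R. Proof. by rewrite divr_gt0. Qed.

Let F_0 k q : (0 <= F_ k q)%E.
Proof.
rewrite /F_ lee_fin indicE; have [/set_mem/=|_] := boolP (_ \in _); last by rewrite mul0r.
rewrite in_itv/= => /andP[/(lt_trans (rk0 k)) t0 _].
by rewrite mul1r divr_ge0 ?sqr_ge0// ltW.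
Qed.

Let mF_ k : measurable_fun [set: R * 'rV[R]_n] (F_ k).
Proof.
apply/measurable_EFinP/measurable_funM.
  apply: (@measurableT_comp _ _ _ _ _ _ (\1_`]r / k.+1%:R, 2 * r[ : R -> R)) => //.
apply: measurable_funM.
  by apply: measurable_funX; exact: (measurable_kernel_conv pA (mh k)).
exact: (measurableT_comp (@measurable_inv R)).
Qed.

Let F_cvg q : (fun k => F_ k q) @ \oo --> Flim q.
Proof.
case: q => t x; rewrite /F_ /Flim /=; apply: cvg_EFin; first exact: nearW.
have [t0|t0] := ltP 0 t; last first.
  rewrite indicE memNset ?mul0r; last by rewrite /= in_itv/= ltNge t0.
  apply: cvg_near_cst; apply: nearW => k.
  by rewrite /= indicE memNset ?mul0r//= in_itv/= ltNge (le_trans t0)//= ltW.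
apply: cvgM; last first.
  by apply: cvgM; [apply: cvgM; exact: ak_cvg|exact: cvg_cst].
apply: cvg_near_cst.
(* For k beyond r / t the lower cutoff is below t, and the indicator has its limiting value. *)
exists (Num.bound (r / t)) => // k /= rk; rewrite !indicE; congr (_%:R); congr nat_of_bool.
apply/idP/idP => /set_mem /=; rewrite in_itv/= => /andP[h1' h2'];
  apply/mem_set; rewrite /= in_itv/= h2' andbT//.
rewrite ltr_pdivrMr// mulrC -ltr_pdivrMr//.
apply: lt_le_trans (archi_boundP _) _; first by rewrite divr_ge0// ltW.
by rewrite ler_nat (leq_trans rk).
Qed.

Let F_le k : (\int[leb]_t \int[mu]_x F_ k (t, x) <= C1%:E)%E.
Proof.
have [H HP] := hbound k.
have eM : r / k.+1%:R < 2 * r.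
  by rewrite ltr_pdivrMr// mulrAC ltr_pMl// (lt_le_trans (ltr1n _ 2))// ler_peMr// ler1n.
have := kernel_square_le pA (rk0 k) eM (mh k) HP (h1 k).
move=> /le_trans/(_ _)/(le_trans _); apply; last first.
  rewrite /C1 EFinM lee_wpmul2l// ?lee_fin ?(ltW (square_cst_gt0 _))//.
rewrite [leRHS]integral_mkcond; apply: le_integral_gen => t _; rewrite /patch.
  case: ifPn => // /set_mem/=; rewrite in_itv/= => /andP[/(lt_trans (rk0 k)) t0 _].
  by apply: integral_ge0 => x _; rewrite lee_fin divr_ge0 ?sqr_ge0// ltW.
rewrite /F_ /= indicE; case: ifPn => _; last first.
  by rewrite integral0_eq// => x _; rewrite mul0r.
by under eq_integral do rewrite mul1r.
Qed.

Let Flim_le : (\int[leb]_t \int[mu]_x Flim (t, x) <= C1%:E)%E.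
Proof. exact: (fatou_le_iterated (m1 := leb) (m2 := mu) mF_ F_0 F_cvg F_le). Qed.

Let kconv_split t x : 0 < t -> kconv p f t x = a t x + b t x.
Proof.
move=> t0; rewrite (kconvE n_gt0 pA fN x m t0) -(setvU (qset Q)) setUC.
rewrite Rintegral_setU//; first exact: measurableC.
  by rewrite setUv; exact: (kconv_integrable n_gt0 pA fN).
by apply/disj_setPCl.
Qed.

(** The factors 2 come from (a + b)^2 <= 2 a^2 + 2 b^2; (2 n)^n compares the volume (4 r)^n of [Q]
    with the lower bound (2 r / n)^n for the ball. *)
Definition carleson_cst : R :=
  2 * (@square_cst R n A * jn_cst) * (2 * n%:R) ^+ n + 2 * off_cst ^+ 2.

Let mFlim : measurable_fun [set: R * 'rV[R]_n] Flim.
Proof. by apply: (emeasurable_fun_cvg _ _ mF_) => q _; exact: F_cvg. Qed.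

Let Flim0 q : (0 <= Flim q)%E.
Proof.
rewrite /Flim lee_fin indicE; have [/set_mem/=|_] := boolP (_ \in _); last by rewrite mul0r.
by rewrite in_itv/= => /andP[t0 _]; rewrite mul1r divr_ge0 ?sqr_ge0// ltW.
Qed.

Let Klow : R := 2 * (off_cst * N) ^+ 2 / r.

(** The far part is at most a multiple of t / r, and (t / r)^2 / t <= 1 / r for t <= r, so
    integrating it over []0, r]] costs a bounded amount. *)
Let kconv_le t x : 0 < t <= r -> eball c r x ->
  ((kconv p f t x ^+ 2 / t)%:E <= 2%:E * Flim (t, x) + Klow%:E)%E.
Proof.
move=> /andP[t0 tr] xB; rewrite /Flim /= indicE mem_set/=; last first.
  by rewrite in_itv/= t0/= (le_lt_trans tr)// ltr_pMl// ltr1n.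
rewrite mul1r -EFinM -EFinD lee_fin kconv_split//.
have bl := b_le t0 xB.
have bK : b t x ^+ 2 / t <= (off_cst * N) ^+ 2 / r.
  apply: (@le_trans _ _ ((off_cst * N * (t / r)) ^+ 2 / t)).
    rewrite ler_wpM2r ?invr_ge0 ?(ltW t0)// -real_normK ?num_real//.
    by rewrite lerXn2r ?nnegrE// (le_trans _ bl).
  rewrite [leLHS](_ : _ = (off_cst * N) ^+ 2 / r * (t / r)); last first.
    by field; rewrite ?gt_eqF.
  by rewrite ler_piMr ?divr_ge0 ?sqr_ge0 ?(ltW r0)// ler_pdivrMr// mul1r.
apply: (@le_trans _ _ (2 * (a t x ^+ 2 / t) + 2 * (b t x ^+ 2 / t))); last first.
  by rewrite lerD2l /Klow -mulrA ler_wpM2l.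
rewrite !mulrA -mulrDl ler_wpM2r ?invr_ge0 ?(ltW t0)//.
by have := sqr_ge0 (a t x - b t x); rewrite sqrrB sqrrD; lra.
Qed.

Lemma carleson :
  (\int[mu]_(x in eball c r) \int[leb]_(t in `]0%R, r])
      (kconv p f t x ^+ 2 / t)%:E <=
   (carleson_cst * N ^+ 2 * ball_vol c r)%:E)%E.
Proof.
pose B := eball c r; have mB : measurable B := measurable_eball c r.
have Kl0 : 0 <= Klow by rewrite divr_ge0 ?(ltW r0)// mulr_ge0 ?sqr_ge0.
have mFx x : measurable_fun [set: R] (fun t => Flim (t, x)).
  exact: (measurableT_comp mFlim (pair2_measurable x)).
have mI : measurable (`]0, r] : set R) by exact: measurable_itv.
have mSw : measurable_fun [set: 'rV[R]_n * R] (fun q => 2%:E * Flim (q.2, q.1))%E.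
  apply: measurable_funeM.
  exact: (measurableT_comp mFlim (measurable_fun_pair measurable_snd measurable_fst)).
apply: (@le_trans _ _ (\int[mu]_(x in B) (\int[leb]_(t in `]0%R, r])
    (2%:E * Flim (t, x)) + (Klow * r)%:E))%E).
  apply: le_integral_gen => x xB.
    apply: adde_ge0; last by rewrite lee_fin mulr_ge0// ltW.
    by apply: integral_ge0 => t _; rewrite mule_ge0.
  apply: (@le_trans _ _ (\int[leb]_(t in `]0%R, r]) (2%:E * Flim (t, x) + Klow%:E))%E).
    apply: le_integral_gen => t.
      by move=> _; rewrite adde_ge0 ?mule_ge0.
    by rewrite /= in_itv/= => tI; exact: kconv_le.
  rewrite ge0_integralD//; last 2 first.
  - by move=> t _; rewrite mule_ge0.
  - exact: (measurable_funTS (measurable_funeM 2%:E (mFx x))).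
  rewrite leeD2l// integral_cst// [X in (_ * X)%E](_ : _ = r%:E) ?EFinM//.
  by rewrite [LHS]lebesgue_measure_itv/= lte_fin r0 oppr0 adde0.
rewrite ge0_integralD//; last 3 first.
- by move=> x _; apply: integral_ge0 => t _; rewrite mule_ge0.
- apply: measurable_funTS.
  exact: (measurable_integral_param_in leb mI mSw).
- by move=> x _; rewrite lee_fin mulr_ge0// ltW.
rewrite integral_cst// [X in (_ * X)%E]lebesgue_eball//.
rewrite (fubini_tonelli_in mu leb)//; last first.
  by move=> x t _ _; rewrite mule_ge0.
apply: (@le_trans _ _ ((2 * C1)%:E + (Klow * r)%:E * (ball_vol c r)%:E)%E).
  rewrite leeD2r// EFinM.
  apply: (@le_trans _ _ (2%:E * \int[leb]_t \int[mu]_x Flim (t, x))%E); last first.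
    by rewrite lee_wpmul2l.
  rewrite -ge0_integralZl//; last 2 first.
  - exact: (measurable_integral_param mu mFlim).
  - by move=> t _; exact: integral_ge0.
  rewrite [leLHS]integral_mkcond; apply: (@le_integral_gen _ _ _ leb) => t _.
    by rewrite mule_ge0// integral_ge0.
  rewrite /patch; case: ifPn => _; last by rewrite mule_ge0// integral_ge0.
  rewrite -ge0_integralZl//; last exact: (measurableT_comp mFlim (pair1_measurable t)).
  rewrite [leLHS]integral_mkcond; apply: le_integral_gen => x _; first by rewrite mule_ge0.
  by rewrite /patch; case: ifPn => // _; rewrite mule_ge0.
rewrite -EFinM -EFinD lee_fin.
have vQ : qvol Q <= (2 * n%:R) ^+ n * ball_vol c r.
  apply: le_trans (ler_wpM2l _ (ball_vol_ge n_gt0 c r0)).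
    rewrite /qvol QE -exprMn le_eqVlt; apply/orP; left; apply/eqP; congr (_ ^+ _).
    by field; rewrite gt_eqF.
  by rewrite exprn_ge0// mulr_ge0.
rewrite [leRHS](_ : _ = 2 * @square_cst R n A * jn_cst * N ^+ 2 *
   ((2 * n%:R) ^+ n * ball_vol c r) + 2 * (off_cst * N) ^+ 2 * ball_vol c r); last first.
  by rewrite /carleson_cst; ring.
rewrite [leLHS](_ : _ = 2 * @square_cst R n A * jn_cst * N ^+ 2 *
   qvol Q + 2 * (off_cst * N) ^+ 2 * ball_vol c r); last first.
  by rewrite /C1 /Klow; move: (qvol Q) => q; field; rewrite gt_eqF.
rewrite lerD2r ler_wpM2l// mulr_ge0 ?sqr_ge0// mulr_ge0 ?jn_cst_ge0//.
by rewrite mulr_ge0// (ltW (square_cst_gt0 _)).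
Qed.

End carleson.

(* With [h = E / (g + E)], [(1 + h) g^2 + (1 + 1/h) E^2 <= (g + 2 E)^2]. *)
Lemma sqrte_absorb (R : realType) (N E : R) (G S F G' F' : \bar R) :
  0 < N -> 0 < E -> (0 <= S)%E -> (0 <= G')%E -> (F' <= G')%E ->
  (G = S + F)%E ->
  (forall h, 0 < h -> (F <= (1 + h)%:E * F' + ((1 + h^-1) * E ^+ 2)%:E)%E) ->
  (sqrte G <= S * N^-1%:E + (N + 2 * E)%:E + sqrte G')%E.
Proof.
move=> N0 E0 S0 G'0 FG' -> FF'.
have SN0 : (0 <= S * N^-1%:E)%E by rewrite mule_ge0// lee_fin invr_ge0 ltW.
have ON0 : 0 <= N + 2 * E by rewrite addr_ge0 ?mulr_ge0// ltW.
have [Ge|Gfin] := eqVneq G' +oo%E.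
  by rewrite Ge/= addey ?leey// -ltNye (@lt_le_trans _ _ 0%E)// adde_ge0.
have [g gE] : exists g : R, sqrte G' = g%:E.
  by exists (fine (sqrte G')); rewrite fineK// sqrte_fin_num// ge0_fin_numE// ltey.
have g0 : 0 <= g by rewrite -lee_fin -gE sqrte_ge0.
have Gg : G' = (g ^+ 2)%:E by rewrite EFin_expe -gE sqr_sqrte.
have [Se|Sfin] := eqVneq S +oo%E.
  have -> : (S * N^-1%:E = +oo)%E by rewrite Se gt0_mulye// lte_fin invr_gt0.
  by rewrite gE -addeA -EFinD addye ?leey.
have [s sE] : exists s : R, S = s%:E.
  by exists (fine S); rewrite fineK// ge0_fin_numE// ltey.
have s0 : 0 <= s by rewrite -lee_fin -sE.
pose h := E / (g + E); have gE0 : 0 < g + E by rewrite ltr_wpDl.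
have h0 : 0 < h by rewrite divr_gt0.
have far : (F <= ((g + 2 * E) ^+ 2)%:E)%E.
  apply: le_trans (FF' h h0) _.
  apply: (@le_trans _ _ ((1 + h)%:E * (g ^+ 2)%:E + ((1 + h^-1) * E ^+ 2)%:E)%E).
    by apply: leeD => //; rewrite lee_wpmul2l -?Gg// lee_fin addr_ge0// ltW.
  rewrite -EFinM -EFinD lee_fin /h invf_div.
  have hg : E / (g + E) * g ^+ 2 <= E * g.
    rewrite mulrAC ler_pdivrMr// expr2 mulrA ler_wpM2l ?mulr_ge0 ?(ltW E0)//.
    by rewrite lerDl ltW.
  have -> : (1 + (g + E) / E) * E ^+ 2 = E ^+ 2 + (g + E) * E.
    by field; rewrite gt_eqF.
  have gE2 : 0 <= g * E by rewrite mulr_ge0// ltW.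
  have EE2 : 0 <= E * E by rewrite mulr_ge0// ltW.
  by move: hg; rewrite mulrDl; lra.
have total : (S + F <= ((s / N + (N + 2 * E) + g) ^+ 2)%:E)%E.
  rewrite sE; apply: le_trans (leeD2l _ far) _.
  rewrite -EFinD lee_fin.
  (* Since s = (s / N) N is at most (s / N + N)^2, the local energy enters linearly and no square
     root of it has to be integrated. *)
  have -> : s / N + (N + 2 * E) + g = (s / N + N) + (g + 2 * E) by ring.
  have u0 : 0 <= s / N by rewrite divr_ge0// ltW.
  have w0 : 0 <= g + 2 * E by rewrite addr_ge0// mulr_ge0// ltW.
  have sN : s = s / N * N by field; rewrite gt_eqF.
  have uN : 0 <= s / N * N by rewrite -sN.
  rewrite [leRHS]sqrrD lerD2r//.
  have : 0 <= (s / N + N) * (g + 2 * E) by rewrite mulr_ge0// addr_ge0// ltW.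
  have := sqr_ge0 (s / N); have := sqr_ge0 N.
  rewrite sqrrD; lra.
have {}total : (sqrte (S + F) <= sqrte ((s / N + (N + 2 * E) + g) ^+ 2)%:E)%E.
  by rewrite lee_sqrt// lee_fin sqr_ge0.
rewrite gE {2}sE -EFinM -!EFinD; apply: le_trans total _.
rewrite EFin_expe sqrte_sqr gee0_abs// lee_fin addr_ge0// addr_ge0//.
by rewrite divr_ge0// ltW.
Qed.

(** * Comparison of the energies at two points of a ball *)

Section oscillation.
Context {R : realType} {n : nat}.
Hypothesis n_gt0 : (0 < n)%N.
Local Notation mu := (@lebesgue_rV R n).
Local Notation leb := (@lebesgue_measure R).
Implicit Types (x y z c : 'rV[R]_n) (s t r : R) (D : set R).

Variables (p : R -> 'rV[R]_n -> R) (A : R).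
Hypothesis pA : square_kernel p A.
Variables (f : 'rV[R]_n -> R) (N : R).
Hypothesis fN : bmo_le f N.
Hypothesis N_gt0 : 0 < N.

Definition energy D x : \bar R := (\int[leb]_(t in D) (kconv p f t x ^+ 2 / t)%:E)%E.

Let mker : measurable_fun [set: R * 'rV[R]_n] (fun q => (kconv p f q.1 q.2 ^+ 2 / q.1)%:E).
Proof.
apply/measurable_EFinP/measurable_funM.
  by apply: measurable_funX; exact: (measurable_kconv pA fN).
exact: (measurableT_comp (@measurable_inv R)).
Qed.

Let mkx x : measurable_fun [set: R] (fun t => (kconv p f t x ^+ 2 / t)%:E).
Proof. exact: (measurableT_comp mker (pair2_measurable x)). Qed.

Lemma measurable_energy D : measurable D -> measurable_fun [set: 'rV[R]_n] (energy D).
Proof.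
move=> mD.
apply: (@measurable_integral_param_in _ _ _ _ _ leb D
  (fun q : 'rV[R]_n * R => (kconv p f q.2 q.1 ^+ 2 / q.2)%:E)) => //.
exact: (measurableT_comp mker (measurable_fun_pair measurable_snd measurable_fst)).
Qed.

Let ker0 t x : 0 < t -> (0 <= (kconv p f t x ^+ 2 / t)%:E)%E.
Proof. by move=> t0; rewrite lee_fin divr_ge0 ?sqr_ge0// ltW. Qed.

Lemma energy_ge0 D x : (forall t, D t -> 0 < t) -> (0 <= energy D x)%E.
Proof. by move=> D0; apply: integral_ge0 => t /D0; exact: ker0. Qed.

Lemma energy_split r x : 0 < r ->
  energy `]0%R, +oo[%classic x = (energy `]0%R, r]%classic x + energy `]r, +oo[%classic x)%E.
Proof.
move=> r0; rewrite /energy -ge0_integral_setU//.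
- congr integral; apply/seteqP; split => t /=; rewrite !in_itv/= ?andbT.
    by move=> ->/=; have [|] := leP t r; [left|right].
  by move=> [/andP[]//|]; exact: lt_trans.
- exact: (measurable_funTS (mkx x)).
- move=> t /=; rewrite !in_itv/= ?andbT => -[/andP[t0 _]|/(lt_trans r0) t0]; exact: ker0.
- rewrite disj_set2E; apply/eqP/seteqP; split => t //=.
  by rewrite !in_itv/= andbT => -[/andP[_ /le_lt_trans h]/h]; rewrite ltxx.
Qed.

Definition far_cst : R := 2 * @smooth_cst R n A.

(** Young's inequality for u = v + (u - v), with [h] left free because its best value depends on the
    energy at [x']. The difference is O(r / t) by smoothness, and its square against dt/t gives r^2
    / t^3. *)
Let energy_far c r x x' h : 0 < r -> 0 < h -> eball c r x -> eball c r x' ->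
  (energy `]r, +oo[%classic x <= (1 + h)%:E * energy `]r, +oo[%classic x' +
     ((1 + h^-1) * (far_cst * N) ^+ 2 * (64 / (1 - 4^-1)))%:E)%E.
Proof.
move=> r0 h0 xB xB'; pose d := (1 + h^-1) * (far_cst * N) ^+ 2.
have d0 : 0 <= d by rewrite mulr_ge0 ?sqr_ge0// addr_ge0// invr_ge0 ltW.
have hh : 0 <= 1 + h by rewrite addr_ge0// ltW.
have rt t : `]r, +oo[%classic t -> r < t by rewrite /= in_itv/= andbT.
apply: (@le_trans _ _ (\int[leb]_(t in `]r, +oo[)
    ((1 + h)%:E * (kconv p f t x' ^+ 2 / t)%:E + d%:E * (r ^+ 2 / t ^+ 3)%:E))%E).
  apply: le_integral_gen => t /rt rlt; have t0 := lt_trans r0 rlt.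
    rewrite -!EFinM -EFinD lee_fin addr_ge0// mulr_ge0 ?divr_ge0 ?sqr_ge0 ?exprn_ge0//;
    exact: ltW.
  rewrite -!EFinM -EFinD lee_fin.
  have xx' : enorm (x - x') <= 2 * r.
    have := ler_enorm_dist x c x'; move: xB xB'; rewrite /eball/= (enormB c x'); lra.
  have ub : `|kconv p f t x - kconv p f t x'| <= far_cst * N * (r / t).
    apply: le_trans (kconv_smooth n_gt0 pA fN t0 _) _.
      by apply: le_trans xx' _; rewrite ler_pM2l// ltW.
    rewrite /far_cst [leRHS](_ : _ = @smooth_cst R n A * N * (2 * r / t)); last by ring.
    rewrite ler_wpM2l ?ler_wpM2r ?invr_ge0 ?(ltW t0)//.
    by rewrite mulr_ge0 ?(ltW N_gt0)// (smooth_cst_ge0 pA).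
  set u := kconv p f t x in ub *; set v := kconv p f t x' in ub *.
  have uv2 : (u - v) ^+ 2 <= (far_cst * N * (r / t)) ^+ 2.
    rewrite -real_normK ?num_real// lerXn2r ?nnegrE//; exact: le_trans ub.
  have young : u ^+ 2 <= (1 + h) * v ^+ 2 + (1 + h^-1) * (u - v) ^+ 2.
    have -> : u ^+ 2 = (1 + h) * v ^+ 2 + (1 + h^-1) * (u - v) ^+ 2 -
        h * (v - h^-1 * (u - v)) ^+ 2 by field; rewrite gt_eqF.
    by rewrite gerBl mulr_ge0 ?sqr_ge0// ltW.
  apply: (@le_trans _ _ (((1 + h) * v ^+ 2 + (1 + h^-1) *
      (far_cst * N * (r / t)) ^+ 2) / t)).
    rewrite ler_wpM2r ?invr_ge0 ?(ltW t0)//; apply: le_trans young _.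
    by rewrite lerD2l ler_wpM2l// addr_ge0// invr_ge0 ltW.
  rewrite le_eqVlt /d; apply/orP; left; apply/eqP; field; rewrite !gt_eqF//.
have mc : measurable_fun [set: R] (fun t : R => (r ^+ 2 / t ^+ 3)%:E).
  apply/measurable_EFinP; apply: measurable_funM => //.
  apply: (@measurableT_comp _ _ _ _ _ _ (@GRing.inv R)); first exact: measurable_inv.
  exact: measurable_funX.
rewrite ge0_integralD//; last 4 first.
- by move=> t /rt/(lt_trans r0) t0; rewrite mule_ge0// ker0.
- by apply: measurable_funTS; apply: measurable_funeM; exact: (mkx x').
- move=> t /rt/(lt_trans r0) t0; rewrite mule_ge0// lee_fin divr_ge0 ?sqr_ge0//.
  by rewrite exprn_ge0// ltW.
- by apply: measurable_funTS; apply: measurable_funeM; exact: mc.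
apply: leeD.
  rewrite ge0_integralZl//; first exact: (measurable_funTS (mkx x')).
  by move=> t /rt/(lt_trans r0) t0; exact: ker0.
rewrite ge0_integralZl//; last 2 first.
- exact: (measurable_funTS mc).
- by move=> t /rt/(lt_trans r0) t0; rewrite lee_fin divr_ge0 ?sqr_ge0// exprn_ge0// ltW.
by rewrite [leRHS]EFinM lee_wpmul2l// ?lee_fin//; exact: integral_inv_cube.
Qed.

Definition osc_cst : R := 1 + 2 * (10 * far_cst + 1).

Lemma energy_compare c r x x' : 0 < r -> eball c r x -> eball c r x' ->
  (sqrte (energy `]0%R, +oo[%classic x) <= energy `]0%R, r]%classic x * N^-1%:E +
     (osc_cst * N)%:E + sqrte (energy `]0%R, +oo[%classic x'))%E.
Proof.
move=> r0 xB xB'.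
have F0 : 0 <= far_cst by rewrite mulr_ge0// (smooth_cst_ge0 pA).
(* The integral of r^2 / t^3 was bounded by 256/3, which is below 10^2; the added [N] makes [E]
   positive even if [far_cst] is 0. *)
pose E := 10 * far_cst * N + N.
have FN0 : 0 <= 10 * far_cst * N by apply: mulr_ge0; [exact: mulr_ge0|exact: ltW].
have E0 : 0 < E by exact: ltr_wpDl.
have -> : osc_cst * N = N + 2 * E by rewrite /osc_cst /E; ring.
have FE : (far_cst * N) ^+ 2 * (64 / (1 - 4^-1)) <= E ^+ 2.
  apply: (@le_trans _ _ ((10 * far_cst * N) ^+ 2)).
    have -> : (10 * far_cst * N) ^+ 2 = 100 * (far_cst * N) ^+ 2 by ring.
    have -> : 64 / (1 - 4^-1) = 256 / 3 :> R by field.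
    have := sqr_ge0 (far_cst * N); lra.
  by rewrite lerXn2r ?nnegrE ?lerDl ?(ltW E0) ?(ltW N_gt0).
apply: (@sqrte_absorb _ N E _ _ _ _ (energy `]r, +oo[%classic x')
  N_gt0 E0 _ _ _ (energy_split x r0)).
- by apply: energy_ge0 => t /=; rewrite in_itv/= => /andP[].
- by apply: energy_ge0 => t /=; rewrite in_itv/= andbT.
- rewrite (energy_split x' r0) leeDr// energy_ge0// => t /=.
  by rewrite in_itv/= => /andP[].
move=> h h0; apply: le_trans (energy_far r0 h0 xB xB') _.
by rewrite leeD2l// lee_fin -mulrA ler_wpM2l// addr_ge0// invr_ge0 ltW.
Qed.

End oscillation.

(** * The kernel of the square function *)

Section kernel_of_psi.
Context {R : realType} {n : nat}.
Local Notation mu := (@lebesgue_rV R n).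
Implicit Types (x y z : 'rV[R]_n) (s t : R).

Variables (psi : 'rV[R]_n -> R) (C1 C2 : R).
Hypotheses (C1_gt0 : 0 < C1) (C2_gt0 : 0 < C2).
Hypothesis psi_L1 : mu.-integrable setT (EFin \o psi).
Hypothesis psi_mean0 : (\int[mu]_x (psi x)%:E = 0)%E.
Hypothesis psi_size : forall x, `|psi x| <= C1 * (1 + enorm x) ^- n.+1.
Hypothesis psi_derivable : forall x (i : 'I_n), derivable psi x (delta_mx ord0 i).
Hypothesis psi_smooth : forall x, enorm (gradient psi x) <= C2 * (1 + enorm x) ^- n.+2.

Let n1 x : 0 < 1 + enorm x. Proof. by rewrite ltr_wpDr ?enorm_ge0. Qed.

Let w x : R := (1 + enorm x) ^- n.+1.

Let w0 x : 0 < w x. Proof. by rewrite invr_gt0 exprn_gt0. Qed.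

Let derivable_line z v s : derivable psi (z + s *: v) v ->
  is_derive s (1 : R) (fun s => psi (z + s *: v)) ('D_v psi (z + s *: v)).
Proof.
have E : (fun h : R => h^-1 *: (((fun s => psi (z + s *: v)) \o shift s) (h *: 1) -
    psi (z + s *: v))) =
  (fun h : R => h^-1 *: ((psi \o shift (z + s *: v)) (h *: v) - psi (z + s *: v))).
  apply/funext => h /=; congr (_ *: (psi _ - _)).
  by rewrite -[h *: 1]/(h * 1) mulr1 scalerDl addrCA.
move=> dv; apply: DeriveDef.
  by rewrite /derivable E.
by rewrite /derive E.
Qed.

Lemma ler_enorm_coord x y : (forall i, `|x ord0 i| <= `|y ord0 i|) -> enorm x <= enorm y.
Proof.
move=> xy; rewrite ler_wsqrtr// ler_sum// => i _.
rewrite -[leLHS]real_normK ?num_real// -[leRHS]real_normK ?num_real//.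
by rewrite lerXn2r ?nnegrE.
Qed.

Let line_le z i a b M : a <= b ->
  (forall s, a <= s <= b -> `|'D_(delta_mx ord0 i) psi (z + s *: delta_mx ord0 i)| <= M) ->
  `|psi (z + b *: delta_mx ord0 i) - psi (z + a *: delta_mx ord0 i)| <= M * (b - a).
Proof.
move=> ab DM.
have [||c] := @MVT_segment R (fun s => psi (z + s *: delta_mx ord0 i))
    (fun s => 'D_(delta_mx ord0 i) psi (z + s *: delta_mx ord0 i)) a b ab.
- by move=> s _; exact: derivable_line.
- apply: derivable_within_continuous => s _.
  by case: (@derivable_line z (delta_mx ord0 i) s (@psi_derivable _ i)).
rewrite in_itv/= => cab ->; rewrite normrM (ger0_norm (_ : 0 <= b - a)) ?subr_ge0//.
by rewrite ler_wpM2r ?subr_ge0// DM.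
Qed.

(** 1 + |z| is at least half of 1 + |x|, whence the power of 2; the decay of order n + 2 is then
    weakened to that of [w]. *)
Let near_le x z : enorm (z - x) <= 2^-1 ->
  enorm (gradient psi z) <= C2 * 2 ^+ n.+2 * w x.
Proof.
move=> zx; apply: le_trans (psi_smooth z) _.
rewrite -mulrA ler_wpM2l ?(ltW C2_gt0)//.
have xz : (1 + enorm x) / 2 <= 1 + enorm z.
  have := ler_enormD (x - z) z; rewrite subrK enormB; have := enorm_ge0 z; lra.
apply: (@le_trans _ _ (((1 + enorm x) / 2) ^- n.+2)).
  have h0 : 0 < (1 + enorm x) / 2 by rewrite divr_gt0.
  by rewrite lef_pV2 ?posrE ?exprn_gt0// lerXn2r ?nnegrE ?(ltW h0) ?(ltW (n1 z)).
rewrite exprMn invfM exprVn invrK mulrC ler_wpM2l ?exprn_ge0//.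
rewrite /w lef_pV2 ?posrE ?exprn_gt0// ler_weXn2l//.
by rewrite lerDl enorm_ge0.
Qed.

(** Only partial derivatives are given, so the path from [x] to [y] changes one coordinate at a
    time, with the mean value theorem on each edge. Every point of the path is within |x - y| of
    [x], where [near_le] holds. *)
Let psi_near x y : enorm (x - y) <= 2^-1 ->
  `|psi y - psi x| <= n%:R * (C2 * 2 ^+ n.+2 * w x * enorm (x - y)).
Proof.
move=> xy.
pose zk k : 'rV[R]_n := \row_j (if (j < k)%N then y ord0 j else x ord0 j).
have zkn : zk n = y by apply/rowP => j; rewrite mxE ltn_ord.
have zk0 : zk 0 = x by apply/rowP => j; rewrite mxE.
have step (k : 'I_n) : `|psi (zk k.+1) - psi (zk k)| <= C2 * 2 ^+ n.+2 * w x * enorm (x - y).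
  pose e : 'rV[R]_n := delta_mx ord0 k.
  pose z : 'rV[R]_n := \row_j (if j == k then 0 else zk k ord0 j).
  have zE s : z + s *: e = \row_j (if j == k then s else zk k ord0 j).
    apply/rowP => j; rewrite !mxE eqxx/=.
    by case: eqVneq => _; rewrite ?mulr1 ?add0r ?mulr0 ?addr0.
  have zx : z + x ord0 k *: e = zk k.
    by rewrite zE; apply/rowP => j; rewrite !mxE; case: eqVneq => // ->; rewrite ltnn.
  have zy : z + y ord0 k *: e = zk k.+1.
    rewrite zE; apply/rowP => j; rewrite !mxE; case: eqVneq => [->|jk].
      by rewrite ltnSn.
    by rewrite [(_ < k.+1)%N]ltnS [(j <= k)%N]leq_eqVlt [(_ == _ :> nat)](negbTE jk).
  have coord := ler_coord_enorm (x - y) k; rewrite !mxE in coord.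
  have bd s : `|s - x ord0 k| <= `|x ord0 k - y ord0 k| ->
      `|'D_e psi (z + s *: e)| <= C2 * 2 ^+ n.+2 * w x.
    move=> sx; have -> : 'D_e psi (z + s *: e) = gradient psi (z + s *: e) ord0 k.
      by rewrite mxE.
    apply: le_trans (ler_coord_enorm _ _) _; apply: near_le.
    apply: le_trans xy; apply: ler_enorm_coord => j; rewrite zE !mxE.
    case: eqVneq => [->//|_]; case: ifP => _; first by rewrite distrC.
    by rewrite subrr normr0.
  have K0 : 0 <= C2 * 2 ^+ n.+2 * w x.
    apply: mulr_ge0; last exact: ltW.
    by rewrite mulr_ge0 ?exprn_ge0// ltW.
  rewrite -zx -zy; have [le|/ltW le] := leP (x ord0 k) (y ord0 k).
    apply: le_trans (@line_le z k _ _ (C2 * 2 ^+ n.+2 * w x) le _) _.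
      move=> s /andP[s1 s2]; apply: bd.
      by rewrite ger0_norm ?subr_ge0// distrC ger0_norm ?subr_ge0// lerB.
    rewrite ler_wpM2l//; apply: le_trans coord.
    by rewrite distrC ler_norm.
  rewrite distrC; apply: le_trans (@line_le z k _ _ (C2 * 2 ^+ n.+2 * w x) le _) _.
    move=> s /andP[s1 s2]; apply: bd.
    by rewrite distrC ger0_norm ?subr_ge0// ger0_norm ?subr_ge0// lerB.
  rewrite ler_wpM2l//; apply: le_trans coord.
  by rewrite ler_norm.
have -> : psi y - psi x = \sum_(k < n) (psi (zk k.+1) - psi (zk k)).
  by rewrite -(big_mkord xpredT (fun k => psi (zk k.+1) - psi (zk k))) telescope_sumr// zkn zk0.
apply: le_trans (ler_norm_sum _ _ _) _.
apply: le_trans (ler_sum _ (fun k _ => step k)) _.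
by rewrite sumr_const card_ord -[leLHS]mulr_natl.
Qed.

Definition psi_cst : R := 2 * C1 + n%:R * (C2 * 2 ^+ n.+2).

(** For |x - y| <= 1/2 by [psi_near]; otherwise 1 <= 2 |x - y| turns the size bound into a Lipschitz
    one, whence the term 2 C1. *)
Let psi_lip x y : `|psi x - psi y| <= psi_cst * enorm (x - y) * (w x + w y).
Proof.
have e0 := enorm_ge0 (x - y).
have ww : 0 <= w x + w y by rewrite addr_ge0 ?(ltW (w0 _)).
have c20 : 0 <= n%:R * (C2 * 2 ^+ n.+2).
  by rewrite mulr_ge0// mulr_ge0 ?exprn_ge0// ltW.
have c10 : 0 <= 2 * C1 by rewrite mulr_ge0// ltW.
rewrite /psi_cst 2!mulrDl; have [xy|/ltW xy] := leP (enorm (x - y)) 2^-1.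
  rewrite distrC; apply: le_trans (psi_near xy) _; apply: ler_wpDl.
    by rewrite !mulr_ge0 ?(ltW C1_gt0).
  rewrite [leLHS](_ : _ = n%:R * (C2 * 2 ^+ n.+2) * enorm (x - y) * w x); last by ring.
  apply: ler_wpM2l; first exact: mulr_ge0.
  by rewrite lerDl ltW.
apply: ler_wpDr; first by rewrite mulr_ge0// mulr_ge0.
apply: (@le_trans _ _ (C1 * w x + C1 * w y)).
  by apply: le_trans (ler_normB _ _) _; exact: lerD.
rewrite -mulrDr ler_wpM2r// mulrAC ler_peMl ?(ltW C1_gt0)//; lra.
Qed.

Lemma dilate_wker t x : 0 < t -> t ^- n * w (t^-1 *: x) = wker t x.
Proof.
move=> t0; rewrite /w /wker enormZ ger0_norm ?invr_ge0 ?(ltW t0)//.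
have e0 : t + enorm x != 0 by rewrite gt_eqF// ltr_wpDr ?enorm_ge0.
have -> : 1 + t^-1 * enorm x = (t + enorm x) / t by field; rewrite gt_eqF.
rewrite exprMn exprVn invfM invrK [t ^+ n.+1]exprS.
have := expf_neq0 n (lt0r_neq0 t0); have := expf_neq0 n.+1 e0.
by move: (t ^+ n) (_ ^+ n.+1) => u v v0 u0; field; rewrite u0 v0.
Qed.

Lemma dilate_square_kernel : square_kernel (dilate psi) psi_cst.
Proof.
have mpsi : measurable_fun [set: 'rV[R]_n] psi.
  by apply/measurable_EFinP; exact: (measurable_int _ psi_L1).
have c20 : 0 <= n%:R * (C2 * 2 ^+ n.+2).
  by rewrite mulr_ge0// mulr_ge0 ?exprn_ge0// ltW.
have C10 := ltW C1_gt0.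
have tn0 t : 0 < t -> 0 <= t ^- n by move=> t0; rewrite invr_ge0 exprn_ge0// ltW.
split.
- apply: measurable_funM.
    apply: (@measurableT_comp _ _ _ _ _ _ (@GRing.inv R)); first exact: measurable_inv.
    exact: measurable_funX.
  apply: (@measurableT_comp _ _ _ _ _ _ psi) => //.
  exact: (measurableT_comp measurable_scalerV (measurable_fun_pair
    (measurableT_comp (@measurable_inv R) measurable_fst) measurable_snd)).
- by rewrite addr_ge0// mulr_ge0.
- move=> t x t0; rewrite /dilate normrM (ger0_norm (tn0 t t0)).
  rewrite -dilate_wker// mulrCA ler_wpM2l ?tn0//.
  apply: le_trans (psi_size _) _; rewrite -/(w _) ler_wpM2r ?(ltW (w0 _))//.
  by rewrite /psi_cst; lra.
- move=> t x y t0; rewrite /dilate -mulrBr normrM (ger0_norm (tn0 t t0)).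
  rewrite -!dilate_wker// -mulrDr mulrCA ler_wpM2l ?tn0//.
  apply: le_trans (psi_lip _ _) _.
  by rewrite -scalerBr enormZ ger0_norm ?invr_ge0 ?(ltW t0)// [t^-1 * _]mulrC.
- move=> t x t0.
  rewrite /Rintegral; under eq_integral do rewrite EFinM.
  rewrite integralZl//; last first.
    have m1 : measurable_fun [set: 'rV[R]_n] (fun y => psi (t^-1 *: (x - y))).
      by apply: measurableT_comp => //; exact: measurable_affine_rV.
    apply: integrable_abs_lty => //.
    rewrite (ge0_integral_affine x t0 (g := fun y => `|psi y|%:E))//.
      rewrite lte_mul_pinfty//; first by rewrite lee_fin exprn_ge0// ltW.
      by have /integrableP[_] := psi_L1.
    by apply/measurable_EFinP; exact: measurableT_comp.
  by rewrite integral_affine// psi_mean0 !mule0.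
Qed.

End kernel_of_psi.

(** * Oscillation of the square function *)

Section blo_bound.
Context {R : realType} {n : nat}.
Hypothesis n_gt0 : (0 < n)%N.
Local Notation mu := (@lebesgue_rV R n).
Local Notation leb := (@lebesgue_measure R).
Implicit Types (x y z c : 'rV[R]_n) (s t r : R).

Variables (p : R -> 'rV[R]_n -> R) (A : R).
Hypothesis pA : square_kernel p A.
Variables (f : 'rV[R]_n -> R) (N : R).
Hypothesis fN : bmo_le f N.
Hypothesis N_gt0 : 0 < N.

Local Notation G := (fun x => sqrte (energy p f `]0%R, +oo[%classic x)).
Let S r x := energy p f `]0%R, r]%classic x.
(** Bounds G x - G x' on a ball of radius [r] independently of x', and is linear in the local
    energy. *)
Let U r x := (S r x * N^-1%:E + (@osc_cst R n A * N)%:E)%E.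

Definition blo_cst : R := @carleson_cst R n A + @osc_cst R n A.

Let mS r : measurable_fun [set: 'rV[R]_n] (S r).
Proof. by apply: (measurable_energy pA fN); exact: measurable_itv. Qed.

Let S0 r x : (0 <= S r x)%E.
Proof. by apply: energy_ge0 => t /=; rewrite in_itv/= => /andP[]. Qed.

Let GU c r x x' : 0 < r -> eball c r x -> eball c r x' -> (G x <= U r x + G x')%E.
Proof. exact: (energy_compare n_gt0 pA fN N_gt0). Qed.

Let osc0 : 0 <= @osc_cst R n A :> R.
Proof.
rewrite /osc_cst addr_ge0// mulr_ge0// addr_ge0// mulr_ge0// mulr_ge0//.
exact: (smooth_cst_ge0 pA).
Qed.

Let U0 r x : (0 <= U r x)%E.
Proof.
rewrite adde_ge0 ?lee_fin ?mulr_ge0 ?(ltW N_gt0)//.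
by rewrite mule_ge0// lee_fin invr_ge0 ltW.
Qed.

Let int_U c r : 0 < r ->
  (\int[mu]_(x in eball c r) U r x <= (blo_cst * N * ball_vol c r)%:E)%E.
Proof.
move=> r0; have mB := measurable_eball c r.
have Nv0 : (0 <= N^-1%:E)%E by rewrite lee_fin invr_ge0 ltW.
rewrite ge0_integralD//; last 3 first.
- by move=> x _; rewrite mule_ge0.
- by apply: measurable_funTS; apply: emeasurable_funM.
- by move=> x _; rewrite lee_fin mulr_ge0// ltW.
rewrite ge0_integralZr//; last exact: measurable_funTS.
rewrite integral_cst// [X in (_ + _ * X)%E]lebesgue_eball//.
apply: le_trans (leeD2r _ (lee_wpmul2r Nv0 (carleson n_gt0 pA fN N_gt0 c r0))) _.
rewrite -!EFinM -EFinD lee_fin le_eqVlt; apply/orP; left; apply/eqP.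
by rewrite /blo_cst; field; rewrite gt_eqF.
Qed.

Let S_ae c r : 0 < r -> {ae mu, forall x, eball c r x -> (S r x < +oo)%E}.
Proof.
move=> r0; have mB := measurable_eball c r.
have Si : mu.-integrable (eball c r) (S r).
  apply/integrableP; split; first exact: measurable_funTS.
  under eq_integral do rewrite gee0_abs//.
  by apply: le_lt_trans (carleson n_gt0 pA fN N_gt0 c r0) _; exact: ltry.
by apply: filterS (integrable_ae mB Si) => x /[apply]; rewrite fin_numElt => /andP[].
Qed.

Lemma square_dichotomy : (forall x, G x = +oo%E) \/ {ae mu, forall x, (G x < +oo)%E}.
Proof.
have [?|/existsNP[x0 /eqP Gx0]] := pselect (forall x, G x = +oo%E); first by left.
right.
have : forall k : nat, {ae mu, forall x, eball x0 k.+1%:R x -> (G x < +oo)%E}.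
  move=> k; apply: filterS (S_ae x0 (ltr0Sn R k)) => x /[swap] xB /(_ xB) Sx.
  have x0B : eball x0 k.+1%:R x0.
    by rewrite /eball/= subrr -(scale0r x0) enormZ normr0 mul0r.
  apply: le_lt_trans (GU _ xB x0B) _ => //.
  apply: lte_add_pinfty; last by rewrite ltey.
  apply: lte_add_pinfty; last exact: ltry.
  rewrite muleC lte_mul_pinfty//.
  by rewrite lee_fin invr_ge0 ltW.
move/ae_foralln; apply: filterS => x xk.
apply: (xk (Num.bound (enorm (x - x0)))).
rewrite /eball/= (lt_le_trans (archi_boundP (enorm_ge0 _)))//.
by rewrite ler_nat.
Qed.

Lemma square_blo c r : 0 < r ->
  (mean (eball c r) (fun x => G x - ess_inf_ball c r G) <= (blo_cst * N)%:E)%E.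
Proof.
move=> r0; have v0 := ball_vol_gt0 n_gt0 c r0.
have GE x : eball c r x -> (G x - ess_inf_ball c r G <= U r x)%E.
  move=> xB; have [->|Ufin] := eqVneq (U r x) +oo%E; first exact: leey.
  have Uf : U r x \is a fin_num by rewrite ge0_fin_numE// ltey.
  have : (G x - U r x <= ess_inf_ball c r G)%E.
    (* The measure is restricted to the ball, so the complement is null and the lower bound is
       checked at points of the ball only. *)
    apply/ess_infP; exists (~` eball c r); split.
    - by apply: measurableC; exact: measurable_eball.
    - by rewrite /= /mrestr setICl measure0.
    - move=> x' /= nGx' xB'; apply: nGx'.
      by rewrite leeBlDl//; exact: (GU r0 xB xB').
  (* For an infinite essential infimum the difference is -oo, by the convention for extended sums,
     and the bound is trivial. *)
  have [e0|e0] := eqVneq (ess_inf_ball c r G) +oo%E.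
    by move=> _; rewrite e0 /= addeNy leNye.
  have e1 : (0 <= ess_inf_ball c r G)%E by apply/ess_infP; apply: aeW => y; exact: sqrte_ge0.
  have ef : ess_inf_ball c r G \is a fin_num by rewrite ge0_fin_numE// ltey.
  by rewrite !leeBlDr// addeC.
rewrite /mean -/(ball_vol c r).
apply: (@le_trans _ _ ((ball_vol c r)^-1%:E * (blo_cst * N * ball_vol c r)%:E)%E).
  apply: lee_wpmul2l; first by rewrite lee_fin invr_ge0 ltW.
  apply: le_trans (int_U c r0); apply: le_integral_gen => //.
rewrite -EFinM lee_fin le_eqVlt; apply/orP; left; apply/eqP.
by field; rewrite gt_eqF.
Qed.

End blo_bound.

(** * Reduction to a Borel representative *)

Section borel_representative.
Context {R : realType} {n : nat}.
Hypothesis n_gt0 : (0 < n)%N.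
Local Notation mu := (@lebesgue_rV R n).
Local Notation leb := (@lebesgue_measure R).
Implicit Types (x y c : 'rV[R]_n) (t r : R) (f g : 'rV[R]_n -> R).

Lemma locally_integrable_ball f c r :
  locally_integrable_rV f -> (\int[mu]_(x in eball c r) `|f x|%:E < +oo)%E.
Proof.
move=> [_ fK].
pose K : set 'rV[R]_n := [set v | forall i, `[c ord0 i - r, c ord0 i + r]%classic (v ord0 i)].
have cK : compact K.
  apply: (@rV_compact _ n (fun i => `[c ord0 i - r, c ord0 i + r]%classic)) => i.
  exact: segment_compact.
apply: le_lt_trans (fK K cK); rewrite [leLHS]integral_mkcond [leRHS]integral_mkcond.
apply: le_integral_gen => x _; rewrite /patch; first by case: ifP.
case: ifPn => [/set_mem xB|_]; last by case: ifP => // _; rewrite -[point]/(0%E : \bar R).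
rewrite mem_set// => i /=; rewrite in_itv/= -ler_distl.
apply: le_trans (ltW xB); rewrite distrC.
by have := ler_coord_enorm (x - c) i; rewrite !mxE distrC.
Qed.

Lemma eq_mean (M B : set 'rV[R]_n) (F G : 'rV[R]_n -> \bar R) :
  measurable M -> mu M = 0%E -> (forall x, ~ M x -> F x = G x) -> mean B F = mean B G.
Proof. by move=> mM M0 FG; rewrite /mean (integral_null_eq B mM M0 FG). Qed.

Lemma BMO_norm_ge0 f : (0 <= BMO_norm f)%E.
Proof.
apply: (@le_trans _ _ (mean (eball 0 1) (fun x => `|(f x)%:E - mean (eball 0 1) (EFin \o f)|)%E)).
  apply: mule_ge0; last exact: integral_ge0.
  by rewrite lee_fin invr_ge0 fine_ge0.
apply: ereal_sup_ubound; exists (0 : 'rV[R]_n) => //.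
by exists 1 => //=; exact: ltr01.
Qed.

(** The representative is chosen before [N], so the same [g] serves every bound [N] of the norm. *)
Lemma BMO_borel f : BMO f -> exists g M, [/\ measurable M, mu M = 0%E,
  forall x, ~ M x -> f x = g x &
  forall N : R, (BMO_norm f <= N%:E)%E -> bmo_le g N].
Proof.
move=> [fL _]; have [g [M [mg mM M0 fg]]] := completed_measurable_borel fL.1.
exists g, M; split=> // N fN.
have gi c r : mu.-integrable (eball c r) (EFin \o g).
  apply: integrable_abs_lty; first exact: measurable_funTS.
  rewrite -(integral_null_eq (f := fun x => `|f x|%:E) _ mM M0); last first.
    by move=> x /fg ->.
  exact: locally_integrable_ball.
split=> // c r r0.
have mB := measurable_eball c r.
have v0 := ball_vol_gt0 n_gt0 c r0.
have mE : mean (eball c r) (EFin \o f) = (ball_avg g c r)%:E.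
  rewrite (eq_mean _ mM M0 (G := EFin \o g)); last by move=> x /fg /= ->.
  by rewrite /mean -/(ball_vol c r) EFinM fineK// integrable_fin_num.
have I0 : (0 <= \int[mu]_(y in eball c r) `|g y - ball_avg g c r|%:E)%E.
  exact: integral_ge0.
have : (mean (eball c r) (fun x => `|(f x)%:E - mean (eball c r) (EFin \o f)|) <= N%:E)%E.
  apply: le_trans fN; apply: ereal_sup_ubound.
  by exists c => //; exists r.
rewrite mE (eq_mean _ mM M0 (G := fun y => `|g y - ball_avg g c r|%:E)); last first.
  by move=> x /fg ->.
rewrite /mean -/(ball_vol c r) lee_pdivrMl// => IN.
rewrite mulrC -lee_fin fineK//.
by rewrite ge0_fin_numE// (le_lt_trans IN)// ltry.
Qed.

(** A null set does not affect the convolution integrals, so the equality holds at every [x], as the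
    alternative of being infinite everywhere requires. *)
Lemma square_fun_energy (psi f g : 'rV[R]_n -> R) (A N : R) (M : set 'rV[R]_n) x :
  square_kernel (dilate psi) A -> bmo_le g N ->
  measurable M -> mu M = 0%E -> (forall x, ~ M x -> f x = g x) ->
  square_fun psi f x = sqrte (energy (dilate psi) g `]0%R, +oo[%classic x).
Proof.
move=> pA gN mM M0 fg; congr sqrte; apply: eq_integral => t /set_mem/=.
rewrite in_itv/= andbT => t0.
rewrite /convolution (integral_null_eq _ mM M0
  (g := fun y => (dilate psi t (x - y) * g y)%:E)); last by move=> y /fg ->.
rewrite (EFin_kconv n_gt0 pA gN)//.
by rewrite abse_EFin -!EFinM -normrM -expr2 ger0_norm ?sqr_ge0.
Qed.

End borel_representative.

Theorem theorem1p6 (R : realType) (n : nat) (psi : 'rV[R]_n -> R) (C1 C2 : R)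
  (n_gt0 : (0 < n)%N) (C1_gt0 : 0 < C1) (C2_gt0 : 0 < C2)
  (psi_L1 : (@lebesgue_rV R n).-integrable setT (EFin \o psi))
  (psi_mean0 : (\int[@lebesgue_rV R n]_x (psi x)%:E = 0)%E)
  (psi_size : forall x, `|psi x| <= C1 * (1 + enorm x) ^- n.+1)
  (psi_derivable : forall x (i : 'I_n), derivable psi x (delta_mx ord0 i))
  (psi_smooth : forall x, enorm (gradient psi x) <= C2 * (1 + enorm x) ^- n.+2) :
  exists2 C : R, 0 < C & forall f : 'rV[R]_n -> R, BMO f ->
    ((forall x, square_fun psi f x = +oo%E) \/
     {ae lebesgue_rV, forall x, (square_fun psi f x < +oo)%E}) /\
    ({ae lebesgue_rV, forall x, (square_fun psi f x < +oo)%E} ->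
     (BLO_norm (square_fun psi f) <= C%:E * BMO_norm f)%E).
Proof.
have pA := dilate_square_kernel C1_gt0 C2_gt0 psi_L1 psi_mean0 psi_size
  psi_derivable psi_smooth.
set A := psi_cst _ _ in pA.
(* The maximum with 1 makes the constant positive, which also permits the division by [C] below. *)
exists (Num.max 1 (@blo_cst R n A)) => [|f fBMO].
  by rewrite lt_max ltr01.
set C := Num.max _ _; have C0 : 0 < C by rewrite lt_max ltr01.
have [g [M [mM M0 fg gN]]] := BMO_borel n_gt0 fBMO.
have bfin : BMO_norm f \is a fin_num by rewrite ge0_fin_numE ?BMO_norm_ge0//; case: fBMO.
have [b bE] : exists b : R, BMO_norm f = b%:E.
  by exists (fine (BMO_norm f)); rewrite fineK.
have b0 : 0 <= b by rewrite -lee_fin -bE BMO_norm_ge0.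
have gN' N : b <= N -> bmo_le g N by move=> bN; apply: gN; rewrite bE lee_fin.
have sqE : square_fun psi f =
    fun x => sqrte (energy (dilate psi) g `]0%R, +oo[%classic x).
  apply/funext => x.
  exact: (square_fun_energy n_gt0 x pA (gN' b (lexx b)) mM M0 fg).
rewrite sqE; split.
  (* Any positive bound of the norm serves here; [b + 1] is positive even if the norm is 0. *)
  have b1 : b <= b + 1 by rewrite lerDl.
  have b10 : 0 < b + 1 by rewrite ltr_wpDl.
  exact: (square_dichotomy n_gt0 pA (gN' _ b1) b10).
move=> _; rewrite bE; apply/lee_addgt0Pr => e e0.
(* This [N] is positive even for b = 0, and C N = C b + e with [e] arbitrarily small. *)
have N0 : 0 < b + e / C by rewrite ltr_wpDl// divr_gt0.
have bN : b <= b + e / C by rewrite lerDl ltW// divr_gt0.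
apply: ereal_inf_lbound; exists (C * (b + e / C)); last first.
  by rewrite -EFinM -EFinD; congr (_%:E); field; rewrite gt_eqF.
move=> c r r0; apply: le_trans (square_blo n_gt0 pA (gN' _ bN) N0 c r0) _.
by rewrite lee_fin ler_wpM2r ?(ltW N0)// le_max lexx orbT.
Qed.
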